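(* Let $\mathcal{K}$ be a Fraïssé class in a relational language, $\mathcal{M}$ its Fraïssé limit with universe $M$ and $G=\mathrm{Aut}(\mathcal{M})$. The Zariski topology on $G$ is not a group topology in each of the following cases: (1) $\mathcal{K}$ is a non-trivial free amalgamation class and the action of $G$ on $M$ is transitive; (2) $\mathcal{M}$ is the rational Urysohn space; (3) $\mathcal{M}$ is the random tournament; (4) $\mathcal{K}=\mathcal{K}_1\otimes\mathcal{K}_2$ for Fraïssé classes $\mathcal{K}_1,\mathcal{K}_2$ with strong amalgamation, where $\mathcal{K}_1$ is non-trivial and either $\mathcal{K}_1$ is as in (2) or the action of $\mathrm{Aut}(\mathcal{M}_1)$ on $\{(a,b)\in M_1^2: a\neq b\}$ is transitive ($\mathcal{M}_1$ the Fraïssé limit of $\mathcal{K}_1$, with universe $M_1$), and the Fraïssé limit of $\mathcal{K}_2$ is the countable dense meet tree, the cyclic tournament $S(2)$, or $(\mathbb{Q},<)$.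
   Context: Zariski topology: for a group $G$, the topology with subbase the sets $\{x\in G: x^{\epsilon_1}g_1x^{\epsilon_2}g_2\cdots x^{\epsilon_n}g_n\neq 1\}$, $n\in\mathbb{N}$, $g_i\in G$, $\epsilon_i\in\{1,-1\}$. A Fraïssé class is a class of finite structures in a relational language, closed under isomorphism, with the hereditary, joint embedding and amalgamation properties; it has strong amalgamation if amalgams can be chosen with the images of the two factors intersecting exactly in the image of the base. Its Fraïssé limit is the unique countable ultrahomogeneous structure with that class as its age. $\mathcal{K}$ is trivial if the equality type of any finite tuple of the limit determines its type (equivalently, the automorphism group is the full symmetric group). For $A\subseteq B,C$, the free amalgam $B\otimes_A C$ is the structure on $B\sqcup_A C$ in which a relation holds iff it holds in $B$ or in $C$; a free amalgamation class is a class of finite relational structures closed under substructures and free amalgams. The rational Urysohn space is the Fraïssé limit of the class of finite metric spaces with rational distances, in the language $\{R_q: q\in\mathbb{Q}_{\geq0}\}$ with $R_q(x,y)\iff d(x,y)\leq q$. A tournament is a digraph with exactly one directed edge between any two distinct vertices; the random tournament is the Fraïssé limit of all finite tournaments. $S(2)$ is the countable homogeneous tournament consisting of points of the unit circle at rational angles, no two antipodal, with $x\to y$ iff the counterclockwise angle from $x$ to $y$ is less than $\pi$. For Fraïssé classes $\mathcal{K}_i$ in disjoint finite relational languages $\mathfrak{L}_i$, $\mathcal{K}_1\otimes\mathcal{K}_2$ is the class of finite $\mathfrak{L}_1\cup\mathfrak{L}_2$-structures whose $\mathfrak{L}_i$-reduct lies in $\mathcal{K}_i$ for $i=1,2$.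 A meet tree is a partial order $(T,\leq)$ in which each $\{s: s\leq t\}$ is linearly ordered and any two elements have a greatest common lower bound; it is dense if each $\{s: s\leq t\}$ is dense without least element and every point is the meet of infinitely many pairs; the countable dense meet tree is the countable such structure. *)

(* Defs.v *)
From HB Require Import structures.
From mathcomp Require Import all_boot all_order all_algebra.
From mathcomp Require Import all_classical topology.

Set Implicit Arguments.
Unset Strict Implicit.
Unset Printing Implicit Defensive.

Import Order.TTheory GRing.Theory Num.Theory.

Local Open Scope classical_set_scope.

(* Function symbols are needed only for meet trees, whose finitely generated
   substructures are the finite subsets closed under meets. *)
Record language := Language {
  rel_sym : Type;
  rel_ar : rel_sym -> nat;
  fun_sym : Type;
  fun_ar : fun_sym -> nat
}.

Definition relational (L : language) : Prop := fun_sym L -> False.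

Definition finite_language (L : language) : Prop :=
  finite_set [set: rel_sym L] /\ finite_set [set: fun_sym L].

Record structure (L : language) := Structure {
  carrier :> Type;
  rel_in : forall R : rel_sym L, ('I_(rel_ar R) -> carrier) -> Prop;
  fun_in : forall f : fun_sym L, ('I_(fun_ar f) -> carrier) -> carrier
}.

Definition str_class (L : language) := structure L -> Prop.

Definition embedding (L : language) (A B : structure L) (h : A -> B) : Prop :=
  [/\ injective h,
      forall (R : rel_sym L) (t : 'I_(rel_ar R) -> A),
        rel_in (fun i => h (t i)) <-> rel_in t
    & forall (f : fun_sym L) (t : 'I_(fun_ar f) -> A),
        h (fun_in t) = fun_in (fun i => h (t i))].

Definition isomorphic (L : language) (A B : structure L) : Prop :=
  exists2 h : A -> B, embedding h & bijective h.

Definition finite_str (L : language) (A : structure L) : Prop :=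
  finite_set [set: A].

Record aut (L : language) (M : structure L) := Aut {
  aut_fun :> M -> M;
  aut_embedding : embedding aut_fun;
  aut_bijective : bijective aut_fun
}.

Section AutGroup.
Variables (L : language) (M : structure L).
Implicit Types f g h : aut M.

Lemma aut_ext f g : aut_fun f =1 aut_fun g -> f = g.
Proof.
case: f g => [f f1 f2] [g g1 g2] /= /funext E; case: g / E g1 g2 => g1 g2.
by congr Aut; exact: Prop_irrelevance.
Qed.

HB.instance Definition _ := gen_eqMixin (aut M).
HB.instance Definition _ := gen_choiceMixin (aut M).

Lemma embedding_id : embedding (@id M). Proof. by split. Qed.

Definition aut1 : aut M := Aut embedding_id (Bijective (frefl id) (frefl id)).

Lemma embedding_comp f g : embedding (fun x => f (g x)).
Proof.
case: (aut_embedding f) (aut_embedding g) => fi fr ff [gi gr gf]; split.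
- by move=> x y /fi /gi.
- by move=> R t; rewrite fr gr.
- by move=> s t; rewrite gf ff.
Qed.

Definition aut_mul f g : aut M :=
  Aut (embedding_comp f g) (bij_comp (aut_bijective f) (aut_bijective g)).

Lemma aut_has_inv f : exists g : M -> M, cancel f g /\ cancel g f.
Proof. by case: (aut_bijective f) => g fK gK; exists g. Qed.

Definition aut_inv_fun f : M -> M := projT1 (cid (aut_has_inv f)).

Lemma aut_funK f : cancel f (aut_inv_fun f).
Proof. by rewrite /aut_inv_fun; case: (cid _) => g /= []. Qed.

Lemma aut_inv_funK f : cancel (aut_inv_fun f) f.
Proof. by rewrite /aut_inv_fun; case: (cid _) => g /= []. Qed.

Lemma embedding_inv f : embedding (aut_inv_fun f).
Proof.
case: (aut_embedding f) => fi fr ff; split.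
- exact: can_inj (aut_inv_funK f).
- move=> R t; rewrite -fr (_ : (fun i => _) = t) //.
  by apply/funext => i; rewrite aut_inv_funK.
- move=> s t; apply: fi; rewrite aut_inv_funK ff; congr fun_in.
  by apply/funext => i; rewrite aut_inv_funK.
Qed.

Definition aut_inv f : aut M :=
  Aut (embedding_inv f) (Bijective (aut_inv_funK f) (aut_funK f)).

Lemma aut_mulA : associative aut_mul.
Proof. by move=> f g h; exact: aut_ext. Qed.
Lemma aut_mul1 : left_id aut1 aut_mul.
Proof. by move=> f; exact: aut_ext. Qed.
Lemma aut_1mul : right_id aut1 aut_mul.
Proof. by move=> f; exact: aut_ext. Qed.
Lemma aut_mulV : left_inverse aut1 aut_inv aut_mul.
Proof. by move=> f; apply: aut_ext => x /=; rewrite aut_funK. Qed.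
Lemma aut_Vmul : right_inverse aut1 aut_inv aut_mul.
Proof. by move=> f; apply: aut_ext => x /=; rewrite aut_inv_funK. Qed.

HB.instance Definition _ :=
  isGroup.Build (aut M) aut_mulA aut_mul1 aut_1mul aut_mulV aut_Vmul.

End AutGroup.

Definition point_transitive (L : language) (M : structure L) : Prop :=
  forall a b : M, exists g : aut M, g a = b.

Definition pair_transitive (L : language) (M : structure L) : Prop :=
  forall a b a' b' : M, a <> b -> a' <> b' ->
    exists g : aut M, g a = a' /\ g b = b'.

Section Zariski.
Local Open Scope group_scope.

(* The pair (true, g) stands for the factor x * g, (false, g) for x^-1 * g. *)
Definition word_eval (G : groupType) (w : seq (bool * G)) (x : G) : G :=
  \prod_(eg <- w) ((if eg.1 then x else x^-1) * eg.2).

Definition zariski_subbase (G : groupType) : set (set G) :=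
  [set A | exists w : seq (bool * G), A = [set x | word_eval w x <> 1]].

Definition zariski (G : groupType) : Type := G.

HB.instance Definition _ (G : groupType) := Group.on (zariski G).
HB.instance Definition _ (G : groupType) :=
  isSubBaseTopological.Build (zariski G) (@zariski_subbase G) id.

Definition zariski_is_group_topology (G : groupType) : Prop :=
  continuous (fun p : zariski G * zariski G => p.1 * p.2 : zariski G) /\
  continuous (fun x : zariski G => x^-1 : zariski G).

End Zariski.

Definition iso_closed (L : language) (K : str_class L) : Prop :=
  forall A B : structure L, isomorphic A B -> K A -> K B.

Definition hereditary (L : language) (K : str_class L) : Prop :=
  forall (A B : structure L) (h : A -> B), embedding h -> K B -> K A.

Definition joint_embedding (L : language) (K : str_class L) : Prop :=
  forall A B : structure L, K A -> K B ->
    exists C : structure L, [/\ K C, exists i : A -> C, embedding i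
                              & exists j : B -> C, embedding j].

Definition amalgamation (L : language) (K : str_class L) : Prop :=
  forall (A B C : structure L) (f : A -> B) (g : A -> C),
    K A -> K B -> K C -> embedding f -> embedding g ->
    exists (D : structure L) (i : B -> D) (j : C -> D),
      [/\ K D, embedding i, embedding j & forall a, i (f a) = j (g a)].

Definition strong_amalgamation (L : language) (K : str_class L) : Prop :=
  forall (A B C : structure L) (f : A -> B) (g : A -> C),
    K A -> K B -> K C -> embedding f -> embedding g ->
    exists (D : structure L) (i : B -> D) (j : C -> D),
      [/\ K D, embedding i, embedding j, forall a, i (f a) = j (g a)
        & forall b c, i b = j c -> exists2 a, b = f a & c = g a].

Definition fraisse_class (L : language) (K : str_class L) : Prop :=
  [/\ forall A, K A -> finite_str A, iso_closed K, hereditary K,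
      joint_embedding K & amalgamation K].

Definition age (L : language) (M : structure L) : str_class L :=
  fun A => finite_str A /\ exists h : A -> M, embedding h.

Definition ultrahomogeneous (L : language) (M : structure L) : Prop :=
  forall (A : structure L) (f g : A -> M),
    finite_str A -> embedding f -> embedding g ->
    exists s : aut M, forall a, s (f a) = g a.

(* Automatic in a relational language; with function symbols it makes the
   finitely generated substructures the finite ones. *)
Definition locally_finite (L : language) (M : structure L) : Prop :=
  forall X : set M, finite_set X ->
    exists Y : set M, [/\ finite_set Y, X `<=` Y
      & forall (f : fun_sym L) (t : 'I_(fun_ar f) -> M),
          (forall i, Y (t i)) -> Y (fun_in t)].

Definition fraisse_limit (L : language) (K : str_class L) (M : structure L) :
    Prop :=
  [/\ countable [set: M], locally_finite M, ultrahomogeneous M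
    & forall A, K A <-> age M A].

Inductive term (L : language) (n : nat) : Type :=
| TVar of 'I_n
| TApp (f : fun_sym L) of ('I_(fun_ar f) -> term L n).

(* [formula L n] has its free variables among the first [n]; [FAll] binds
   variable 0 and shifts the others. *)
Inductive formula (L : language) : nat -> Type :=
| FEq n of term L n & term L n : formula L n
| FRel n (R : rel_sym L) of ('I_(rel_ar R) -> term L n) : formula L n
| FNeg n of formula L n : formula L n
| FAnd n of formula L n & formula L n : formula L n
| FAll n of formula L n.+1 : formula L n.

Section Satisfaction.
Variables (L : language) (M : structure L).

Fixpoint term_eval n (v : 'I_n -> M) (u : term L n) : M :=
  match u with
  | TVar i => v i
  | TApp f ts => fun_in (fun i => term_eval v (ts i))
  end.

Definition scons n (x : M) (v : 'I_n -> M) : 'I_n.+1 -> M :=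
  fun i => oapp v x (unlift ord0 i).

Fixpoint sat n (phi : formula L n) : ('I_n -> M) -> Prop :=
  match phi with
  | FEq _ u1 u2 => fun v => term_eval v u1 = term_eval v u2
  | FRel _ R ts => fun v => @rel_in L M R (fun i => term_eval v (ts i))
  | FNeg _ p => fun v => ~ sat p v
  | FAnd _ p q => fun v => sat p v /\ sat q v
  | FAll _ p => fun v => forall x, sat p (scons x v)
  end.

Definition same_equality_type n (a b : 'I_n -> M) : Prop :=
  forall i j, a i = a j <-> b i = b j.

Definition same_type n (a b : 'I_n -> M) : Prop :=
  forall phi : formula L n, sat phi a <-> sat phi b.

(* A Fraisse class is trivial when its limit [M] satisfies this. *)
Definition trivial_structure : Prop :=
  forall n (a b : 'I_n -> M), same_equality_type a b -> same_type a b.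

End Satisfaction.

(* D, with the maps i and j, is B \otimes_A C up to isomorphism; A is embedded
   in B by f and in C by g. *)
Definition free_amalgam (L : language) (A B C D : structure L)
    (f : A -> B) (g : A -> C) (i : B -> D) (j : C -> D) : Prop :=
  [/\ injective i /\ injective j,
      forall a, i (f a) = j (g a),
      forall b c, i b = j c -> exists2 a, b = f a & c = g a,
      forall d, (exists b, i b = d) \/ (exists c, j c = d)
    & forall (R : rel_sym L) (t : 'I_(rel_ar R) -> D), rel_in t <->
        (exists2 s : 'I_(rel_ar R) -> B, (forall k, i (s k) = t k) & rel_in s)
        \/
        (exists2 s : 'I_(rel_ar R) -> C, (forall k, j (s k) = t k) & rel_in s)].

Definition free_amalgamation_class (L : language) (K : str_class L) : Prop :=
  [/\ relational L, forall A, K A -> finite_str A, hereditary K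
    & forall (A B C D : structure L) (f : A -> B) (g : A -> C)
        (i : B -> D) (j : C -> D),
        K B -> K C -> embedding f -> embedding g ->
        free_amalgam f g i j -> K D].

Section Metric.
Local Open Scope ring_scope.

Definition metric_language : language :=
  Language (fun _ : {q : rat | 0 <= q} => 2%N) (of_void nat).

Definition tuple2 (T : Type) (x y : T) : 'I_2 -> T :=
  fun i => if i == ord0 then x else y.

Definition rational_metric (T : Type) (d : T -> T -> rat) : Prop :=
  [/\ forall x y, 0 <= d x y, forall x y, d x y = 0 <-> x = y,
      forall x y, d x y = d y x & forall x y z, d x z <= d x y + d y z].

Definition finite_rational_metric_spaces : str_class metric_language :=
  fun A => finite_str A /\ exists2 d : A -> A -> rat, rational_metric d &
    forall (q : rel_sym metric_language) (x y : A),
      @rel_in _ A q (tuple2 x y) <-> d x y <= sval q.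

End Metric.

(* The predicates of this shape are indexed by the language, so that they can
   be applied to structures in a variable language. *)
Variant rational_urysohn_space : forall L : language, structure L -> Prop :=
| RationalUrysohnSpace (M : structure metric_language) of
    fraisse_limit finite_rational_metric_spaces M : rational_urysohn_space M.

Definition binary_language : language :=
  Language (fun _ : unit => 2%N) (of_void nat).

Definition edge (M : structure binary_language) (x y : M) : Prop :=
  @rel_in _ M tt (tuple2 x y).

Definition tournament (M : structure binary_language) : Prop :=
  (forall x : M, ~ edge x x) /\
  (forall x y : M, x <> y ->
     (edge x y /\ ~ edge y x) \/ (edge y x /\ ~ edge x y)).

Definition finite_tournaments : str_class binary_language :=
  fun A => finite_str A /\ tournament A.

Variant random_tournament : forall L : language, structure L -> Prop :=
| RandomTournament (M : structure binary_language) of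
    fraisse_limit finite_tournaments M : random_tournament M.

Section CircularTournament.
Local Open Scope ring_scope.

(* [theta x] is the angle of the point x, in turns (one turn being 2 pi), so
   that antipodal points differ by half a turn, and the counterclockwise angle
   from x to y is theta y - theta x modulo 1. The points are dense in the
   circle: homogeneity alone would allow, e.g., three equidistant points. *)
Definition circular_tournament (M : structure binary_language) : Prop :=
  exists theta : M -> rat,
    [/\ injective theta,
        forall x, 0 <= theta x < 1,
        forall x y, theta x - theta y <> 1 / 2,
        forall p q : rat, 0 <= p -> p < q -> q <= 1 ->
          exists x, p < theta x < q
      & forall x y, edge x y <->
          exists k : int, 0 < theta y - theta x + k%:~R < 1 / 2].

Definition rat_order : structure binary_language :=
  @Structure binary_language rat
    (fun _ t => t ord0 < t (lift ord0 ord0)) (fun f : void => match f with end).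

End CircularTournament.

Variant is_S2 : forall L : language, structure L -> Prop :=
| IsS2 (M : structure binary_language) of
    countable [set: M] & ultrahomogeneous M & circular_tournament M : is_S2 M.

Variant is_rat_order : forall L : language, structure L -> Prop :=
| IsRatOrder (M : structure binary_language) of
    isomorphic M rat_order : is_rat_order M.

Definition meet_language : language :=
  Language (fun _ : unit => 2%N) (fun _ : unit => 2%N).

Section MeetTree.
Variable T : structure meet_language.

Definition tle (x y : T) : Prop := @rel_in _ T tt (tuple2 x y).
Definition tlt (x y : T) : Prop := tle x y /\ x <> y.
Definition tmeet (x y : T) : T := @fun_in _ T tt (tuple2 x y).

Definition meet_tree : Prop :=
  [/\ forall x, tle x x,
      forall x y, tle x y -> tle y x -> x = y,
      forall x y z, tle x y -> tle y z -> tle x z,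
      forall t x y, tle x t -> tle y t -> tle x y \/ tle y x
    & forall x y, [/\ tle (tmeet x y) x, tle (tmeet x y) y
                    & forall z, tle z x -> tle z y -> tle z (tmeet x y)]].

(* The last clause says that infinitely many cones branch at t: t is the meet
   of any two members of an infinite family of points above it. Counting
   arbitrary pairs would be void, since t is the meet of t and any s above t. *)
Definition dense_meet_tree : Prop :=
  [/\ meet_tree,
      forall t x y, tle y t -> tlt x y -> exists z, tlt x z /\ tlt z y,
      forall t x, tle x t -> exists z, tlt z x
    & forall t, exists s : nat -> T,
        (forall n, tlt t (s n)) /\ forall m n, m <> n -> tmeet (s m) (s n) = t].

End MeetTree.

Variant countable_dense_meet_tree :
    forall L : language, structure L -> Prop :=
| CountableDenseMeetTree (T : structure meet_language) of
    countable [set: T] & inhabited T & dense_meet_tree T :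
    countable_dense_meet_tree T.

(* The union of two disjoint languages. *)
Definition language_sum (L1 L2 : language) : language :=
  Language
    (fun R : rel_sym L1 + rel_sym L2 =>
       match R with inl R1 => rel_ar R1 | inr R2 => rel_ar R2 end)
    (fun f : fun_sym L1 + fun_sym L2 =>
       match f with inl f1 => fun_ar f1 | inr f2 => fun_ar f2 end).

Definition reduct1 (L1 L2 : language) (M : structure (language_sum L1 L2)) :
    structure L1 :=
  @Structure L1 M (fun R => @rel_in _ M (inl R)) (fun f => @fun_in _ M (inl f)).

Definition reduct2 (L1 L2 : language) (M : structure (language_sum L1 L2)) :
    structure L2 :=
  @Structure L2 M (fun R => @rel_in _ M (inr R)) (fun f => @fun_in _ M (inr f)).

Definition superposition (L1 L2 : language)
    (K1 : str_class L1) (K2 : str_class L2) : str_class (language_sum L1 L2) :=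
  fun A => [/\ finite_str A, K1 (reduct1 A) & K2 (reduct2 A)].

Variant is_superposition (L1 L2 : language)
    (K1 : str_class L1) (K2 : str_class L2) :
    forall L : language, str_class L -> Prop :=
| IsSuperposition : is_superposition K1 K2 (superposition K1 K2).

(* Main.v *)
Require Import Defs.
From HB Require Import structures.
From mathcomp Require Import all_boot all_order all_algebra.
From mathcomp Require Import finmap.
From mathcomp Require Import all_classical topology.
From mathcomp Require Import lra zify.

Set Implicit Arguments.
Unset Strict Implicit.
Unset Printing Implicit Defensive.

Import Order.TTheory GRing.Theory Num.Theory.
Local Open Scope classical_set_scope.

(* No two nonempty Zariski open sets are disjoint, whereas continuity of
   (x, y) |-> x^-1 y at (1, h), h <> 1, would separate 1 from h. To make
   finitely many words nontrivial at once, follow the trajectory of a new point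
   under each reduced word, fixing x on ever larger finite sets; this works as
   soon as every g <> 1 moves some realization of every non-algebraic 1-type over
   a finite set (after avoiding finitely many points).

   That condition is proved contrapositively: if g fixes all realizations of a
   type p, one shows that g fixes all realizations of larger and larger families
   of types, because two points a and g a have the same type over the fixed
   points, and amalgamation produces a fixed point that tells them apart. In the
   superposition case K2 first frees the K1-part of p: in a meet tree, in S(2) and
   in the rational order, a <> a' can be told apart by a point arbitrarily close
   to a. Then K1 tells any two points apart by realizations of the K2-part of p. *)

(** * Finite sets and substructures *)


(** For finite [A], the automorphisms that agree with [s] on [A] form a basic open set of the
    topology of pointwise convergence. Each nonempty reduced word is shown to be nontrivial
    throughout some smaller basic open set, so that finitely many words can be treated in turn. A
    trajectory extends freely until the sign of the letter changes: in x^-1 g x the value r = x q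
    has just been fixed, and g r = r would send the trajectory back to q. Reducedness only says g <>
    1; hence the need for a value r with g r <> r.

    Function symbols are a second obstacle: homogeneity is applied to maps between finite closed
    sets, and adding one point to a closed set need not give a closed set. Therefore a closed set is
    first enlarged until the point can be added alone. In a meet tree the only point missing is the
    one where the new point branches off. *)

Lemma infinite_notin (T : Type) (S F : set T) : infinite_set S -> finite_set F ->
  exists2 x, S x & ~ F x.
Proof.
by move=> iS fF; have /infinite_setN0[x [Sx Fx]] := infinite_setD iS fF; exists x.
Qed.

Section FiniteSets.
Variable T : Type.

Lemma finite_set_ind (P : set T -> Prop) : P set0 ->
  (forall A x, finite_set A -> ~ A x -> P A -> P (x |` A)) ->
  forall A, finite_set A -> P A.
Proof.
move=> P0 PS A.
(* [finite_seqP] speaks of lists over an [eqType]; [{classic T}] provides the equality test. *)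
move=> /(@finite_seqP ({classic T} : eqType) (A : set {classic T}))[s].
elim: s A => [|x s IH] A ->.
  by rewrite (_ : [set` _] = set0) //; apply/seteqP; split.
have -> : [set` x :: s] = x |` [set` s] :> set {classic T}.
  apply/seteqP; split=> y /=; rewrite inE; first by case/orP => [/eqP|]; [left|right].
  by case=> [->|->]; rewrite ?eqxx ?orbT.
have [xs|/negP xs] := boolP (x \in s).
  rewrite (_ : _ |` _ = [set` s] :> set {classic T}); first exact: IH.
  by apply/seteqP; split=> [y [->|]|y] //=; right.
by apply: PS => //; [exact: (@finite_seq ({classic T} : eqType) s) | exact: IH].
Qed.

Lemma sval_inj (C : set T) : injective (fun x : {x | C x} => sval x).
Proof.
by move=> [x p] [y q] /= e; subst y; congr exist; exact: Prop_irrelevance.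
Qed.

Lemma finite_setT_sig (C : set T) :
  finite_set C -> finite_set [set: {x | C x}].
Proof.
move=> fC; elim/finite_set_ind: C / fC => [|A x _ nAx fA].
  by apply: sub_finite_set (finite_set0 _) => -[].
pose h (y : {y | A y}) : {y | (x |` A) y} := exist _ (sval y) (or_intror (svalP y)).
pose x0 : {y | (x |` A) y} := exist _ x (or_introl erefl).
apply: (@sub_finite_set _ _ (x0 |` (h @` setT))).
  move=> [y [yx|Ay]] _.
    by left; apply: sval_inj.
  by right; exists (exist _ y Ay) => //; apply: sval_inj.
by rewrite finite_setU; split; [exact: finite_set1|exact: finite_image].
Qed.

Lemma finite_range (I : finType) (f : I -> T) : finite_set (range f).
Proof. exact: finite_image (finite_finset). Qed.

Definition inj_on (U : Type) (E : set T) (f : T -> U) :=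
  forall x y, E x -> E y -> f x = f y -> x = y.

(** The points outside [E0] are placed in [S] one by one, each off the finite image of those before
    it. With [E0] empty this chooses finitely many distinct points of [S]. *)
Lemma extend_injection (U : Type) (E0 E : set T) (f : T -> U) (S : set U) :
  finite_set E0 -> finite_set E -> infinite_set S -> inj_on E0 f ->
  exists f' : T -> U,
    [/\ inj_on (E0 `|` E) f',
        forall x, E0 x -> f' x = f x
      & forall x, E x -> ~ E0 x -> S (f' x)].
Proof.
move=> fE0 fE iS injf.
elim/finite_set_ind: E / fE => [|E x fE nEx [f' [i1 i2 i3]]].
  by exists f; split => //; rewrite setU0.
case: (pselect (E0 x)) => [Ex|Ex].
  exists f'; split=> //.
    have sub y : (E0 `|` (x |` E)) y -> (E0 `|` E) y.
      by move=> [Ey|[->|Ey]]; [left|left|right].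
    by move=> y z /sub Ey /sub Ez; exact: i1.
  by move=> y [->|/i3].
have [u Su nu] : exists2 u, S u & ~ (f' @` (E0 `|` E)) u.
  by apply: infinite_notin => //; apply: finite_image; rewrite finite_setU.
have xN y : (E0 `|` (x |` E)) y -> y <> x -> (E0 `|` E) y.
  by move=> [Ey|[//|Ey]] _; [left|right].
exists (fun y => if pselect (y = x) then u else f' y); split.
- move=> y z Ey Ez; case: (pselect (y = x)) => yx; case: (pselect (z = x)) => zx //= e.
  + by rewrite yx zx.
  + by case: nu; exists z => //; exact: xN.
  + by case: nu; exists y => //; exact: xN.
  + by apply: i1 e; exact: xN.
- by move=> y Ey; case: pselect => yx /=; [by case: Ex; rewrite -yx|exact: i2].
- by move=> y Ey nEy; case: pselect => //= yx; case: Ey => // Ey; exact: i3.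
Qed.
End FiniteSets.

Section Substructures.
Variable L : language.
Implicit Types M N P : structure L.

Definition fun_closed M (C : set M) :=
  forall (f : fun_sym L) (t : 'I_(fun_ar f) -> M),
    (forall i, C (t i)) -> C (fun_in t).

Definition substr M (C : set M) (cC : fun_closed C) : structure L :=
  @Structure L {x | C x} (fun R t => @rel_in L M R (fun i => sval (t i)))
    (fun f t => exist _ (fun_in (fun i => sval (t i)))
                        (cC f _ (fun i => svalP (t i)))).

Lemma substr_embedding M (C : set M) (cC : fun_closed C) :
  embedding (fun x : substr cC => sval x).
Proof. by split=> //; exact: sval_inj. Qed.

(* [h] is total so that no element has to be transported between subtypes; its
   values outside [C] are irrelevant. *)
Definition embedding_on M N (C : set M) (h : M -> N) :=
  [/\ inj_on C h,
      forall (R : rel_sym L) (t : 'I_(rel_ar R) -> M), (forall i, C (t i)) ->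
        (rel_in (fun i => h (t i)) <-> rel_in t)
    & forall (f : fun_sym L) (t : 'I_(fun_ar f) -> M), (forall i, C (t i)) ->
        h (fun_in t) = fun_in (fun i => h (t i))].

Lemma embedding_on_substr M N (C : set M) (cC : fun_closed C) (h : M -> N) :
  embedding_on C h -> embedding (fun x : substr cC => h (sval x)).
Proof.
case=> [h1 h2 h3]; split.
- by move=> x y /h1 e; apply: sval_inj; apply: e; exact: svalP.
- by move=> R t; apply: h2 => i; exact: svalP.
- by move=> f t; apply: h3 => i; exact: svalP.
Qed.

Lemma embedding_onW M N (C : set M) (h : M -> N) :
  embedding h -> embedding_on C h.
Proof. by case=> [h1 h2 h3]; split => // x y _ _ /h1. Qed.

Lemma sub_embedding_on M N (C C' : set M) (h : M -> N) :
  C' `<=` C -> embedding_on C h -> embedding_on C' h.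
Proof.
move=> s [h1 h2 h3]; split.
- by move=> x y /s ? /s ?; exact: h1.
- by move=> R t Ct; apply: h2 => i; apply/s.
- by move=> R t Ct; apply: h3 => i; apply/s.
Qed.

Lemma eq_embedding_on M N (C : set M) (h h' : M -> N) : fun_closed C ->
  (forall x, C x -> h x = h' x) -> embedding_on C h -> embedding_on C h'.
Proof.
move=> cC e [h1 h2 h3]; split.
- by move=> x y Cx Cy; rewrite -!e //; exact: h1.
- move=> R t Ct; rewrite -h2 // (_ : (fun i => h (t i)) = fun i => h' (t i)) //.
  by apply/funext => i; rewrite e.
- move=> f t Ct; rewrite -e; last exact: cC.
  rewrite h3 // (_ : (fun i => h (t i)) = fun i => h' (t i)) //.
  by apply/funext => i; rewrite e.
Qed.

Lemma embedding_on_comp M N P (C : set M) (C' : set N) (h : M -> N)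
    (k : N -> P) : (forall x, C x -> C' (h x)) ->
  embedding_on C h -> embedding_on C' k -> embedding_on C (fun x => k (h x)).
Proof.
move=> s [h1 h2 h3] [k1 k2 k3]; split.
- move=> x y Cx Cy e; apply: h1 => //; apply: k1 => //; exact: s.
- by move=> R t Ct; rewrite k2 ?h2 // => i; exact: s.
- by move=> f t Ct; rewrite h3 ?k3 // => i; exact: s.
Qed.

Lemma substr_finite M (C : set M) (cC : fun_closed C) :
  finite_set C -> finite_str (substr cC).
Proof. exact: finite_setT_sig. Qed.

Lemma fun_closed_image M N (C : set M) (h : M -> N) :
  fun_closed C -> embedding_on C h -> fun_closed (h @` C).
Proof.
move=> cC [_ _ h3] f t Ct.
have /choice[s Hs] : forall i, exists x, C x /\ h x = t i.
  by move=> i; have [x Cx <-] := Ct i; exists x.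
exists (fun_in s); first by apply: cC => i; case: (Hs i).
rewrite h3; last by move=> i; case: (Hs i).
by congr fun_in; apply/funext => i; case: (Hs i).
Qed.

Lemma fun_closed_relational M (C : set M) : relational L -> fun_closed C.
Proof. by move=> rL f; case: (rL f). Qed.

Lemma fun_closed_aut M (C : set M) (s : aut M) :
  fun_closed C -> fun_closed (s @` C).
Proof.
move=> cC; apply: fun_closed_image => //; apply: embedding_onW.
exact: aut_embedding.
Qed.

Lemma aut_inj M (s : aut M) : injective s.
Proof. by case: (aut_embedding s). Qed.

Lemma aut_rel M (s : aut M) (R : rel_sym L) (t : 'I_(rel_ar R) -> M) :
  rel_in (fun i => s (t i)) <-> rel_in t.
Proof. by case: (aut_embedding s). Qed.

Lemma aut_mulE M (s t : aut M) x : (s * t)%g x = s (t x). Proof. by []. Qed.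

Lemma aut_mulVK M (s : aut M) x : s^-1%g (s x) = x.
Proof. exact: aut_funK. Qed.

Lemma aut_mulKV M (s : aut M) x : s (s^-1%g x) = x.
Proof. exact: aut_inv_funK. Qed.

Lemma aut_one M x : (1%g : aut M) x = x. Proof. by []. Qed.

Section Limit.
Variables (K : str_class L) (M : structure L).
Hypothesis HM : fraisse_limit K M.

Lemma closure_ex (X : set M) : finite_set X ->
  exists Y : set M, [/\ finite_set Y, X `<=` Y & fun_closed Y].
Proof. by case: HM => _ lf _ _; exact: lf. Qed.

Lemma extend_to_aut (C : set M) (h : M -> M) : finite_set C -> fun_closed C ->
  embedding_on C h -> exists s : aut M, forall x, C x -> s x = h x.
Proof.
case: HM => _ _ uh _ fC cC eh.
have [s Hs] := uh (substr cC) _ _ (substr_finite cC fC) (substr_embedding cC)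
  (embedding_on_substr cC eh).
by exists s => x Cx; exact: (Hs (exist _ x Cx)).
Qed.

Lemma limit_substr (C : set M) (cC : fun_closed C) : finite_set C -> K (substr cC).
Proof.
case: HM => _ _ _ ag fC; apply/ag; split; first exact: substr_finite.
by exists (fun x => sval x); exact: substr_embedding.
Qed.

Lemma embed_in_limit N (C : set N) (cC : fun_closed C) : inhabited M ->
  K (substr cC) -> exists h : N -> M, embedding_on C h.
Proof.
case=> p0; case: HM => _ _ _ ag /ag[_ [h [h1 h2 h3]]].
(* Maps are total here; [p0] fills in the values outside [C]. *)
pose k x := if pselect (C x) is left p then h (exist _ x p) else p0.
have kE x (p : C x) : k x = h (exist _ x p).
  rewrite /k; case: pselect => // q; congr (h (exist _ x _)).
  exact: Prop_irrelevance.
exists k; split.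
- move=> x y Cx Cy; rewrite !kE => /h1/(congr1 (fun z => sval z)) //.
- move=> R t Ct; have := h2 R (fun i => exist _ (t i) (Ct i)) => /= <-.
  by rewrite (_ : (fun i => k (t i)) = (fun i => h (exist _ (t i) (Ct i)))) //;
    apply/funext => i; rewrite kE.
- move=> f t Ct; rewrite (kE _ (cC _ _ Ct)).
  have := h3 f (fun i => exist _ (t i) (Ct i)).
  rewrite (_ : (fun i => h _) = (fun i => k (t i))).
    move=> <-; congr h; exact: sval_inj.
  by apply/funext => i; rewrite kE.
Qed.

(** Any embedding of [C'] in [M] carries [C] to a copy of itself; ultrahomogeneity supplies the
    automorphism that brings this copy back to [C]. *)
Lemma extension_property N (C : set M) (j : M -> N) (C' : set N)
    (cC' : fun_closed C') :
  inhabited M -> finite_set C -> fun_closed C -> embedding_on C j ->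
  (forall x, C x -> C' (j x)) -> K (substr cC') ->
  exists k : N -> M, embedding_on C' k /\ forall x, C x -> k (j x) = x.
Proof.
move=> iM fC cC ej jC KN; have [h eh] := embed_in_limit iM KN.
have [s Hs] : exists s : aut M, forall x, C x -> s x = h (j x).
  by apply: extend_to_aut => //; exact: embedding_on_comp eh.
exists (fun x => s^-1%g (h x)); split.
  apply: (@embedding_on_comp _ _ _ _ setT h (s^-1%g)) => //.
  exact/embedding_onW/aut_embedding.
by move=> x Cx; rewrite -Hs // aut_mulVK.
Qed.
End Limit.
End Substructures.

(** * Words and trajectories *)


Section Words.
Variable G : groupType.
Local Open Scope group_scope.
Implicit Types w : seq (bool * G).

(** Cancellation threatens only between two letters of opposite sign, so only there must the
    coefficient be nontrivial. *)
Fixpoint reduced w : Prop :=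
  if w is (e, g) :: w' then
    (if w' is (e', _) :: _ then e <> e' -> g <> 1 else True) /\ reduced w'
  else True.

Lemma word_eval_cons e g w x :
  word_eval ((e, g) :: w) x = (if e then x else x^-1) * g * word_eval w x.
Proof. by rewrite /word_eval big_cons. Qed.

(** Coefficients stand to the right of the letters, which leaves a leading constant [c] outside the
    word. The next letter on the left absorbs it in its coefficient; if that letter then cancels
    against the first letter of [w'], the coefficient [g'] becomes the new constant. *)
Lemma reduce_word w : exists c w',
  reduced w' /\ forall x, word_eval w x = c * word_eval w' x.
Proof.
elim: w => [|[e g] w [c [w' [rw' Ew]]]].
  by exists 1, [::]; split => // x; rewrite mul1g.
case: (pselect (reduced ((e, g * c) :: w'))) => [r|nr].
  exists 1, ((e, g * c) :: w'); split => // x.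
  by rewrite mul1g !word_eval_cons Ew !mulgA.
case: w' rw' Ew nr => [|[e' g'] w'] rw' Ew nr; first by case: nr.
have [ee gc] : e <> e' /\ g * c = 1.
  by split; [move=> ee; apply: nr; split|apply: contrapT => gc; apply: nr; split].
exists g', w'; split; first by case: rw'.
move=> x; rewrite word_eval_cons Ew !mulgA -(mulgA _ g c) gc mulg1.
rewrite word_eval_cons !mulgA.
by case: e e' ee {rw' nr Ew gc} => [] [] //; rewrite ?mulgV ?mulVg mul1g.
Qed.

End Words.

Lemma finI_fromP (I : choiceType) T (D : set I) (f : I -> set T) B :
  finI_from D f B ->
  exists S, [/\ finite_set S, S `<=` D & B = \bigcap_(i in S) f i].
Proof.
case=> E sE <-; exists [set` E]; split=> //.
by move=> i /sE; rewrite inE.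
Qed.

(** * Irreducibility of the Zariski topology *)

Section NotGroupTopology.
Variable G : groupType.
Local Open Scope group_scope.

Lemma zariski_open_word (w : seq (bool * G)) :
  open ([set x | word_eval w x <> 1] : set (zariski G)).
Proof.
exists [set [set x | word_eval w x <> 1]]; last by rewrite bigcup_set1.
move=> _ ->; apply: (@finI_from1 _ _ (@zariski_subbase G) id).
by exists w.
Qed.

Lemma zariski_base (U : set (zariski G)) (x : G) : open U -> U x ->
  exists W : set (seq (bool * G)), [/\ finite_set W,
    forall w, W w -> word_eval w x <> 1 &
    forall y : G, (forall w, W w -> word_eval w y <> 1) -> U y].
Proof.
case=> D' sD <- [B D'B Bx].
have [S [fS sS BE]] : exists S : set (set G), [/\ finite_set S,
    S `<=` @zariski_subbase G & B = \bigcap_(A in S) A].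
  exact: finI_fromP (sD _ D'B).
have /choice[f Hf] : forall A : set G, exists w : seq (bool * G),
    S A -> A = [set x | word_eval w x <> 1].
  move=> A; case: (pselect (S A)) => [/sS[w ->]|]; last by exists [::].
  by exists w.
have {}Bx : (\bigcap_(A in S) A) x by rewrite -BE.
exists (f @` S); split.
- exact: finite_image.
- by move=> _ [A AS <-]; have := Bx A AS; rewrite /= {1}(Hf _ AS).
- move=> y Hy; exists B => //; change (B y); rewrite BE => A AS.
  by rewrite (Hf _ AS); apply: Hy; exists A.
Qed.

Lemma zariski_not_group_topology :
  (forall W : set (seq (bool * G)), finite_set W ->
     (forall w, W w -> exists x, word_eval w x <> 1) ->
     exists x, forall w, W w -> word_eval w x <> 1) ->
  (exists h : G, h <> 1) ->
  ~ zariski_is_group_topology G.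
Proof.
move=> irr [h h1] [cM cV].
have oU : open ([set x | word_eval [:: (true, 1)] x <> 1] : set (zariski G)).
  exact: zariski_open_word.
have UE x : word_eval [:: (true, 1)] x = x.
  by rewrite /word_eval big_seq1 /= mulg1.
have c1 : (fun p : zariski G * zariski G => (p.1^-1 * p.2 : zariski G))
    @ nbhs ((1, h) : zariski G * zariski G) --> ((1^-1 * h : G) : zariski G).
  apply: (@continuous2_cvg _ _ _ _ _ _ (fun p : zariski G * zariski G => p.1^-1)
    (fun p : zariski G * zariski G => p.2) (fun x y : zariski G => x * y : zariski G)).
  - exact: (cM (1^-1, h)).
  - apply: (@cvg_comp _ _ _ (fun p : zariski G * zariski G => p.1)
      (fun x : zariski G => x^-1 : zariski G) _ (nbhs (1 : zariski G))).
      exact: cvg_fst.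
    exact: (cV 1).
  - exact: cvg_snd.
have : nbhs ((1, h) : zariski G * zariski G)
    [set p : zariski G * zariski G | p.1^-1 * p.2 <> 1].
  apply: (c1 [set x | x <> 1]); apply: open_nbhs_nbhs; split.
    by move: oU; congr open; apply/seteqP; split=> y /=; rewrite UE.
  by rewrite /= invg1 mul1g.
case=> -[V W] /= [nV nW] sVW.
move: nV nW; rewrite !nbhsE /= => -[V' [oV V1] sV] [W' [oW Wh] sW].
have [X [fX X1 X2]] := zariski_base oV V1.
have [Y [fY Y1 Y2]] := zariski_base oW Wh.
(* The words around [1] are nontrivial at [1] and those around [h] at [h]; irreducibility makes all
   of them nontrivial at one [x], and the pair [(x, x)] is sent to [1]. *)
have [x Hx] : exists x, forall w, (X `|` Y) w -> word_eval w x <> 1.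
  apply: irr; first by rewrite finite_setU.
  by move=> w [/X1|/Y1]; [exists 1|exists h].
apply: (sVW (x, x)); last by rewrite /= mulVg.
by split; [apply/sV/X2|apply/sW/Y2] => w Zw; apply: Hx; [left|right].
Qed.
End NotGroupTopology.

(** * Orbits over finite sets, and trajectories *)

Section OrbitConditions.
Variables (L : language) (M : structure L).

Definition agree (A : set M) (s x : aut M) := forall a, A a -> s a = x a.

(** Closing [A] together with [a] may require several new points. This provides a larger closed set,
    still without [a], to which [a] can be added alone. *)
Definition splits_closed := forall (A : set M) a,
  finite_set A -> fun_closed A -> ~ A a ->
  exists A' : set M, [/\ finite_set A', fun_closed A', A `<=` A', ~ A' a
                       & fun_closed (a |` A')].

Definition infinite_orbits := forall (A F : set M) a,
  finite_set A -> fun_closed A -> ~ A a -> finite_set F ->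
  exists s : aut M, agree A 1%g s /\ ~ F (s a).

(** The set [F] leaves room for the finitely many values that a trajectory has to avoid for other
    reasons. *)
Definition moves_orbits := forall (A F : set M) a (g : aut M),
  finite_set A -> fun_closed A -> ~ A a -> fun_closed (a |` A) ->
  finite_set F -> g <> 1%g ->
  exists s : aut M, [/\ agree A 1%g s, ~ F (s a) & g (s a) <> s a].

End OrbitConditions.

Section Trajectories.
Variables (L : language) (M : structure L).
Local Open Scope group_scope.
Implicit Types (s x g h : aut M) (A F : set M).

Hypothesis ne : inhabited M.
Hypothesis closed0 : fun_closed (set0 : set M).
Hypothesis Hprep : splits_closed M.
Hypothesis Hinf : infinite_orbits M.
Hypothesis Hmove : moves_orbits M.

(* [q] is new for the next letter [x] or [x^-1], when [x] is known to agree
   with [s] on [A] only. *)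
Definition fresh (e : bool) A s (q : M) := if e then ~ A q else ~ (s @` A) q.

Lemma finite_preim_aut g F : finite_set F -> finite_set (g @^-1` F).
Proof.
move=> fF; apply: sub_finite_set (finite_image (fun y => g^-1 y) fF) => z Fz.
by exists (g z) => //; rewrite aut_mulVK.
Qed.

(** The value of [x] or of its inverse at [q] is still undetermined. Composing [s] with some [t]
    that fixes [B] changes this value but not [s] on [B]; [t] is chosen so that the next point
    [g0 r] is fresh again. *)
Lemma extend_trajectory (e : bool) A s q F (e0 : bool) g0 :
  finite_set A -> fun_closed A -> finite_set F -> fresh e A s q ->
  (e0 <> e -> g0 <> 1) ->
  exists s' A' r, [/\ finite_set A', fun_closed A', A `<=` A', agree A s s'
    & [/\ forall x, agree A' s' x -> (if e then x else x^-1) q = r, ~ F r &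
         fresh e0 A' s' (g0 r)]].
Proof.
move=> fA cA fF fq ee.
(* [q1] is [q] read on the source side of [s]; in both directions freshness becomes [~ A q1]. *)
pose q1 := if e then q else s^-1 q.
have nq1 : ~ A q1.
  by case: e @q1 fq {ee} => //= nq Aq; apply: nq; exists (s^-1 q); rewrite ?aut_mulKV.
have [B [fB cB AB nB cqB]] := Hprep fA cA nq1.
(* After a change of sign the danger is [g0 r = r]. In terms of [t q1] this reads
   [g1 (t q1) = t q1]. *)
pose g1 := if e then s^-1 * g0 * s else g0.
(* The three parts keep [r] out of [F], and [g0 r] off the points already used, after a change of
   sign and without one respectively. *)
pose F1 := (if e then s @^-1` F else F) `|` g1 @^-1` (q1 |` B)
  `|` (if e then (g0 * s) @^-1` (q1 |` B) else g0 @^-1` (s @` (q1 |` B))).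
have fqB : finite_set (q1 |` B) by rewrite finite_setU; split => //; exact: finite_set1.
have fF1 : finite_set F1.
  rewrite 2!finite_setU; split; [split|].
  - by case: (e) => //; exact: finite_preim_aut.
  - exact: finite_preim_aut.
  - by case: (e); apply: finite_preim_aut => //; exact: finite_image.
have [t [tB tF tmove]] : exists t, [/\ agree B 1 t, ~ F1 (t q1)
    & e0 <> e -> g1 (t q1) <> t q1].
  case: (pselect (e0 = e)) => [e0e|e0e].
    by have [t [tB tF]] := Hinf fB cB nB fF1; exists t.
  have g1n : g1 <> 1.
    rewrite /g1; case: (e) => [E|]; last exact: ee.
    apply: (ee e0e); have := congr1 (fun y => s * y * s^-1) E.
    by rewrite !mulgA mulgV mul1g mulgK mulg1 mulgV.
  by have [t [tB tF tm]] := Hmove fB cB nB cqB fF1 g1n; exists t; split.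
have ctqB : fun_closed (t q1 |` B).
  rewrite (_ : _ |` _ = t @` (q1 |` B)); first exact: fun_closed_aut.
  apply/seteqP; split=> [y [->|By]|_ [y [->|By] <-]].
  - by exists q1 => //; left.
  - by exists y; [right|rewrite -tB].
  - by left.
  - by right; rewrite -tB.
clear nq1 fF1; destruct e; simpl in *.
(* Forwards, [s * t] sends [q1] to the new value [s (t q1)]; backwards, [s * t^-1] sends the new
   value [t q1] to [s q1 = q]. *)
- exists (s * t), (q1 |` B), (s (t q1)); split=> //.
  + by apply: subset_trans AB _; exact: subsetUr.
  + by move=> a Aa; rewrite aut_mulE -tB //; exact: AB.
  split.
  + by move=> x <- //; left.
  + by move=> Fr; apply: tF; left; left.
  + rewrite /fresh; case: e0 ee tmove => /= ee tmove.
      by move=> H; apply: tF; right.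
    move=> [y Hy E]; have {}E : s (t y) = g0 (s (t q)) := E.
    have g1E : g1 (t q) = t y by rewrite -(aut_mulVK s (t y)) E.
    case: Hy => [yq|By]; first by apply: tmove => //; exact: etrans g1E (congr1 t yq).
    by apply: tF; left; right; right; suff : B (g1 (t q)) by []; rewrite g1E -tB.
- exists (s * t^-1), (t q1 |` B), (t q1); split=> //.
  + by rewrite finite_setU; split => //; exact: finite_set1.
  + by apply: subset_trans AB _; exact: subsetUr.
  + move=> a Aa; have ta : a = t a := tB _ (AB _ Aa).
    by rewrite aut_mulE {2}ta aut_mulVK.
  split.
  + move=> x xs; have xt : x (t q1) = q.
      rewrite -xs; last by left.
      exact: etrans (congr1 s (aut_mulVK t q1)) (aut_mulKV s q).
    exact: etrans (congr1 (fun y => x^-1 y) (esym xt)) (aut_mulVK x (t q1)).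
  + by move=> Fr; apply: tF; left; left.
  + rewrite /fresh; case: e0 ee tmove => /= ee tmove.
      move=> [E|BE]; first exact: tmove.
      by apply: tF; left; right; right.
    move=> [y Hy E]; have {}E : s (t^-1 y) = g0 (t q1) := E.
    apply: tF; right; exists (t^-1 y); last exact: E.
    case: Hy => [->|By]; first by left; rewrite aut_mulVK.
    right; suff -> : t^-1 y = y by [].
    have ty : y = t y := tB _ By.
    by rewrite {1}ty aut_mulVK.
Qed.

(** A word acts from its right end, so its leftmost letter is treated last. The letter [(e0, g0)]
    still to come is carried along, since its sign and coefficient decide what [r] has to avoid. *)
Lemma trajectory w : forall e0 g0 A s F p, reduced ((e0, g0) :: w) ->
  finite_set A -> fun_closed A -> finite_set F ->
  (forall eg, eg \in (e0, g0) :: w -> ~ (A `|` s @` A) (eg.2 p)) ->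
  exists s' A' r, [/\ finite_set A', fun_closed A', A `<=` A', agree A s s'
    & [/\ forall x, agree A' s' x -> word_eval w x p = r,
          w <> [::] -> ~ F r & fresh e0 A' s' (g0 r)]].
Proof.
elim: w => [|[e g] w IH] e0 g0 A s F p rw fA cA fF fp.
  exists s, A, p; split=> //; split=> //.
    by move=> x _; rewrite /word_eval big_nil.
  have := fp (e0, g0); rewrite inE eqxx => /(_ isT) H.
  by rewrite /fresh; case: e0 {rw fp} H => /= H HA; apply: H; [left|right].
case: rw => ee rw.
have [s1 [A1 [r1 [fA1 cA1 AA1 ss1 [ev1 _ fr1]]]]] :
  exists s' A' r, [/\ finite_set A', fun_closed A', A `<=` A', agree A s s'
    & [/\ forall x, agree A' s' x -> word_eval w x p = r,
          w <> [::] -> ~ F r & fresh e A' s' (g r)]].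
  by apply: IH => // eg egw; apply: fp; rewrite inE egw orbT.
have [s2 [A2 [r2 [fA2 cA2 AA2 ss2 [ev2 Fr2 fr2]]]]] :=
  extend_trajectory fA1 cA1 fF fr1 ee.
exists s2, A2, r2; split=> //.
- exact: subset_trans AA2.
- by move=> a Aa; rewrite ss1 // ss2 //; exact: AA1.
split=> // x xs; rewrite word_eval_cons !aut_mulE ev1 ?ev2 //.
by move=> a Aa; rewrite ss2 // xs //; exact: AA2.
Qed.

Lemma infinite_carrier : infinite_set [set: M].
Proof.
case: (ne) => p fM.
by have [s [_]] := Hinf (finite_set0 _) closed0 (fun h : set0 p => h) fM; apply.
Qed.

Lemma avoid_roots A s w c : reduced w -> w <> [::] ->
  finite_set A -> fun_closed A ->
  exists s' A', [/\ finite_set A', fun_closed A', A `<=` A', agree A s s'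
    & forall x, agree A' s' x -> c * word_eval w x <> 1].
Proof.
case: w => // -[e g] w rw _ fA cA.
(* The starting point must be fresh after any of the coefficients and in either direction: hence the
   preimages of both [A] and its image under [s]. *)
pose X := \bigcup_(h in [set h : aut M | h \in 1 :: [seq eg.2 | eg <- (e, g) :: w]])
            (h @^-1` (A `|` s @` A)).
have fX : finite_set X.
  apply: bigcup_finite; first exact: (@finite_seq (aut M)).
  move=> h _; apply: finite_preim_aut.
  by rewrite finite_setU; split => //; exact: finite_image.
have [p _ pX] := infinite_notin infinite_carrier fX.
(* A dummy letter of coefficient [1] in front makes [trajectory] run through the whole word;
   repeating the sign [e] keeps the word reduced. Avoiding [c^-1 p] at the end prevents
   [c * word_eval w x] from fixing [p]. *)
have rw' : reduced ((e, 1 : aut M) :: (e, g) :: w) by split.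
have [|s' [A' [r [fA' cA' AA' ss' [ev Fr _]]]]] :=
  @trajectory _ e 1 A s [set c^-1 p] p rw' fA cA (finite_set1 _).
  move=> eg egw Hp; apply: pX; exists eg.2 => //=.
  move: egw; rewrite inE => /orP[/eqP ->|egw]; first by rewrite inE eqxx.
  by rewrite inE; apply/orP; right; apply: (map_f (fun eg => eg.2) egw).
exists s', A'; split=> // x xs E; apply: Fr => //.
rewrite -(ev x xs); set v := word_eval _ x in E *.
change (v p = c^-1 p).
apply: (@aut_inj _ _ c); rewrite aut_mulKV.
exact: (congr1 (fun z : aut M => z p) E).
Qed.

Lemma aut_zariski_not_group_topology : ~ zariski_is_group_topology (aut M).
Proof.
apply: zariski_not_group_topology; last first.
  case: (ne) => p.
  have [s [_ sp]] := Hinf (finite_set0 _) closed0 (fun h : set0 p => h) (finite_set1 p).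
  by exists s => s1; apply: sp; rewrite s1.
move=> W fW HW.
(* Every [x] that agrees with [s] on [A] is to work, not just one: this lets the next word be
   treated by refining [s] and [A]. *)
suff [s [A [_ _ H]]] : exists s (A : set M), [/\ finite_set A, fun_closed A &
    forall x w, agree A s x -> W w -> word_eval w x <> 1].
  by exists s => w; exact: H.
move: HW; elim/finite_set_ind: W / fW => [|W w _ _ IH] HW.
  by exists 1, set0; split=> //; exact: finite_set0.
have [|s [A [fA cA sA]]] := IH; first by move=> w' Ww'; apply: HW; right.
have [y wy] := HW w (or_introl erefl).
have [c [w' [rw' Ew]]] := reduce_word w.
(* If nothing is left after reduction, [w] is constant, and it is nontrivial everywhere because it
   is so at [y]. *)
case: (pselect (w' = [::])) => [w0|w0].
  exists s, A; split=> // x w1 xs [->|]; last exact: sA.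
  by move: wy; rewrite !Ew w0 /word_eval !big_nil.
have [s' [A' [fA' cA' AA' ss' H]]] := avoid_roots s c rw' w0 fA cA.
exists s', A'; split=> // x w1 xs.
move=> [->|Ww1]; first by rewrite Ew; exact: H.
by apply: sA => // a Aa; rewrite ss' // xs //; exact: AA'.
Qed.
End Trajectories.

(** * Relational structures and the random tournament *)


Definition update (T U : Type) (f : T -> U) (a : T) (b : U) (x : T) : U :=
  if pselect (x = a) then b else f x.

Lemma update_same (T U : Type) (f : T -> U) a b : update f a b a = b.
Proof. by rewrite /update; case: pselect. Qed.

Lemma update_other (T U : Type) (f : T -> U) a b x : x <> a -> update f a b x = f x.
Proof. by rewrite /update; case: pselect. Qed.

Section Relational.
Variables (L : language) (K : str_class L) (M : structure L).
Hypothesis HM : fraisse_limit K M.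

Definition pointwise_stabilizer_free := forall (A : set M) a (g : aut M),
  finite_set A -> ~ A a ->
  (forall s : aut M, agree A 1%g s -> g (s a) = s a) -> g = 1%g.

Lemma same_type_aut (A : set M) a b : finite_set A -> fun_closed (a |` A) ->
  ~ A a -> embedding_on (a |` A) (update id a b) ->
  exists s : aut M, agree A 1%g s /\ s a = b.
Proof.
move=> fA cA nA eh.
have fA' : finite_set (a |` A) by rewrite finite_setU; split => //; exact: finite_set1.
have [s Hs] := extend_to_aut HM fA' cA eh.
exists s; split; last by rewrite Hs ?update_same //; left.
move=> x Ax; rewrite Hs; last by right.
by rewrite update_other // => xa; apply: nA; rewrite -xa.
Qed.

(** Without function symbols [F] can be absorbed in [A]: [a] is first moved off both sets, and its
    orbit over their union then avoids [F]. *)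
Lemma relational_criterion : relational L -> inhabited M ->
  infinite_orbits M -> pointwise_stabilizer_free ->
  ~ zariski_is_group_topology (aut M).
Proof.
move=> rL iM io psf.
apply: aut_zariski_not_group_topology => //.
- move=> A a fA _ nA; exists A; split=> //; exact: (fun_closed_relational _ rL).
- move=> A F a g fA cA nA _ fF g1.
  have fAF : finite_set (A `|` F) by rewrite finite_setU.
  have [s0 [As0 ns0]] := io A (A `|` F) a fA cA nA fAF.
  apply: contrapT => H; apply: g1; apply: (psf _ (s0 a) _ fAF ns0) => s sAF.
  apply: contrapT => gs; apply: H; exists (s * s0)%g; split.
  + move=> x Ax; rewrite aut_mulE -As0 //.
    by rewrite aut_one -sAF //; left.
  + rewrite aut_mulE => Fs; apply: ns0.
    suff <- : s (s0 a) = s0 a by right.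
    by apply: (@aut_inj _ _ s); rewrite -(sAF (s (s0 a))) //; right.
  + exact: gs.
Qed.
End Relational.

Lemma tuple2E (T : Type) (t : 'I_2 -> T) : t = tuple2 (t ord0) (t (lift ord0 ord0)).
Proof.
apply/funext => i; rewrite /tuple2; case: eqP => [->//|i0]; congr t.
by apply: val_inj; case: i i0 => -[|[|//]] //= ? []; apply: val_inj.
Qed.

Lemma tuple2_comp (T U : Type) (f : T -> U) x y :
  (fun i => f (tuple2 x y i)) = tuple2 (f x) (f y).
Proof. by apply/funext => i; rewrite /tuple2; case: ifP. Qed.

Section Tournaments.
Variable M : structure binary_language.

Lemma binary_embedding_on (N P : structure binary_language) (C : set N) (h : N -> P) :
  inj_on C h -> (forall x y, C x -> C y -> edge (h x) (h y) <-> edge x y) ->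
  embedding_on C h.
Proof.
move=> ih eh; split=> // -[] t Ct.
by rewrite (tuple2E t) tuple2_comp; exact: eh.
Qed.

Hypothesis HM : fraisse_limit finite_tournaments M.

Lemma limit_tournament : tournament M.
Proof.
split=> [x|x y xy].
  have cC : fun_closed [set x] by exact: fun_closed_relational.
  have [_ [irr _]] := limit_substr HM cC (finite_set1 x).
  move=> exx; apply: (irr (exist _ x erefl)).
  by rewrite /edge /= tuple2_comp.
have cC : fun_closed [set x; y] by exact: fun_closed_relational.
have [_ [_ tot]] := limit_substr HM cC (finite_set2 x y).
pose x' : substr cC := exist _ x (or_introl erefl).
pose y' : substr cC := exist _ y (or_intror erefl).
have /tot : x' <> y' by move=> /(congr1 (fun z => sval z)).
by rewrite /edge /= !tuple2_comp.
Qed.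

Definition tournament_extension (X : set M) : structure binary_language :=
  @Structure binary_language (option M)
    (fun _ t => match t ord0, t (lift ord0 ord0) with
                | Some x, Some y => edge x y
                | None, Some y => X y
                | Some x, None => ~ X x
                | None, None => False
                end) (fun f : void => match f with end).

Lemma tournament_inhabited : inhabited M.
Proof.
case: HM => _ _ _ ag.
pose N := @Structure binary_language unit (fun _ _ => False) (fun f : void => match f with end).
have /ag[_ [h _]] : finite_tournaments N.
  split; first exact: finite_finset.
  by split=> [x []|[] []].
by constructor; exact: (h tt).
Qed.

(** Every choice of edges at the new point [None] gives a tournament, so every pattern over [C] is
    realized. *)
Lemma tournament_point (C X : set M) : finite_set C ->
  exists b, [/\ ~ C b, forall c, C c -> (edge b c <-> X c)
                & forall c, C c -> (edge c b <-> ~ X c)].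
Proof.
move=> fC; have [irr tot] := limit_tournament.
pose N := tournament_extension X.
pose C' : set N := None |` (Some @` C).
have cC' : fun_closed C' by exact: fun_closed_relational.
have [||||||k [ek kE]] := @extension_property _ _ _ HM N C (Some : M -> N) C' cC'.
- exact: tournament_inhabited.
- exact: fC.
- exact: fun_closed_relational.
- by apply: binary_embedding_on => [x y _ _ []|].
- by move=> x Cx; right; exists x.
- split; first apply: substr_finite.
    by rewrite finite_setU; split; [exact: finite_set1|exact: finite_image].
  split=> [[[x|] Cx]|[[x|] Cx] [[y|] Cy] xy]; rewrite /edge /=.
  + exact: irr.
  + by [].
  + by apply: tot => e; apply: xy; apply: sval_inj; rewrite /= e.
  + by case: (pselect (X x)) => Xx; [right|left]; split=> // /(_ Xx).
  + by case: (pselect (X y)) => Xx; [left|right]; split=> // /(_ Xx).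
  + by case: xy; apply: sval_inj.
have [ki kr _] := ek.
have CN : C' None by left.
have CS c : C c -> C' (Some c) by move=> Cc; right; exists c.
exists (k None); split.
- by move=> Cb; have := ki _ _ (CS _ Cb) CN (kE _ Cb).
- move=> c Cc; have := kr tt (tuple2 None (Some c)).
  rewrite tuple2_comp kE //; apply.
  by move=> i; rewrite /tuple2; case: ifP => _; [|exact: CS].
- move=> c Cc; have := kr tt (tuple2 (Some c) None).
  rewrite tuple2_comp kE //; apply.
  by move=> i; rewrite /tuple2; case: ifP => _; [exact: CS|].
Qed.

Lemma tournament_same_type (A : set M) a b : finite_set A -> ~ A a -> ~ A b ->
  (forall c, A c -> (edge b c <-> edge a c)) ->
  exists s : aut M, agree A 1%g s /\ s a = b.
Proof.
move=> fA na nb ab; have [irr tot] := limit_tournament.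
have irrb : edge b b <-> edge a a by split => /irr.
have ba c : A c -> (edge c b <-> edge c a).
  move=> Ac; have ca : c <> a by move=> e; apply: na; rewrite -e.
  have cb : c <> b by move=> e; apply: nb; rewrite -e.
  by have := ab c Ac; have := tot _ _ ca; have := tot _ _ cb; tauto.
have Aa c : A c -> c <> a by move=> Ac e; apply: na; rewrite -e.
apply: (same_type_aut HM) => //; first exact: fun_closed_relational.
apply: binary_embedding_on.
  move=> x y [->|Ax] [->|Ay] //; rewrite ?update_same ?update_other //; try exact: Aa.
  + by move=> e; case: nb; rewrite e.
  + by move=> e; case: nb; rewrite -e.
move=> x y [->|Ax] [->|Ay]; rewrite ?update_same ?update_other //; try exact: Aa.
- exact: ab.
- exact: ba.
Qed.

Lemma tournament_not_group_topology : ~ zariski_is_group_topology (aut M).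
Proof.
have [irr tot] := limit_tournament.
apply: relational_criterion => //.
- exact: tournament_inhabited.
- move=> A F a fA _ nA fF.
  have fAF : finite_set (A `|` F) by rewrite finite_setU.
  have [b [nb ab _]] := tournament_point (edge a) fAF.
  have [s [As sa]] : exists s : aut M, agree A 1%g s /\ s a = b.
    apply: tournament_same_type => //; first by move=> Ab; apply: nb; left.
    by move=> c Ac; apply: ab; left.
  by exists s; split=> //; rewrite sa => Fb; apply: nb; right.
move=> A a0 g fA na0 Hg.
have edge_g x y : edge (g x) (g y) <-> edge x y.
  have := aut_rel g (R := tt) (tuple2 x y); rewrite tuple2_comp; exact.
have fix_out a : ~ A a -> g a = a.
  move=> na; apply: contrapT => ga.
  (* [b] copies [a0] towards all points but [a], where it takes the opposite of the relation from
     [a0] to [g a]. So it has the type of [a0] over [A] and tells [a] from [g a]. *)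
  pose X c := (c = a /\ ~ edge a0 (g a)) \/ (c <> a /\ edge a0 c).
  have fC : finite_set (A `|` [set a; g a]).
    by rewrite finite_setU; split => //; exact: finite_set2.
  have [b [nb bX _]] := tournament_point X fC.
  have Ab : ~ A b by move=> Ab; apply: nb; left.
  have [|s [As sb]] := tournament_same_type fA na0 Ab.
    move=> c Ac; rewrite bX /X; last by left.
    have ca : c <> a by move=> e; apply: na; rewrite -e.
    by tauto.
  have gb : g b = b by rewrite -sb; exact: Hg.
  have := edge_g b a; rewrite gb bX; last by right; right.
  rewrite bX; last by right; left.
  by rewrite /X; tauto.
apply: aut_ext => a; apply: contrapT => ga.
have fC : finite_set (A `|` [set a; g a]).
  by rewrite finite_setU; split => //; exact: finite_set2.
(* All points outside [A] are now known to be fixed, so [b] is free to dominate [a] and not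
   [g a]. *)
have [b [nb bX _]] := tournament_point [set a] fC.
have gb : g b = b by apply: fix_out => Ab; apply: nb; left.
have := edge_g b a; rewrite gb bX; last by right; right.
rewrite bX; last by right; left.
by rewrite /=; tauto.
Qed.
End Tournaments.

(** * The rational Urysohn space *)


Section Urysohn.
Local Open Scope ring_scope.

Lemma finite_pos_lower_bound (T : Type) (C : set T) (f : T -> rat) :
  finite_set C -> (forall c, C c -> 0 < f c) ->
  exists2 e, 0 < e & forall c, C c -> e <= f c.
Proof.
move=> fC; elim/finite_set_ind: C / fC => [_|C x _ _ IH pos].
  by exists 1 => //; apply: ltr01.
have [|e e0 He] := IH; first by move=> c Cc; apply: pos; right.
exists (Num.min e (f x)); first by rewrite lt_min e0 pos //; left.
by move=> c [->|/He ec]; rewrite ge_min ?lexx ?ec ?orbT.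
Qed.

Lemma finite_pos_upper_bound (T : Type) (C : set T) (f : T -> rat) :
  finite_set C -> exists2 D, 0 < D & forall c, C c -> f c <= D.
Proof.
move=> fC; elim/finite_set_ind: C / fC => [|C x _ _ [D D0 HD]].
  by exists 1 => //; apply: ltr01.
exists (Num.max D (f x)); first by rewrite lt_max D0.
by move=> c [->|/HD ec]; rewrite le_max ?lexx ?ec ?orbT.
Qed.

Definition metrizes (M : structure metric_language) (d : M -> M -> rat) :=
  forall (q : rel_sym metric_language) (x y : M),
    @rel_in _ M q (tuple2 x y) <-> d x y <= sval q.

Definition dist_le (q : rat) (q0 : 0 <= q) : rel_sym metric_language :=
  exist (fun q : rat => is_true (0 <= q)) q q0.

Lemma metric_embedding_on (N P : structure metric_language) dN dP
    (C : set N) (h : N -> P) : metrizes dN -> metrizes dP ->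
  inj_on C h -> (forall x y, C x -> C y -> dP (h x) (h y) = dN x y) ->
  embedding_on C h.
Proof.
move=> mN mP ih eh; split=> [//|q t Ct|[]].
by rewrite (tuple2E t) tuple2_comp mP mN eh.
Qed.

(** The limit carries only the threshold relations. The distance of two points is read off the
    substructure they form, and [P] determines it uniquely; substructures of three points give the
    triangle inequality. *)
Lemma urysohn_metric (M : structure metric_language) :
  fraisse_limit finite_rational_metric_spaces M ->
  exists2 d : M -> M -> rat, rational_metric d & metrizes d.
Proof.
move=> HM.
pose P x y (v : rat) := 0 <= v /\ forall q : rel_sym metric_language,
  @rel_in _ M q (tuple2 x y) <-> v <= sval q.
have P_uniq x y v w : P x y v -> P x y w -> v = w.
  move=> [v0 Hv] [w0 Hw]; apply/eqP; rewrite eq_le.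
  have := Hw (dist_le v0); rewrite Hv /= => -[/(_ (lexx v)) wv _].
  have := Hv (dist_le w0); rewrite Hw /= => -[/(_ (lexx w)) vw _].
  by rewrite vw wv.
have loc (C : set M) : finite_set C ->
    exists dC : {x | C x} -> {x | C x} -> rat, rational_metric dC /\
      forall x y, P (sval x) (sval y) (dC x y).
  move=> fC; have cC : fun_closed C by exact: fun_closed_relational.
  have [_ [dC mC HC]] := limit_substr HM cC fC; exists dC; split=> // x y.
  by split=> [|q]; [case: mC|rewrite -HC /= tuple2_comp].
have /choice[d Pd] : forall xy : M * M, exists v, P xy.1 xy.2 v.
  move=> [x y]; have [dC [_ HC]] := loc _ (finite_set2 x y).
  by exists (dC (exist _ x (or_introl erefl)) (exist _ y (or_intror erefl))); exact: HC.
exists (fun x y => d (x, y)); last first.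
  by move=> q x y; have [_] := Pd (x, y); apply.
have dE C dC : (forall x y, P (sval x) (sval y) (dC x y)) ->
    forall x y : {x : M | C x}, d (sval x, sval y) = dC x y.
  by move=> HC x y; apply: P_uniq (HC x y); exact: (Pd (sval x, sval y)).
split.
- by move=> x y; case: (Pd (x, y)).
- move=> x y; have [dC [[_ H0 _ _] HC]] := loc _ (finite_set2 x y).
  have := dE _ _ HC; set x' : {z | [set x; y] z} := exist _ x (or_introl erefl).
  set y' : {z | [set x; y] z} := exist _ y (or_intror erefl).
  move=> /(_ x' y') /= ->; rewrite H0; split=> [/(congr1 (fun z => sval z))//|xy].
  exact: sval_inj.
- move=> x y; have [dC [[_ _ H0 _] HC]] := loc _ (finite_set2 x y).
  have := dE _ _ HC; set x' : {z | [set x; y] z} := exist _ x (or_introl erefl).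
  set y' : {z | [set x; y] z} := exist _ y (or_intror erefl).
  by move=> E; have /= -> := E x' y'; have /= -> := E y' x'; exact: H0.
- move=> x y z; have [dC [[_ _ _ H0] HC]] := loc _ (finite_set3 x y z).
  have := dE _ _ HC; set x' : {t | [set x; y; z] t} := exist _ x (or_introl (or_introl erefl)).
  set y' : {t | [set x; y; z] t} := exist _ y (or_introl (or_intror erefl)).
  set z' : {t | [set x; y; z] t} := exist _ z (or_intror erefl).
  move=> E; have /= -> := E x' y'; have /= -> := E y' z'; have /= -> := E x' z'.
  exact: H0.
Qed.

Variable M : structure metric_language.
Hypothesis HM : fraisse_limit finite_rational_metric_spaces M.
Variable d : M -> M -> rat.
Hypotheses (dM : rational_metric d) (rd : metrizes d).

Let d0 x y : 0 <= d x y. Proof. by case: dM. Qed.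
Let dxx x : d x x = 0. Proof. by case: dM => _ H _ _; apply/H. Qed.
Let dsym x y : d x y = d y x. Proof. by case: dM. Qed.
Let dtri x y z : d x z <= d x y + d y z. Proof. by case: dM. Qed.
Let dpos x y : x <> y -> 0 < d x y.
Proof.
case: dM => _ H _ _ xy; rewrite lt_neqAle d0 andbT eq_sym.
by apply/eqP => /H.
Qed.

Definition metric_extension_dist (f : M -> rat) (x y : option M) : rat :=
  match x, y with
  | Some x, Some y => d x y
  | None, Some y => f y
  | Some x, None => f x
  | None, None => 0
  end.

Definition metric_extension (f : M -> rat) : structure metric_language :=
  @Structure metric_language (option M)
    (fun q t => metric_extension_dist f (t ord0) (t (lift ord0 ord0)) <= sval q)
    (fun f : void => match f with end).

Lemma urysohn_inhabited : inhabited M.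
Proof.
case: HM => _ _ _ ag.
pose N := @Structure metric_language unit (fun _ _ => True) (fun f : void => match f with end).
have /ag[_ [h _]] : finite_rational_metric_spaces N.
  split; first exact: finite_finset.
  exists (fun _ _ => 0).
    by split=> [||//|] // [] [].
  by move=> [q q0] x y; split.
by constructor; exact: (h tt).
Qed.

(** The hypotheses say that [f] is a positive Katetov function on [C]: exactly what the distances to
    a new point have to satisfy. *)
Lemma urysohn_point (C : set M) (f : M -> rat) : finite_set C ->
  (forall x, C x -> 0 < f x) ->
  (forall x y, C x -> C y -> f x <= f y + d x y) ->
  (forall x y, C x -> C y -> d x y <= f x + f y) ->
  exists b, ~ C b /\ forall c, C c -> d b c = f c.
Proof.
move=> fC fpos flip ftri.
pose N := metric_extension f.
pose C' : set N := None |` (Some @` C).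
have cC' : fun_closed C' by exact: fun_closed_relational.
have mN : metrizes (metric_extension_dist f : N -> N -> rat) by [].
have C'S x : C' (Some x) -> C x by move=> [//|[y Cy [<-]]].
have [||||||k [ek kE]] := @extension_property _ _ _ HM N C (Some : M -> N) C' cC'.
- exact: urysohn_inhabited.
- exact: fC.
- exact: fun_closed_relational.
- by apply: (metric_embedding_on rd mN) => [x y _ _ []|].
- by move=> x Cx; right; exists x.
- split; first apply: substr_finite.
    by rewrite finite_setU; split; [exact: finite_set1|exact: finite_image].
  exists (fun x y => metric_extension_dist f (sval x) (sval y)); last first.
    by move=> q x y.
  split.
  + move=> [[x|] Cx] [[y|] Cy] /=; [exact: d0| | |by []]; apply/ltW/fpos; exact: C'S.
  + move=> [[x|] Cx] [[y|] Cy] /=; split.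
    * by case: dM => _ H _ _ /H xy; apply: sval_inj; rewrite /= xy.
    * by move=> /(congr1 (fun z => sval z)) [->].
    * by move=> fx; have := fpos _ (C'S _ Cx); rewrite fx ltxx.
    * by [].
    * by move=> fx; have := fpos _ (C'S _ Cy); rewrite fx ltxx.
    * by [].
    * by move=> _; apply: sval_inj.
    * by [].
  + by move=> [[x|] Cx] [[y|] Cy] /=.
  + move=> [[x|] Cx] [[y|] Cy] [[z|] Cz] //=; rewrite ?addr0 ?add0r //.
    * by rewrite addrC flip //; exact: C'S.
    * by rewrite ftri //; exact: C'S.
    * by rewrite dsym flip //; exact: C'S.
    * by have := fpos _ (C'S _ Cy); lra.
have [ki kr _] := ek.
have CN : C' None by left.
have CS c : C c -> C' (Some c) by move=> Cc; right; exists c.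
exists (k None); split.
  by move=> Cb; have := ki _ _ (CS _ Cb) CN (kE _ Cb).
move=> c Cc.
have H (q : rel_sym metric_language) : d (k None) c <= sval q <-> f c <= sval q.
  have := kr q (tuple2 None (Some c)); rewrite tuple2_comp kE // rd; apply.
  by move=> i; rewrite /tuple2; case: ifP => _; [|exact: CS].
apply/eqP; rewrite eq_le.
have := (H (dist_le (d0 (k None) c))).1 (lexx _).
by have := (H (dist_le (ltW (fpos _ Cc)))).2 (lexx _) => /= -> ->.
Qed.

Lemma urysohn_same_type (A : set M) a b : finite_set A -> ~ A a -> ~ A b ->
  (forall c, A c -> d b c = d a c) -> exists s : aut M, agree A 1%g s /\ s a = b.
Proof.
move=> fA na nb ab.
have Aa c : A c -> c <> a by move=> Ac e; apply: na; rewrite -e.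
apply: (same_type_aut HM) => //; first exact: fun_closed_relational.
apply: (metric_embedding_on rd rd).
  move=> x y [->|Ax] [->|Ay] //; rewrite ?update_same ?update_other //; try exact: Aa.
  + by move=> e; case: nb; rewrite e.
  + by move=> e; case: nb; rewrite -e.
move=> x y [->|Ax] [->|Ay]; rewrite ?update_same ?update_other //; try exact: Aa.
- by rewrite !dxx.
- exact: ab.
- by rewrite dsym ab.
Qed.

(** Put [b] at distance [D + e] from [a] and [D] from the rest of [C]. The triangle inequality
    allows it: [e] is at most the distance from [a] to any other point of [C], and the bound on
    these distances puts any two points of [C] within twice [D] of each other. *)
Lemma urysohn_separate (C : set M) a D : finite_set C -> C a -> 0 < D ->
  (forall c, C c -> d a c <= D) ->
  exists b, [/\ ~ C b, d b a <> D & forall c, C c -> c <> a -> d b c = D].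
Proof.
move=> fC Ca D0 HD.
have [|e e0 He] := @finite_pos_lower_bound _ (C `\ a) (d a) (finite_setD _ fC).
  by move=> c [_ ca]; apply: dpos => ac; apply: ca.
have [|||b [nb Hb]] := @urysohn_point C (fun z => if pselect (z = a) then D + e else D) fC.
- by move=> x _; case: pselect => _ /=; lra.
- move=> x y Cx Cy; case: (pselect (x = a)) => xa; case: (pselect (y = a)) => ya /=.
  + by have := d0 x y; lra.
  + by have := He y (conj Cy ya); rewrite xa; lra.
  + by have := d0 x y; lra.
  + by have := d0 x y; lra.
- move=> x y Cx Cy; have := dtri x a y; rewrite (dsym x a).
  have := HD _ Cx; have := HD _ Cy.
  by case: pselect => xa; case: pselect => ya /=; lra.
exists b; split=> //.
  by rewrite Hb //; case: pselect => //= _; lra.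
by move=> c Cc ca; rewrite Hb //; case: pselect.
Qed.

(** [a] receives a twin with the same distances to the other points, at a distance [e] from [a] that
    exceeds none of these. *)
Lemma urysohn_infinite_orbits : infinite_orbits M.
Proof.
move=> A F a fA _ nA fF.
pose C := a |` (A `|` F).
have fC : finite_set C by rewrite !finite_setU; split; [exact: finite_set1|split].
have [|e e0 He] := @finite_pos_lower_bound _ (C `\ a) (d a) (finite_setD _ fC).
  by move=> c [_ ca]; apply: dpos => ac; apply: ca.
have [|||b [nb Hb]] := @urysohn_point C (fun z => if pselect (z = a) then e else d a z) fC.
- by move=> x Cx; case: pselect => //= xa; apply: dpos => ax; apply: xa.
- move=> x y Cx Cy; case: (pselect (x = a)) => xa; case: (pselect (y = a)) => ya /=.
  + by have := d0 x y; lra.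
  + by have := He y (conj Cy ya); have := d0 x y; lra.
  + by rewrite ya dsym; lra.
  + by have := dtri a y x; rewrite (dsym y x).
- move=> x y Cx Cy; case: (pselect (x = a)) => xa; case: (pselect (y = a)) => ya /=.
  + by rewrite xa ya dxx; lra.
  + by rewrite xa; lra.
  + by rewrite ya dsym; lra.
  + by have := dtri x a y; rewrite (dsym x a).
have [||s [As sa]] := urysohn_same_type fA nA _ _ (b := b).
- by move=> Ab; apply: nb; right; left.
- move=> c Ac; rewrite Hb; last by right; left.
  by case: pselect => //= ca; case: nA; rewrite -ca.
by exists s; split=> //; rewrite sa => Fb; apply: nb; right; right.
Qed.

Lemma urysohn_not_group_topology : ~ zariski_is_group_topology (aut M).
Proof.
apply: relational_criterion => //.
- exact: urysohn_inhabited.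
- exact: urysohn_infinite_orbits.
move=> A a0 g fA na0 Hg.
have dg x y : d (g x) (g y) = d x y.
  have H (q : rel_sym metric_language) : d (g x) (g y) <= sval q <-> d x y <= sval q.
    by rewrite -!rd -(aut_rel g (tuple2 x y)) tuple2_comp.
  apply/eqP; rewrite eq_le.
  have := (H (dist_le (d0 (g x) (g y)))).1 (lexx _).
  by have := (H (dist_le (d0 x y))).2 (lexx _) => /= -> ->.
have fix0 b : ~ A b -> (forall c, A c -> d b c = d a0 c) -> g b = b.
  by move=> nb ab; have [s [As <-]] := urysohn_same_type fA na0 nb ab; exact: Hg.
have a0pos c : A c -> 0 < d a0 c by move=> Ac; apply: dpos => e; apply: na0; rewrite e.
(* A point [a] equidistant from [A] can be put at the same distance [D] from a realization of the
   type of [a0]; there is then room to vary this last distance alone. *)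
have fix1 a D : 0 < D -> (forall c, A c -> d a0 c <= D) ->
    (forall c, A c -> d a c = D) -> g a = a.
  move=> D0 DA aD; apply: contrapT => ga.
  have na : ~ A a by move=> Aa; have := aD _ Aa; rewrite dxx; lra.
  have Aa c : A c -> c <> a by move=> Ac e; apply: na; rewrite -e.
  have [b1 [nb1 b1A b1a]] : exists b, [/\ ~ A b, forall c, A c -> d b c = d a0 c
      & d b a = D].
    pose f := update (d a0) a D.
    have fa : f a = D by exact: update_same.
    have fE c : A c -> f c = d a0 c by move=> Ac; apply: update_other; exact: Aa.
    have [||||b [nb Hb]] := @urysohn_point (a |` A) f.
    + by rewrite finite_setU; split=> //; exact: finite_set1.
    + by move=> x [->|Ax]; [rewrite fa|rewrite fE //; exact: a0pos].
    + move=> x y [->|Ax] [->|Ay].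
      * by rewrite fa dxx; lra.
      * by rewrite fa fE // aD //; have := a0pos _ Ay; lra.
      * by rewrite fa fE // (dsym x a) aD //; have := DA _ Ax; lra.
      * by rewrite !fE //; have := dtri a0 y x; rewrite (dsym y x).
    + move=> x y [->|Ax] [->|Ay].
      * by rewrite fa dxx; lra.
      * by rewrite fa fE // aD //; have := a0pos _ Ay; lra.
      * by rewrite fa fE // (dsym x a) aD //; have := a0pos _ Ax; lra.
      * by rewrite !fE //; have := dtri x a0 y; rewrite (dsym x a0).
    exists b; split.
    + by move=> Ab; apply: nb; right.
    + by move=> c Ac; rewrite Hb; [exact: fE|right].
    + by rewrite Hb; [exact: fa|left].
  have gb1 := fix0 _ nb1 b1A.
  have b1ga : d b1 (g a) = D by rewrite -gb1 dg.
  pose C := A `|` [set g a].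
  have fC : finite_set C by rewrite finite_setU; split=> //; exact: finite_set1.
  have nCa : ~ C a by move=> [//|/= e]; apply: ga.
  (* [e] is the slack by which the distance from [b1] to [a] can be raised. At [g a] the slack is
     the distance from [a] to [g a], positive because [a] is assumed to move. *)
  have [|e e0 He] := @finite_pos_lower_bound _ C (fun z => d b1 z + d a z - D) fC.
    move=> c [Ac|->] /=; first by rewrite b1A ?aD //; have := a0pos _ Ac; lra.
    by rewrite b1ga; have := dpos (fun E => ga (esym E)); lra.
  have Cpos c : C c -> 0 < d b1 c.
    by move=> [Ac|->]; [rewrite b1A //; exact: a0pos|rewrite b1ga].
  (* [b2] has the distances of [b1] to [A] and [g a], but [D + e] to [a]. It realizes the type of
     [a0], so [g] fixes it, although it tells [a] from [g a]. *)
  have [||||b2 [nb2 Hb2]] := @urysohn_point (a |` C) (fun z => if pselect (z = a) then D + e else d b1 z).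
  - by rewrite finite_setU; split=> //; exact: finite_set1.
  - by move=> x; case: pselect => //= xa; [lra|move=> [//|]; exact: Cpos].
  - move=> x y Cx Cy; case: pselect => xa; case: pselect => ya //=.
    + by have := d0 x y; lra.
    + by case: Cy => // /He; rewrite xa; lra.
    + by have := dtri b1 a x; rewrite ya b1a (dsym x a); lra.
    + by have := dtri b1 y x; rewrite (dsym y x).
  - move=> x y Cx Cy; case: pselect => xa; case: pselect => ya //=.
    + by rewrite xa ya dxx; lra.
    + by have := dtri a b1 y; rewrite xa (dsym a b1) b1a; lra.
    + by have := dtri x b1 a; rewrite ya (dsym x b1) b1a; lra.
    + by have := dtri x b1 y; rewrite (dsym x b1).
  have gb2 : g b2 = b2.
    apply: fix0 => [Ab|c Ac]; first by apply: nb2; right; left.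
    rewrite Hb2; last by right; left.
    by case: pselect => [/(Aa _ Ac)//|/= _]; exact: b1A.
  have : d b2 (g a) = d b2 a by rewrite -{1}gb2 dg.
  rewrite Hb2; last by right; right.
  rewrite Hb2; last by left.
  by case: pselect => //= _; case: pselect => //= _; rewrite b1ga; lra.
have [D D0 HD] := finite_pos_upper_bound (d a0) fA.
(* The point [b] has different distances to [a] and [g a], so it cannot be fixed either. Its common
   distance to the rest of [C] is a sum of two bounds, to meet the requirements of [fix1] and of
   [urysohn_separate] at once. *)
have moved a (C : set M) : A `<=` C -> finite_set C -> C a -> C (g a) -> g a <> a ->
    exists b, [/\ ~ C b, g b <> b & exists2 D', 0 < D' & (forall c, A c -> d a0 c <= D') /\
       forall c, C c -> c <> a -> d b c = D'].
  move=> AC fC Ca Cga ga.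
  have [D' D'0 HD'] := finite_pos_upper_bound (d a) fC.
  have [||b [nb ba bC]] := @urysohn_separate C a (D + D') fC Ca.
  - by lra.
  - by move=> c /HD'; lra.
  exists b; split=> //.
    by move=> gb; apply: ba; rewrite -(bC _ Cga ga) -{2}gb dg.
  exists (D + D'); first lra.
  by split=> // c /HD; lra.
have fix_out a : ~ A a -> g a = a.
  move=> na; apply: contrapT => ga.
  have [||||b [nb gb [D' D'0 [HD' bD]]]] := @moved a (A `|` [set a; g a]) _ _ _ _ ga.
  - by move=> x; left.
  - by rewrite finite_setU; split=> //; exact: finite_set2.
  - by right; left.
  - by right; right.
  apply: gb; apply: (fix1 _ D') => // c Ac; apply: bD; first by left.
  by move=> e; apply: na; rewrite -e.
(* A moved point, in [A] or not, yields one outside [A], which [fix_out] excludes. *)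
apply: aut_ext => a; apply: contrapT => ga.
have [||||b [nb gb _]] := @moved a (A `|` [set a; g a]) _ _ _ _ ga.
- by move=> x; left.
- by rewrite finite_setU; split=> //; exact: finite_set2.
- by right; left.
- by right; right.
by apply: gb; apply: fix_out => Ab; apply: nb; left.
Qed.

End Urysohn.

(** * Free amalgamation classes *)


Section Types.
Variables (L : language) (M : structure L).

Lemma term_eval_aut n (s : aut M) (v : 'I_n -> M) (u : term L n) :
  s (term_eval v u) = term_eval (fun i => s (v i)) u.
Proof.
elim: u => //= f ts IH; case: (aut_embedding s) => _ _ ->.
by congr fun_in; apply/funext => i; exact: IH.
Qed.

Lemma sat_aut n (phi : formula L n) (s : aut M) (v : 'I_n -> M) :
  sat phi v <-> sat phi (fun i => s (v i)).
Proof.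
elim: phi v => {n} [n t u|n R ts|n p IH|n p IHp q IHq|n p IH] v /=.
- by rewrite -!term_eval_aut; split=> [->//|/aut_inj].
- rewrite -(aut_rel s) (_ : (fun i => s _) =
    (fun i => term_eval (fun i => s (v i)) (ts i))) //.
  by apply/funext => i; rewrite term_eval_aut.
- by rewrite IH.
- by rewrite IHp IHq.
- have sE x : (fun i => s (scons x v i)) = scons (s x) (fun i => s (v i)).
    by apply/funext => i; rewrite /scons; case: (unlift _ _).
  split=> H x; last by rewrite IH sE; exact: H.
  by rewrite -(aut_mulKV s x) -sE -IH; exact: H.
Qed.

Lemma aut_same_type n (s : aut M) (a b : 'I_n -> M) :
  (forall i, s (a i) = b i) -> same_type a b.
Proof.
by move=> sab phi; rewrite (sat_aut phi s); rewrite (_ : (fun i => s _) = b) //; apply/funext.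
Qed.

Variable K : str_class L.
Hypothesis HM : fraisse_limit K M.
Hypothesis rL : relational L.

Lemma tuple_aut n (a b : 'I_n -> M) : same_equality_type a b ->
  (forall R (u : 'I_(rel_ar R) -> 'I_n),
     @rel_in _ M R (fun i => b (u i)) <-> rel_in (fun i => a (u i))) ->
  exists s : aut M, forall i, s (a i) = b i.
Proof.
move=> ab H.
pose h x := if pselect (exists i, a i = x) is left p then b (projT1 (cid p)) else x.
have hE i : h (a i) = b i.
  rewrite /h; case: pselect => [p|np]; last by case: np; exists i.
  by apply/ab; case: (cid p).
have [s Hs] : exists s : aut M, forall x, range a x -> s x = h x.
  apply: (extend_to_aut HM); first exact: finite_range.
    exact: fun_closed_relational.
  split.
  - by move=> _ _ [i _ <-] [j _ <-]; rewrite !hE => /ab.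
  - move=> R t Ct; have /choice[u Hu] : forall i, exists j, a j = t i.
      by move=> i; have [j _ <-] := Ct i; exists j.
    rewrite (_ : t = fun i => a (u i)); last by apply/funext => i; rewrite Hu.
    by rewrite -H; under [X in rel_in X]funext do rewrite hE.
  - by move=> f; case: (rL f).
by exists s => i; rewrite Hs ?hE //; exists i.
Qed.

(** One implication suffices, equality of equality types being symmetric. Homogeneity then gives an
    automorphism from one tuple to the other, and automorphisms preserve all formulas. *)
Lemma trivial_structure_criterion :
  (forall n (a b : 'I_n -> M), same_equality_type a b ->
     forall R (u : 'I_(rel_ar R) -> 'I_n),
       rel_in (fun i => a (u i)) -> @rel_in _ M R (fun i => b (u i))) ->
  trivial_structure M.
Proof.
move=> H n a b ab; have [|s sab] := @tuple_aut n a b ab; last exact: (@aut_same_type _ s).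
move=> R u; split; last exact: H.
by apply: H => i j; split=> /ab.
Qed.
End Types.

Section FreeAmalgamation.
Variables (L : language) (K : str_class L) (M : structure L).
Hypothesis HM : fraisse_limit K M.
Hypothesis HK : free_amalgamation_class K.
Hypothesis pt : point_transitive M.
Hypothesis iM : inhabited M.

Let rL : relational L. Proof. by case: HK. Qed.

Let cl (N : structure L) (C : set N) : fun_closed C.
Proof. exact: fun_closed_relational. Qed.

Let inB (A : set M) (x : M) : M + M := if pselect (A x) then inl x else inr x.

(** The free amalgam of [B] and [C] over [A], inside [M + M]: [C] occupies the left summand, and
    [inB] places [B] with only its points outside [A] on the right. *)
Definition free_join (A B C : set M) : structure L :=
  @Structure L (M + M)
    (fun R t =>
      (exists s : 'I_(rel_ar R) -> M,
         [/\ forall k, inl (s k) = t k, forall k, C (s k) & rel_in s]) \/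
      (exists s : 'I_(rel_ar R) -> M,
         [/\ forall k, inB A (s k) = t k, forall k, B (s k) & rel_in s]))
    (fun f => match rL f with end).

(** The free amalgam of [B] and [C] over [A] belongs to the class, so it embeds in [M] over [C];
    homogeneity moves [B] onto its copy there. The conclusion is free independence of this copy from
    [C] over [A]. *)
Lemma free_independence (A B C : set M) : A `<=` B -> A `<=` C ->
  finite_set B -> finite_set C ->
  exists s : aut M, [/\ agree A 1%g s,
    forall b, B b -> C (s b) -> A b &
    forall R (t : 'I_(rel_ar R) -> M), rel_in t ->
      (forall i, C (t i) \/ (s @` B) (t i)) ->
      (forall i, C (t i)) \/ (forall i, (s @` B) (t i))].
Proof.
move=> AB AC fB fC.
have inA x : A x -> inB A x = inl x by rewrite /inB; case: pselect.
have innA x : ~ A x -> inB A x = inr x by rewrite /inB; case: pselect.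
have inBl x y : inB A x = inl y -> A x /\ x = y.
  by rewrite /inB; case: pselect => // Ax [].
have inB_inj : injective (inB A).
  by move=> x y; rewrite {1}/inB; case: pselect => [Ax /esym/inBl[]|nA] //;
    rewrite /inB; case: pselect => // _ [].
pose N := free_join A B C.
pose C' : set N := ((inl : M -> N) @` C) `|` ((inB A : M -> N) @` B).
have emb_inl : embedding_on C (inl : M -> N).
  split; [by move=> x y _ _ []| |by move=> f; case: (rL f)].
  move=> R t Ct; split=> [|rt]; last by left; exists t.
  case=> [[s [st Cs rs]]|[s [st Bs rs]]].
    by rewrite (_ : t = s) //; apply/funext => k; have [] := st k.
  by rewrite (_ : t = s) //; apply/funext => k; have [_ ->] := inBl _ _ (st k).
have emb_inB : embedding_on B (inB A : M -> N).
  split; [by move=> x y _ _ /inB_inj| |by move=> f; case: (rL f)].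
  move=> R t Bt; split=> [|rt]; last by right; exists t.
  case=> [[s [st Cs rs]]|[s [st Bs rs]]].
    by rewrite (_ : t = s) //; apply/funext => k; have [_ ->] := inBl _ _ (esym (st k)).
  by rewrite (_ : t = s) //; apply/funext => k; exact/inB_inj.
have KN : K (substr (@cl _ C')).
  pose f (x : substr (@cl _ A)) : substr (@cl _ B) := exist _ (sval x) (AB _ (svalP x)).
  pose g (x : substr (@cl _ A)) : substr (@cl _ C) := exist _ (sval x) (AC _ (svalP x)).
  pose i (x : substr (@cl _ B)) : substr (@cl _ C') :=
    exist C' (inB A (sval x)) (or_intror (imageP _ (svalP x))).
  pose j (x : substr (@cl _ C)) : substr (@cl _ C') :=
    exist C' (inl (sval x)) (or_introl (imageP _ (svalP x))).
  case: HK => _ _ _ Hfree; apply: (Hfree _ _ _ _ f g i j).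
  - exact: (limit_substr HM).
  - exact: (limit_substr HM).
  - split; [|by []|by move=> h; case: (rL h)].
    by move=> x y /(congr1 (fun z => sval z)) /= e; exact: sval_inj.
  - split; [|by []|by move=> h; case: (rL h)].
    by move=> x y /(congr1 (fun z => sval z)) /= e; exact: sval_inj.
  split.
  - split=> x y /(congr1 (fun z => sval z)) /=.
      by move=> /inB_inj e; exact: sval_inj.
    by move=> [e]; exact: sval_inj.
  - by move=> a; apply: sval_inj => /=; apply: inA; exact: svalP.
  - move=> b c /(congr1 (fun z => sval z)) /= /inBl[Ab bc].
    by exists (exist _ (sval b) Ab); apply: sval_inj.
  - move=> [d [[c Cc cd]|[b Bb bd]]]; [right|left].
      by exists (exist _ c Cc); apply: sval_inj.
    by exists (exist _ b Bb); apply: sval_inj.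
  - move=> R t; split=> /=.
      case=> [[s [st Cs rs]]|[s [st Bs rs]]]; [right|left].
        exists (fun k => exist _ (s k) (Cs k)) => // k.
        by apply: sval_inj; exact: st.
      exists (fun k => exist _ (s k) (Bs k)) => // k.
      by apply: sval_inj; exact: st.
    case=> [[s st rs]|[s st rs]]; [right|left].
      exists (fun k => sval (s k)); split=> // k; last exact: svalP.
      by rewrite -st.
    exists (fun k => sval (s k)); split=> // k; last exact: svalP.
    by rewrite -st.
have [|k [ek kE]] := extension_property HM iM fC (@cl _ C) emb_inl _ KN.
  by move=> x Cx; left; exists x.
have [ki kr _] := ek.
have [s Hs] : exists s : aut M, forall b, B b -> s b = k (inB A b).
  apply: (extend_to_aut HM fB (@cl _ B)).
  by apply: embedding_on_comp emb_inB ek => x Bx; right; exists x.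
exists s; split.
- by move=> a Aa; rewrite Hs ?inA ?kE //; [exact: AC|exact: AB].
- move=> b Bb Cb; have e : inB A b = inl (s b).
    apply: (ki (inB A b) (inl (s b))); [by right; exists b|by left; exists (s b)|].
    by rewrite (kE _ Cb) Hs.
  by have [] := inBl _ _ e.
move=> R t rt tCB.
have /choice[t' Ht'] : forall i, exists x : N, C' x /\ k x = t i.
  move=> i; case: (tCB i) => [Ci|[b Bb <-]].
    by exists (inl (t i)); split; [left; exists (t i)|exact: kE].
  by exists (inB A b); split; [right; exists b|rewrite Hs].
have : rel_in t'.
  rewrite -kr; last by move=> i; case: (Ht' i).
  by rewrite (_ : (fun i => _) = t) //; apply/funext => i; case: (Ht' i).
case=> -[u [ut Cu _]]; [left|right] => i; have [_ <-] := Ht' i; rewrite -ut.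
  by rewrite kE.
by exists (u i); rewrite ?Hs.
Qed.

Lemma free_infinite_orbits : infinite_orbits M.
Proof.
move=> A F a fA _ nA fF.
have [||||s [As Bs _]] := @free_independence A (a |` A) (A `|` F).
- by move=> x; right.
- by move=> x; left.
- by rewrite finite_setU; split=> //; exact: finite_set1.
- by rewrite finite_setU.
exists s; split=> // Fs; apply: nA; apply: Bs; first by left.
by right.
Qed.

(** Only constant tuples are related at [a]: this is the type of a point amalgamated freely with [A]
    over the empty set. *)
Definition free_over (A : set M) (a : M) := ~ A a /\
  forall R (t : 'I_(rel_ar R) -> M), rel_in t ->
    (forall i, A (t i) \/ t i = a) -> (exists i, t i = a) -> forall i, t i = a.

Lemma free_over_sub (A A' : set M) a : A `<=` A' -> free_over A' a -> free_over A a.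
Proof.
move=> AA [na fa]; split=> [/AA//|R t rt tA]; apply: fa => // i.
by case: (tA i) => [/AA|]; [left|right].
Qed.

(** Relations on tuples mixing the point with [A] all fail, and on constant tuples [a] and [b] agree
    by transitivity. So there is a single free type over [A]. *)
Lemma free_over_same_type (A : set M) a b : finite_set A ->
  free_over A a -> free_over A b -> exists s : aut M, agree A 1%g s /\ s a = b.
Proof.
move=> fA [na fa] [nb fb]; have [s0 s0a] := pt a b.
have Aa c : A c -> c <> a by move=> Ac e; apply: na; rewrite -e.
apply: (same_type_aut HM fA (@cl _ _) na).
split; [| |by move=> f; case: (rL f)].
  move=> x y [->|Ax] [->|Ay] //; rewrite ?update_same ?update_other //; try exact: Aa.
  + by move=> e; case: nb; rewrite e.
  + by move=> e; case: nb; rewrite -e.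
move=> R t Ct.
case: (pselect (forall i, t i = a)) => [ta|nta].
  rewrite -[X in _ <-> X](aut_rel s0) (_ : (fun i => update _ _ _ _) = (fun i => s0 (t i))) //.
  by apply/funext => i; rewrite ta update_same s0a.
have /existsNP[i ti] := nta.
case: (pselect (exists j, t j = a)) => [[j tj]|nt]; last first.
  rewrite (_ : (fun i => update _ _ _ _) = t) //.
  by apply/funext => j; rewrite update_other // => tj; apply: nt; exists j.
split=> rt.
  have : update id a b (t i) = b.
    apply: (fb R _ rt); last by exists j; rewrite tj update_same.
    move=> l; case: (Ct l) => [->|Al]; first by right; rewrite update_same.
    by left; rewrite update_other //; exact: Aa.
  by rewrite update_other // => tb; case: nb; rewrite -tb; case: (Ct i).
case: ti; apply: (fa R) => //; last by exists j.
by move=> l; case: (Ct l); [right|left].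
Qed.

Hypothesis nontriv : ~ trivial_structure M.

Definition nonconstant (I : Type) (t : I -> M) := exists i j, t i <> t j.

(** If relations held on constant tuples only, transitivity would make them agree on tuples of the
    same equality type, and the structure would be trivial. *)
Lemma nontrivial_relation :
  exists R (t : 'I_(rel_ar R) -> M), rel_in t /\ nonconstant t.
Proof.
apply: contrapT => H; apply: nontriv; apply: (trivial_structure_criterion HM rL).
move=> n a b ab R u ra.
have cst : forall i j, a (u i) = a (u j).
  move=> i j; apply: contrapT => nij; apply: H.
  by exists R, (fun i => a (u i)); split=> //; exists i, j.
(* Without an index [R] is nullary, and the two tuples are equal. *)
case: (pselect (exists i : 'I_(rel_ar R), True)) => [[i _]|ni].
  have [s sab] := pt (a (u i)) (b (u i)).
  rewrite (_ : (fun i => b (u i)) = (fun i => s (a (u i)))); first by rewrite aut_rel.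
  by apply/funext => j; rewrite (cst j i) sab; apply/ab; exact: cst.
rewrite (_ : (fun i => b (u i)) = (fun i => a (u i))) //.
by apply/funext => i; case: ni; exists i.
Qed.

(* A related tuple with the least number k + 1 > 1 of distinct entries: then no
   relation holds between fewer distinct points, so k-sets are homogeneous. *)
Lemma minimal_relation : exists k (s : 'I_k.+1 -> M) R
    (u : 'I_(rel_ar R) -> 'I_k.+1) i0 i1,
  [/\ injective s, rel_in (fun i => s (u i)), u i0 <> u i1 &
      forall (b : 'I_k -> M) R' (v : 'I_(rel_ar R') -> 'I_k),
        nonconstant (fun i => b (v i)) -> ~ rel_in (fun i => b (v i))].
Proof.
pose P k := exists (s : 'I_k -> M) R (u : 'I_(rel_ar R) -> 'I_k),
  rel_in (fun i => s (u i)) /\ nonconstant (fun i => s (u i)).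
have exP : exists k, `[< P k >].
  have [R [t [rt nt]]] := nontrivial_relation.
  by exists (rel_ar R); apply/asboolP; exists t, R, id.
case: (ex_minnP exP) => -[|k] /asboolP[s [R [u [ru [i0 [i1 ui]]]]]] kmin.
  by case: (u i0).
have nP : ~ P k by move=> /asboolP/kmin; rewrite ltnn.
exists k, s, R, u, i0, i1; split=> //.
(* If two entries coincided, the index [x] could be dropped, against minimality. *)
- move=> x y sxy; apply: contrapT => xy; apply: nP.
  have [y' yE] : exists y', y = lift x y'.
    by case: (unliftP x y) => [y' ->|e]; [exists y'|case: xy].
  exists (fun j => s (lift x j)), R, (fun i => odflt y' (unlift x (u i))).
  have E i : s (lift x (odflt y' (unlift x (u i)))) = s (u i).
    by case: (unliftP x (u i)) => [z ->//|->/=]; rewrite -yE.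
  split; first by under [X in rel_in X]funext do rewrite E.
  by exists i0, i1; rewrite !E.
- by move=> e; apply: ui; rewrite e.
- by move=> b R' v nb rb; apply: nP; exists b, R', v.
Qed.

Lemma free_pointwise_stabilizer : pointwise_stabilizer_free M.
Proof.
move=> A a0 g fA na0 Hg.
have [k [s [R [u [i0 [i1 [s_inj rs u01 kmin]]]]]]] := minimal_relation.
(* By [kmin], relations among [k] points hold on constant tuples only, and these are compared by
   transitivity. So any two injective [k]-tuples are conjugate. *)
have homog (b c : 'I_k -> M) : injective b -> injective c ->
    exists r : aut M, forall i, r (b i) = c i.
  move=> bi ci; apply: (tuple_aut HM rL); first by move=> i j; split=> [/bi|/ci] ->.
  move=> R' v; case: (pselect (exists i j, v i <> v j)) => [[i [j vij]]|nv].
    split=> H; exfalso; move: H; apply: kmin; exists i, j; first by move=> /ci.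
    by move=> /bi.
  have vc i j : v i = v j by apply: contrapT => vij; apply: nv; exists i, j.
  case: (pselect (exists i : 'I_(rel_ar R'), True)) => [[i _]|ni].
    have [r rbc] := pt (b (v i)) (c (v i)).
    rewrite -[X in _ <-> X](aut_rel r).
    rewrite (_ : (fun i => c (v i)) = (fun i => r (b (v i)))) //.
    by apply/funext => j; rewrite (vc j i).
  rewrite (_ : (fun i => c (v i)) = (fun i => b (v i))) //.
  by apply/funext => i; case: ni; exists i.
pose lifted j := s (lift (u i0) j).
have lifted_inj : injective lifted by move=> x y /s_inj/lift_inj.
have values i : u i = u i0 \/ exists j, u i = lift (u i0) j.
  by case: (unliftP (u i0) (u i)) => [j ->|]; [right; exists j|left].
have [j1 uj1] : exists j, u i1 = lift (u i0) j.
  by case: (values i1) => // e; case: u01.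
pose O := [set x | exists2 s : aut M, agree A 1%g s & x = s a0].
have iO : infinite_set O.
  move=> fO; have [t [At nt]] := free_infinite_orbits fA (@cl _ A) na0 fO.
  by apply: nt; exists t.
have OnA x : O x -> ~ A x.
  move=> [t At ->] Ata; apply: na0; suff -> : a0 = t a0 by [].
  by apply: (@aut_inj _ _ t); rewrite -(At _ Ata).
have gO x : O x -> g x = x by move=> [t At ->]; exact: Hg.
have Omul x (t : aut M) : agree A 1%g t -> O x -> O (t x).
  by move=> At [r Ar ->]; exists (t * r)%g => // a Aa; rewrite aut_mulE -Ar // -At.
(* Orbit points, all fixed by [g], joined by [R] to a point free over [A]. *)
have [b [w [b_inj [Ob [wb [a2 [fa2 [wa2 [rw a2b]]]]]]]]] : exists (b : 'I_k -> M) (w : 'I_(rel_ar R) -> M),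
    injective b /\ (forall j, O (b j)) /\
    (forall i, u i <> u i0 -> exists j, w i = b j) /\
    exists a, free_over A a /\ (forall i, u i = u i0 -> w i = a) /\ rel_in w /\ forall j, b j <> a.
  have [b [b_inj _ Ob]] := @extend_injection 'I_k M set0 setT (fun _ => a0) O
    (finite_set0 _) finite_finset iO (fun x _ h _ => match h with end).
  have {}b_inj : injective b by move=> x y; apply: b_inj; right.
  have {}Ob j : O (b j) by apply: Ob.
  have [r rb] := homog _ _ lifted_inj b_inj.
  pose a1 := r (s (u i0)).
  have [||||t [bt Bt Rt]] := @free_independence (range b) (a1 |` range b) (A `|` range b).
  - by move=> x; right.
  - by move=> x; right.
  - by rewrite finite_setU; split; [exact: finite_set1|exact: finite_range].
  - by rewrite finite_setU; split => //; exact: finite_range.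
  have a1b j : b j <> a1 by rewrite -rb => /aut_inj/s_inj/eqP; rewrite eq_sym (negbTE (neq_lift _ _)).
  have ta1 : ~ (A `|` range b) (t a1).
    by move=> /Bt; case; [left|move=> j _; exact: a1b].
  have tb j : t (b j) = b j by rewrite -bt.
  exists b, (fun i => t (r (s (u i)))); do 2 split=> //; split.
    move=> i; case: (values i) => // -[j uj] _; exists j.
    by rewrite uj (rb j) tb.
  exists (t a1); split; last first.
    split; first by move=> i ->.
    split; first by rewrite aut_rel aut_rel.
    by move=> j e; apply: ta1; right; exists j.
  split; first by move=> At; apply: ta1; left.
  move=> R' v rv vA [i vi] l.
  have [|H|H] := Rt R' v rv.
  - move=> m; case: (vA m) => [Am|->]; first by left; left.
    by right; exists a1 => //; left.
  - by case: ta1; rewrite -vi.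
  - case: (vA l) => // Al; have [x [->//|[j _ <-]]] := H l.
    by rewrite tb => e; case: (OnA _ (Ob j)); rewrite e.
(* Orbit points joined to [a] by [R] are moved over [a] and [A] to be free from [g a]. As [g] fixes
   them, they are joined to [g a] too, against freeness. *)
have step1 a : free_over A a -> ~ A (g a) -> g a = a.
  move=> fa nAg; apply: contrapT => ga.
  have [r [Ar ra]] := free_over_same_type fA fa2 fa.
  pose b' j := r (b j).
  have fb' : finite_set (range b') by exact: finite_range.
  have [||||t [At Bt Rt]] := @free_independence (a |` A) (a |` A `|` range b') (a |` A `|` [set g a]).
  - by move=> x; left.
  - by move=> x; left.
  - by rewrite !finite_setU; do !split => //; exact: finite_set1.
  - by rewrite !finite_setU; do !split => //; exact: finite_set1.
  have At' : agree A 1%g t by move=> x Ax; rewrite At //; right.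
  have Ob'' j : O (t (b' j)) by apply: (Omul _ _ At'); exact: (Omul _ _ Ar).
  have nb' j : ~ (a |` A `|` [set g a]) (t (b' j)).
    move=> /Bt; case; first by right; exists j.
    - by rewrite -ra => /aut_inj; exact: a2b.
    - exact: OnA (Omul _ _ Ar (Ob j)).
  have rgw : rel_in (fun i => g (t (r (w i)))) by rewrite !aut_rel.
  have ta : t a = a by rewrite -At //; left.
  have [i|H|H] := Rt _ _ rgw.
  - case: (pselect (u i = u i0)) => ui.
      by left; right; rewrite (wa2 _ ui) ra ta.
    have [j wj] := wb _ ui.
    right; exists (b' j); first by right; exists j.
    by rewrite wj (gO _ (Ob'' j)).
  - have [j wj] := wb _ (fun e => u01 (esym e)).
    by have := H i1; rewrite wj (gO _ (Ob'' j)); exact: nb'.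
  - have := H i0; rewrite (wa2 _ erefl) ra ta => -[x Bx txg].
    have : (a |` A) x by apply: Bt => //; rewrite txg; right.
    move=> aAx; have xg : x = g a by rewrite -txg -At.
    by case: aAx; rewrite xg.
clear w wb rw wa2.
(* Being outside [A1] also keeps [g a] out of [A], as [step1] requires. *)
pose A1 := A `|` g @^-1` A.
have fA1 : finite_set A1 by rewrite finite_setU; split=> //; exact: finite_preim_aut.
have step2 a : free_over A1 a -> g a = a.
  move=> fa; apply: step1; first by apply: free_over_sub fa => x; left.
  by case: fa => na _ Aga; apply: na; right.
(* The other points of the tuple are taken free over [a] from [A1] and [a'], so they cannot be
   joined to [a'] in place of [a]. When [a] is outside [A1], the same independence makes them free
   over [A1]. *)
have separate a a' : a <> a' -> exists w : 'I_(rel_ar R) -> M,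
    [/\ rel_in w, forall i, w i <> a -> ~ A1 (w i),
        ~ A1 a -> forall i, w i <> a -> free_over A1 (w i) &
        ~ rel_in (fun i => update id a a' (w i))].
  move=> aa'; have [r ra] := pt (s (u i0)) a.
  pose c j := r (lifted j).
  have ca j : c j <> a.
    by rewrite -ra => /aut_inj/s_inj/eqP; rewrite eq_sym (negbTE (neq_lift _ _)).
  have fc : finite_set (range c) by exact: finite_range.
  have [||||t [At Bt Rt]] := @free_independence [set a] (a |` range c) (A1 `|` [set a; a']).
  - by move=> x; left.
  - by move=> x ->; right; left.
  - by rewrite finite_setU; split => //; exact: finite_set1.
  - by rewrite finite_setU; split => //; exact: finite_set2.
  have ta : t a = a by rewrite -At.
  have tca j : t (c j) <> a by rewrite -[X in _ <> X]ta => /aut_inj; exact: ca.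
  have nc j : ~ (A1 `|` [set a; a']) (t (c j)).
    by move=> /Bt; move/(_ (or_intror (imageP _ I))); exact: ca.
  pose w i := t (r (s (u i))).
  have wv i : w i = a \/ exists j, w i = t (c j).
    case: (values i) => [ui|[j uj]]; first by left; rewrite /w ui ra ta.
    by right; exists j; rewrite /w uj.
  exists w; split.
  - by rewrite /w !aut_rel.
  - by move=> i; case: (wv i) => // -[j ->] _ H; apply: (nc j); left.
  - move=> na i; case: (wv i) => // -[j ->] _; split; first by move=> H; apply: (nc j); left.
    move=> R' v rv vA [l vl] m.
    have [n|H|H] := Rt R' v rv.
    + case: (vA n) => [An|->]; first by left; left.
      by right; exists (c j) => //; right; exists j.
    + by case: (nc j); rewrite -vl.
    + case: (vA m) => // Am; have [x Bx tx] := H m.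
      have xa : x = a by apply: Bt => //; rewrite tx; left.
      by case: na; rewrite -ta -xa tx.
  - move=> H; case: (Rt _ _ H) => [i|H1|H1].
    + case: (wv i) => [->|[j ->]]; first by left; right; right; rewrite update_same.
      right; exists (c j); first by right; exists j.
      by rewrite update_other.
    + have := H1 i1; rewrite /w uj1 update_other; last exact: tca.
      exact: nc.
    + have := H1 i0; rewrite /w ra ta update_same => -[x Bx tx].
      have xa : x = a by apply: Bt => //; rewrite tx; right; right.
      by apply: aa'; rewrite -tx xa ta.
have moved a w : rel_in w -> (forall i, w i <> a -> g (w i) = w i) ->
    rel_in (fun i : 'I_(rel_ar R) => update id a (g a) (w i)).
  move=> rw' gw; rewrite (_ : (fun i => _) = (fun i => g (w i))) ?aut_rel //.
  apply/funext => i; case: (pselect (w i = a)) => wi; first by rewrite wi update_same.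
  by rewrite update_other // gw.
(* The other points of the tuple at [a] are free over [A1], hence fixed by [step2]; so [R] would
   persist with [g a] in place of [a]. *)
have step3 a : ~ A1 a -> g a = a.
  move=> na; apply: contrapT => ga.
  have [v [rv _ /(_ na) fv nv]] := separate a (g a) (fun e => ga (esym e)).
  by apply: nv; apply: moved => // i va; apply: step2; exact: fv.
(* The same argument, with the other points merely outside [A1], hence fixed by [step3]. *)
apply: aut_ext => a; apply: contrapT => ga.
have [v [rv nv _ nrv]] := separate a (g a) (fun e => ga (esym e)).
by apply: nrv; apply: moved => // i va; apply: step3; exact: nv.
Qed.

Lemma free_amalgamation_not_group_topology : ~ zariski_is_group_topology (aut M).
Proof.
apply: relational_criterion => //.
- exact: free_infinite_orbits.
- exact: free_pointwise_stabilizer.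
Qed.
End FreeAmalgamation.

(** * Superpositions *)


Lemma left_inverse_on (T U : Type) (E : set T) (h : T -> U) : inhabited T ->
  inj_on E h -> exists h' : U -> T, forall x, E x -> h' (h x) = x.
Proof.
move=> [x0] ih.
exists (fun y => if pselect (exists x, E x /\ h x = y) is left p then projT1 (cid p) else x0).
move=> x Ex; case: pselect => [p|np]; last by case: np; exists x.
by case: (cid p) => y /= [Ey]; exact: ih.
Qed.

Section StrongAmalgamation.
Variables (L : language) (K : str_class L) (M : structure L).
Hypothesis HM : fraisse_limit K M.
Hypothesis strong : strong_amalgamation K.

(** A strong amalgam is embedded in [M] and moved by [r] until [C] is in place; [s] takes [B] to
    where it then lies. *)
Lemma strong_disjoint (A B C : set M) : A `<=` B -> A `<=` C ->
  finite_set B -> finite_set C ->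
  fun_closed A -> fun_closed B -> fun_closed C ->
  exists s : aut M, agree A 1%g s /\ forall b, B b -> C (s b) -> A b.
Proof.
move=> AB AC fB fC cA cB cC.
pose f (x : substr cA) : substr cB := exist _ (sval x) (AB _ (svalP x)).
pose g (x : substr cA) : substr cC := exist _ (sval x) (AC _ (svalP x)).
have ef : embedding f.
  split=> //; first by move=> x y /(congr1 (fun z => sval z)) /= e; exact: sval_inj.
  by move=> h t; exact: sval_inj.
have eg : embedding g.
  split=> //; first by move=> x y /(congr1 (fun z => sval z)) /= e; exact: sval_inj.
  by move=> h t; exact: sval_inj.
have fA : finite_set A by exact: sub_finite_set AB fB.
have [D [i [j [KD ei ej ij dij]]]] :=
  strong (limit_substr HM cA fA) (limit_substr HM cB fB) (limit_substr HM cC fC) ef eg.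
case: (HM) => _ _ uh ag; have [_ [h eh]] := (ag D).1 KD.
have comp (P Q R : structure L) (u : P -> Q) (v : Q -> R) :
    embedding u -> embedding v -> embedding (fun x => v (u x)).
  move=> [u1 u2 u3] [v1 v2 v3]; split.
  - by move=> x y /v1/u1.
  - by move=> S t; rewrite v2 u2.
  - by move=> S t; rewrite u3 v3.
have [r rE] := uh (substr cC) _ _ (substr_finite cC fC) (comp _ _ _ _ _ ej eh) (substr_embedding cC).
have [s sE] := uh (substr cB) _ _ (substr_finite cB fB) (substr_embedding cB)
  (comp _ _ _ _ _ (comp _ _ _ _ _ ei eh) (aut_embedding r)).
exists s; split.
  move=> a Aa; pose a0 : substr cA := exist _ a Aa.
  exact: esym (etrans (sE (f a0)) (etrans (congr1 (fun z => r (h z)) (ij a0)) (rE (g a0)))).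
move=> b Bb Cb; pose b0 : substr cB := exist _ b Bb; pose c0 : substr cC := exist _ (s b) Cb.
have /dij[a ba _] : i b0 = j c0.
  case: eh => hi _ _; apply: hi; apply: (@aut_inj _ _ r).
  exact: etrans (esym (sE b0)) (esym (rE c0)).
by have := congr1 (fun z => sval z) ba => /= ->; exact: svalP.
Qed.

Lemma strong_infinite_orbits : infinite_orbits M.
Proof.
move=> A F a fA cA nA fF.
have [B [fB sB cB]] : exists Y : set M, [/\ finite_set Y, a |` A `<=` Y & fun_closed Y].
  by apply: (closure_ex HM); rewrite finite_setU; split=> //; exact: finite_set1.
have [C [fC sC cC]] : exists Y : set M, [/\ finite_set Y, A `|` F `<=` Y & fun_closed Y].
  by apply: (closure_ex HM); rewrite finite_setU.
have [||s [As Bs]] := strong_disjoint _ _ fB fC cA cB cC.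
- by move=> x Ax; apply: sB; right.
- by move=> x Ax; apply: sC; left.
exists s; split=> // Fs; apply: nA; apply: Bs; first by apply: sB; left.
by apply: sC; right.
Qed.
End StrongAmalgamation.

(** As the tuple avoids [a'], its entries other than [a] can be moved over [a] and [a'] away from
    any finite set, and then be realized by points known to be fixed. *)
Definition distinguishes_points (L : language) (M : structure L) :=
  forall a a' : M, a <> a' -> exists R (t : 'I_(rel_ar R) -> M),
    (forall i, t i <> a') /\
    ~ (rel_in (fun i => update id a a' (t i)) <-> rel_in t).

(** This is [splits_closed] inside a given finite [C]. Finite sets of the superposition are seen in
    [M2] only through an embedding, along which [A'] has to be pulled back. *)
Definition splits_within (L : language) (M : structure L) :=
  forall (A C : set M) a, finite_set C -> fun_closed A -> fun_closed C ->
    A `<=` C -> C a -> ~ A a ->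
    exists A' : set M, [/\ A `<=` A', A' `<=` C, ~ A' a, fun_closed A'
      & fun_closed (a |` A')].

(** [b] is a twin of [a] over [A] that can be added to [C] alone and sees a difference between [a]
    and [a']. The map [e] tells which places of [R] are taken by [b]. *)
Definition separates_twins (L : language) (M : structure L) :=
  forall (A C : set M) a a', finite_set C -> fun_closed A -> fun_closed C ->
    A `<=` C -> C a -> ~ A a -> fun_closed (a |` A) -> C a' -> a <> a' ->
    exists b, [/\ ~ C b, fun_closed (b |` C),
      embedding_on (a |` A) (update id a b) &
      exists R (e : 'I_(rel_ar R) -> bool),
        ~ (rel_in (fun i => if e i then b else a) <->
           rel_in (fun i => if e i then b else a'))].

Section Superposition.
Variables (L1 L2 : language) (K1 : str_class L1) (K2 : str_class L2).
Variables (M1 : structure L1) (M2 : structure L2).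
Variable M : structure (language_sum L1 L2).
Hypothesis rL1 : relational L1.
Hypothesis HM1 : fraisse_limit K1 M1.
Hypothesis HM2 : fraisse_limit K2 M2.
Hypothesis HM : fraisse_limit (superposition K1 K2) M.
Hypothesis strong1 : strong_amalgamation K1.
Hypothesis strong2 : strong_amalgamation K2.
Hypothesis iM1 : inhabited M1.
Hypothesis iM2 : inhabited M2.
Hypothesis closed0 : fun_closed (set0 : set M2).
Hypothesis dist1 : distinguishes_points M1.
Hypothesis split2 : splits_within M2.
Hypothesis sep2 : separates_twins M2.

Let cl1 (N : structure L1) (C : set N) : fun_closed C.
Proof. exact: fun_closed_relational. Qed.

Lemma infinite_M1 : infinite_set [set: M1].
Proof.
apply: infinite_carrier => //; exact: strong_infinite_orbits HM1 strong1.
Qed.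

Lemma fun_closed_reduct2 (N : structure (language_sum L1 L2)) (C : set N) :
  fun_closed C <-> @fun_closed L2 (reduct2 N) C.
Proof.
split=> cC; first by move=> f t; exact: (cC (inr f)).
by move=> [f|f] t; [case: (rL1 f)|exact: cC].
Qed.

Lemma embedding_on_reducts (N P : structure (language_sum L1 L2)) (C : set N) (h : N -> P) :
  @embedding_on L1 (reduct1 N) (reduct1 P) C h ->
  @embedding_on L2 (reduct2 N) (reduct2 P) C h -> embedding_on C h.
Proof.
move=> [h1 h2 h3] [k1 k2 k3]; split=> //.
  by move=> [R|R] t; [exact: h2|exact: k2].
by move=> [f|f] t; [exact: h3|exact: k3].
Qed.

Lemma embed_reduct1 (C : set M) : finite_set C -> fun_closed C ->
  exists h : M -> M1, @embedding_on L1 (reduct1 M) M1 C h.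
Proof.
move=> fC cC; have [_ K1C _] := limit_substr HM cC fC.
apply: (@embed_in_limit L1 K1 M1 HM1 (reduct1 M) C (fun f => cC (inl f))) => //.
Qed.

Lemma embed_reduct2 (C : set M) : finite_set C -> fun_closed C ->
  exists h : M -> M2, @embedding_on L2 (reduct2 M) M2 C h.
Proof.
move=> fC cC; have [_ _ K2C] := limit_substr HM cC fC.
apply: (@embed_in_limit L2 K2 M2 HM2 (reduct2 M) C (fun f => cC (inr f))) => //.
Qed.

(* Since [L1] is relational, every finite structure of the class is found, up to
   isomorphism, inside such a pullback: [K2] provides the carrier and the
   functions. *)
Definition pullback (p : M2 -> M1) : structure (language_sum L1 L2) :=
  @Structure (language_sum L1 L2) M2
    (fun R => match R return ('I_(@rel_ar (language_sum L1 L2) R) -> M2) -> Prop with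
              | inl R => fun t => @rel_in L1 M1 R (fun i => p (t i))
              | inr R => fun t => @rel_in L2 M2 R t end)
    (fun f => match f return ('I_(@fun_ar (language_sum L1 L2) f) -> M2) -> M2 with
              | inl f => match rL1 f with end
              | inr f => fun t => @fun_in L2 M2 f t end).

Lemma pullback_closed p (C : set M2) : fun_closed C ->
  @fun_closed _ (pullback p) C.
Proof. by move=> cC [f|f] t; [case: (rL1 f)|exact: cC]. Qed.

Lemma pullback_in_class p (C : set M2) (cC : @fun_closed _ (pullback p) C) :
  finite_set C -> inj_on C p -> superposition K1 K2 (substr cC).
Proof.
move=> fC ip; split; first exact: substr_finite.
  case: (HM1) => _ _ _ ag; apply/ag; split; first exact: finite_setT_sig.
  exists (fun x => p (sval x)); split; [|by []|by move=> f; case: (rL1 f)].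
  by move=> x y /ip e; apply: sval_inj; apply: e; exact: svalP.
case: (HM2) => _ _ _ ag; apply/ag; split; first exact: finite_setT_sig.
by exists (fun x => sval x); split=> //; exact: sval_inj.
Qed.

Lemma superposition_inhabited : inhabited M.
Proof.
case: iM2 => p2.
have [C [fC sC cC]] := closure_ex HM2 (finite_set1 p2).
case: (iM1) => p1.
have [p [ip _ _]] := @extend_injection M2 M1 set0 C (fun _ => p1) setT
  (finite_set0 _) fC infinite_M1 (fun x _ h _ => match h with end).
have ip' : inj_on C p by move=> x y Cx Cy; apply: ip; right.
case: (HM) => _ _ _ ag.
have [_ [h _]] := (ag _).1 (pullback_in_class (pullback_closed cC) fC ip').
by constructor; exact: (h (exist _ p2 (sC _ erefl))).
Qed.

(** The two parts of an extension of [C] can be prescribed independently: [C'] gives the [K2]-part,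
    and the injective labelling [p] of its points by points of [M1] gives the [K1]-part. *)
Lemma superposition_extension (C : set M) (C' : set M2) (h2 : M -> M2) (p : M2 -> M1) :
  finite_set C -> fun_closed C -> finite_set C' -> fun_closed C' ->
  (forall c, C c -> C' (h2 c)) -> inj_on C' p ->
  @embedding_on L2 (reduct2 M) M2 C h2 ->
  @embedding_on L1 (reduct1 M) M1 C (fun c => p (h2 c)) ->
  exists k : M2 -> M, [/\ @embedding_on L2 M2 (reduct2 M) C' k,
    forall c, C c -> k (h2 c) = c &
    forall R (t : 'I_(rel_ar R) -> M2), (forall i, C' (t i)) ->
      (@rel_in _ (reduct1 M) R (fun i => k (t i)) <-> @rel_in _ M1 R (fun i => p (t i)))].
Proof.
move=> fC cC fC' cC' CC' ip e2 e1.
have eh : @embedding_on _ M (pullback p) C h2.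
  by apply: embedding_on_reducts => //; case: e1 => i1 r1 _; case: e2 => i2 _ _; split=> // f; case: (rL1 f).
have [k [[k1 k2 k3] kE]] := extension_property HM superposition_inhabited fC cC eh CC'
  (pullback_in_class (pullback_closed cC') fC' ip).
exists k; split=> //.
  split=> //; first by move=> R t; exact: (k2 (inr R)).
  by move=> f t; exact: (k3 (inr f)).
by move=> R t; exact: (k2 (inl R)).
Qed.

(** Strong amalgamation is applied in [M1] and in [M2] separately; a labelling then glues the two
    copies of [B] into one copy in [M]. *)
Lemma superposition_infinite_orbits : infinite_orbits M.
Proof.
move=> A F a fA cA nA fF.
have [B [fB sB cB]] : exists Y : set M, [/\ finite_set Y, a |` A `<=` Y & fun_closed Y].
  by apply: (closure_ex HM); rewrite finite_setU; split=> //; exact: finite_set1.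
have [C [fC sC cC]] : exists Y : set M, [/\ finite_set Y, A `|` F `<=` Y & fun_closed Y].
  by apply: (closure_ex HM); rewrite finite_setU.
have [E [fE sE cE]] : exists Y : set M, [/\ finite_set Y, B `|` C `<=` Y & fun_closed Y].
  by apply: (closure_ex HM); rewrite finite_setU.
have AB : A `<=` B by move=> x Ax; apply: sB; right.
have AC : A `<=` C by move=> x Ax; apply: sC; left.
have BE : B `<=` E by move=> x Bx; apply: sE; left.
have CE : C `<=` E by move=> x Cx; apply: sE; right.
have AE := subset_trans AB BE.
have [h1 e1] := embed_reduct1 fE cE.
have [h2 e2] := embed_reduct2 fE cE.
have [i1 r1 _] := e1; have [i2 r2 _] := e2.
have img (X : set M) : X `<=` E -> fun_closed X -> fun_closed (h2 @` X).
  move=> XE /fun_closed_reduct2 cX; apply: (@fun_closed_image L2 (reduct2 M)) => //.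
  exact: sub_embedding_on e2.
have [|||||||t1 [A1 D1]] := strong_disjoint HM1 strong1 (A := h1 @` A) (B := h1 @` B) (C := h1 @` C).
- exact: image_subset.
- exact: image_subset.
- exact: finite_image.
- exact: finite_image.
- exact: cl1.
- exact: cl1.
- exact: cl1.
have [|||||||t2 [A2 D2]] := strong_disjoint HM2 strong2 (A := h2 @` A) (B := h2 @` B) (C := h2 @` C).
- exact: image_subset.
- exact: image_subset.
- exact: finite_image.
- exact: finite_image.
- exact: img.
- exact: img.
- exact: img.
have [h2' h2K] := left_inverse_on superposition_inhabited i2.
(* [C] keeps its labels, and the copy of [B] in [M2] is labelled by the copy of [B] in [M1]. *)
pose p0 y := if pselect ((h2 @` C) y) then h1 (h2' y) else t1 (h1 (h2' (t2^-1%g y))).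
have p0C c : C c -> p0 (h2 c) = h1 c.
  move=> Cc; rewrite /p0; case: pselect => [?|[]] /=; last by exists c.
  by rewrite h2K //; exact: CE.
have imA (h : M -> M1) b : B b -> inj_on E h -> (h @` A) (h b) -> A b.
  by move=> Bb ih [a' Aa' e]; rewrite -(ih _ _ (AE _ Aa') (BE _ Bb) e).
have imA2 b : B b -> (h2 @` A) (h2 b) -> A b.
  by move=> Bb [a' Aa' e]; rewrite -(i2 _ _ (AE _ Aa') (BE _ Bb) e).
have p0B b : B b -> p0 (t2 (h2 b)) = t1 (h1 b).
  move=> Bb; rewrite /p0; case: pselect => [Ct|?] /=.
    have /imA2 Ab : (h2 @` A) (h2 b) by apply: D2 => //; exists b.
    have <- : h2 b = t2 (h2 b) by rewrite -A2 //; exists b => //; exact: Ab.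
    rewrite h2K; last exact: BE.
    by rewrite -A1 //; exists b => //; exact: Ab.
  by rewrite aut_funK h2K //; exact: BE.
pose X := (h2 @` C) `|` ((fun b => t2 (h2 b)) @` B).
have fX : finite_set X by rewrite finite_setU; split; exact: finite_image.
have p0inj : inj_on X p0.
  (* Labels can coincide only where the copies in [M1] meet. By [D1] this is over [A], where nothing
     has been moved. *)
  have cross c b : C c -> B b -> h1 c = t1 (h1 b) -> h2 c = t2 (h2 b).
    move=> Cc Bb e; have Ab : A b.
      by apply: (imA h1) => //; apply: D1; [exists b|rewrite -e; exists c].
    have tb : t1 (h1 b) = h1 b by rewrite -A1 //; exists b.
    have -> : t2 (h2 b) = h2 b by rewrite -A2 //; exists b.
    by congr h2; apply: i1; [exact: CE|exact: BE|rewrite -tb].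
  move=> _ _ [[c Cc <-]|[b Bb <-]] [[c' Cc' <-]|[b' Bb' <-]]; rewrite ?p0C ?p0B //.
  - by move=> /i1 -> //; exact: CE.
  - exact: cross.
  - by move=> /esym/cross -> //.
  - by move=> /aut_inj/i1 -> //; exact: BE.
have [C' [fC' sC' cC']] := closure_ex HM2 fX.
have [p [ip pE _]] := extend_injection fX fC' infinite_M1 p0inj.
have ip' : inj_on C' p by move=> x y Cx Cy; apply: ip; right.
have XC c : C c -> X (h2 c) by move=> Cc; left; exists c.
have XB b : B b -> X (t2 (h2 b)) by move=> Bb; right; exists b.
have [|||k [k1 kE k2]] := superposition_extension fC cC fC' cC' (h2 := h2) _ ip'.
- by move=> c /XC/sC'.
- exact: sub_embedding_on e2.
- apply: (@eq_embedding_on L1 (reduct1 M) M1 C h1) => //.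
    by move=> c Cc; rewrite pE ?p0C //; exact: XC.
  exact: sub_embedding_on e1.
have [s Hs] : exists s : aut M, forall b, B b -> s b = k (t2 (h2 b)).
  apply: (extend_to_aut HM) => //; apply: embedding_on_reducts.
    split; last by move=> f; case: (rL1 f).
      move=> x y Bx By e; case: k1 => ki _ _.
      apply: i2; [exact: BE|exact: BE|apply: (@aut_inj _ _ t2)].
      exact: (ki _ _ (sC' _ (XB _ Bx)) (sC' _ (XB _ By)) e).
    move=> R t Bt; rewrite (k2 R (fun i => t2 (h2 (t i)))).
      rewrite -r1; last by move=> i; exact: BE.
      rewrite -[X in _ <-> X](aut_rel t1).
      rewrite (_ : (fun i => p _) = (fun i => t1 (h1 (t i)))) //.
      by apply/funext => i; rewrite pE ?p0B //; exact: XB.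
    by move=> i; apply: sC'; exact: XB.
  apply: (@embedding_on_comp L2 (reduct2 M) M2 (reduct2 M) B C' _ k) => //.
    by move=> b /XB/sC'.
  apply: (@embedding_on_comp L2 (reduct2 M) M2 M2 B setT h2 t2) => //.
    exact: sub_embedding_on e2.
  exact/embedding_onW/aut_embedding.
have Ba : B a by apply: sB; left.
exists s; split.
  move=> x Ax; rewrite Hs; last exact: AB.
  have <- : h2 x = t2 (h2 x) by rewrite -A2 //; exists x.
  by rewrite kE //; exact: AC.
rewrite Hs // => Fa; have Ca : C (k (t2 (h2 a))) by apply: sC; right.
apply: nA; apply: imA2 => //; apply: D2; first by exists a.
exists (k (t2 (h2 a))) => //; case: k1 => ki _ _; apply: ki.
- by apply: sC'; exact: XC.
- by apply: sC'; exact: XB.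
- exact: kE.
Qed.

Lemma superposition_splits : splits_closed M.
Proof.
move=> A a fA cA nA.
have [C [fC sC cC]] : exists Y : set M, [/\ finite_set Y, a |` A `<=` Y & fun_closed Y].
  by apply: (closure_ex HM); rewrite finite_setU; split=> //; exact: finite_set1.
have [h2 e2] := embed_reduct2 fC cC; have [i2 _ f2] := e2.
have AC : A `<=` C by move=> x Ax; apply: sC; right.
have Ca : C a by apply: sC; left.
have [||||||A' [sA' sC' nA' cA' caA']] := @split2 (h2 @` A) (h2 @` C) (h2 a).
- exact: finite_image.
- apply: (@fun_closed_image L2 (reduct2 M)); first exact/fun_closed_reduct2.
  exact: sub_embedding_on e2.
- by apply: (@fun_closed_image L2 (reduct2 M)) => //; exact/fun_closed_reduct2.
- exact: image_subset.
- by exists a.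
- by move=> [x Ax /i2 xa]; apply: nA; rewrite -xa //; exact: AC.
exists [set x | C x /\ A' (h2 x)]; split.
- by apply: sub_finite_set fC => x [].
- move=> [f|f] t Ct; first by case: (rL1 f).
  split; first by apply: cC => i; case: (Ct i).
  by rewrite (f2 f t) => [|i]; [apply: cA' => i|]; case: (Ct i).
- by move=> x Ax; split; [exact: AC|apply: sA'; exists x].
- by case.
- move=> [f|f] t Ct; first by case: (rL1 f).
  have tC i : C (t i) by case: (Ct i) => [->|[]].
  have Cf : C (@fun_in _ (reduct2 M) f t) by exact: (cC (inr f)).
  have : (h2 a |` A') (h2 (@fun_in _ (reduct2 M) f t)).
    rewrite f2 //; apply: caA' => i; case: (Ct i) => [->|[_ ?]]; first by left.
    by right.
  by case=> [e|A'f]; [left; exact: (i2 _ _ Cf Ca e)|right; split].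
Qed.

Lemma superposition_moves_orbits : moves_orbits M.
Proof.
move=> A F b0 g fA cA nb0 cb0 fF g1; apply: contrapT => Hno.
have fixed (s : aut M) : agree A 1%g s -> ~ F (s b0) -> g (s b0) = s b0.
  by move=> As Fs; apply: contrapT => gs; apply: Hno; exists s.
have fAb : finite_set (b0 |` A) by rewrite finite_setU; split=> //; exact: finite_set1.
have g1rel R (t : 'I_(rel_ar R) -> M) :
    @rel_in _ (reduct1 M) R (fun i => g (t i)) <-> @rel_in _ (reduct1 M) R t.
  exact: (@aut_rel _ _ g (inl R)).
have g2rel R (t : 'I_(rel_ar R) -> M) :
    @rel_in _ (reduct2 M) R (fun i => g (t i)) <-> @rel_in _ (reduct2 M) R t.
  exact: (@aut_rel _ _ g (inr R)).
(* The [K1]-part of the type of [b0] over [A] is irrelevant for being fixed. *)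
have fixed_by_K2_type x : ~ A x -> ~ F x ->
    @embedding_on L2 (reduct2 M) (reduct2 M) (b0 |` A) (update id b0 x) -> g x = x.
  move=> nx Fx ex; apply: contrapT => gx.
  have [C [fC sC cC]] : exists Y : set M,
      [/\ finite_set Y, A `|` F `|` [set x; g x] `<=` Y & fun_closed Y].
    by apply: (closure_ex HM); rewrite !finite_setU; do !split=> //; exact: finite_set1.
  have [E [fE sE cE]] : exists Y : set M,
      [/\ finite_set Y, b0 |` C `<=` Y & fun_closed Y].
    by apply: (closure_ex HM); rewrite !finite_setU; do !split=> //; exact: finite_set1.
  have AC : A `<=` C by move=> y Ay; apply: sC; left; left.
  have CE : C `<=` E by move=> y Cy; apply: sE; right.
  have AE := subset_trans AC CE.
  have Eb : E b0 by apply: sE; left.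
  have Cx : C x by apply: sC; right; left.
  have Cgx : C (g x) by apply: sC; right; right.
  have [h1 e1] := embed_reduct1 fE cE; have [i1 r1 _] := e1.
  have [h2 e2] := embed_reduct2 fC cC; have [i2 r2 _] := e2.
  have cC2 : @fun_closed L2 (reduct2 M) C by exact/fun_closed_reduct2.
  have cA2 : @fun_closed L2 (reduct2 M) A by exact/fun_closed_reduct2.
  have cxA2 : @fun_closed L2 (reduct2 M) (x |` A).
    rewrite (_ : x |` A = update id b0 x @` (b0 |` A)).
      by apply: (@fun_closed_image L2 (reduct2 M) (reduct2 M)) => //; exact/fun_closed_reduct2.
    have Ab c : A c -> c <> b0 by move=> Ac e; apply: nb0; rewrite -e.
    apply/seteqP; split=> [y [->|Ay]|_ [y [->|Ay] <-]].
    - by exists b0; [left|rewrite update_same].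
    - by exists y; [right|rewrite update_other //; exact: Ab].
    - by left; rewrite update_same.
    - by right; rewrite update_other //; exact: Ab.
  have xAC : x |` A `<=` C by move=> y [->|/AC].
  have e2' (X : set M) : X `<=` C -> @embedding_on L2 (reduct2 M) M2 X h2.
    by move=> XC; exact: sub_embedding_on e2.
  (* A twin of [x] over [A], found in [M2], that tells [x] from [g x]. *)
  have [||||||||| b [nb cb eb [R [ee He]]]] := @sep2 (h2 @` A) (h2 @` C) (h2 x) (h2 (g x)).
  - exact: finite_image.
  - by apply: (@fun_closed_image L2 (reduct2 M)) => //; exact: e2'.
  - exact: (@fun_closed_image L2 (reduct2 M)).
  - exact: image_subset.
  - by exists x.
  - by move=> [y Ay e]; apply: nx; rewrite -(i2 _ _ (AC _ Ay) Cx e).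
  - have -> : h2 x |` h2 @` A = h2 @` (x |` A) by rewrite image_setU image_set1.
    by apply: (@fun_closed_image L2 (reduct2 M)) => //; exact: e2'.
  - by exists (g x).
  - by move=> e; exact: gx (esym (i2 _ _ Cx Cgx e)).
  have [|||||||t1 [A1 D1]] := strong_disjoint HM1 strong1 (A := h1 @` A) (B := h1 @` (b0 |` A)) (C := h1 @` C).
  - by apply: image_subset => y; right.
  - exact: image_subset.
  - exact: finite_image.
  - exact: finite_image.
  - exact: cl1.
  - exact: cl1.
  - exact: cl1.
  have [h2' h2K] := left_inverse_on superposition_inhabited i2.
  (* The label of [b] realizes the [K1]-type of [b0] over [A]. Since [b] has the [K2]-type of [x],
     which is that of [b0], the point [k b] will realize the full type of [b0]. *)
  pose p := update (fun y => h1 (h2' y)) b (t1 (h1 b0)).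
  have nbC c : C c -> h2 c <> b by move=> Cc e; apply: nb; exists c.
  have pC c : C c -> p (h2 c) = h1 c.
    by move=> Cc; rewrite /p update_other ?h2K //; exact: nbC.
  have pb : p b = t1 (h1 b0) by rewrite /p update_same.
  have tb c : C c -> t1 (h1 b0) <> h1 c.
    move=> Cc e; have [y Ay yb] : (h1 @` A) (h1 b0).
      by apply: D1; [exists b0 => //; left|rewrite e; exists c].
    by apply: nb0; rewrite -(i1 _ _ (AE _ Ay) Eb yb).
  have ip : inj_on (b |` h2 @` C) p.
    move=> _ _ [->|[c Cc <-]] [->|[c' Cc' <-]] //; rewrite ?pb ?pC //.
    - by move=> /tb.
    - by move=> e'; case: (tb c).
    - by move=> e'; rewrite (i1 _ _ (CE _ Cc) (CE _ Cc') e').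
  have [||||k [k1 kE k2]] := superposition_extension fC cC _ cb (h2 := h2) _ ip.
  - by rewrite finite_setU; split; [exact: finite_set1|exact: finite_image].
  - by move=> c Cc; right; exists c.
  - exact: e2.
  - apply: (@eq_embedding_on L1 (reduct1 M) M1 C h1) => //.
      by move=> c Cc; rewrite pC.
    exact: sub_embedding_on e1.
  have [ki kr _] := k1.
  have Ab c : A c -> c <> b0 by move=> Ac e'; apply: nb0; rewrite -e'.
  have nCb : ~ C (k b).
    move=> Ckb; apply: nb; exists (k b) => //.
    apply: ki; [by right; exists (k b)|by left|exact: kE].
  have [s [As sb]] : exists s : aut M, agree A 1%g s /\ s b0 = k b.
    apply: (same_type_aut HM fA cb0 nb0).
    pose th := update h2 b0 b.
    have thb : th b0 = b by exact: update_same.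
    have thA c : A c -> th c = h2 c by move=> Ac; apply: update_other; exact: Ab.
    have thC' y : (b0 |` A) y -> (b |` h2 @` C) (th y).
      move=> [->|Ay]; first by rewrite thb; left.
      by rewrite thA //; right; exists y => //; exact: AC.
    have kth y : (b0 |` A) y -> k (th y) = update id b0 (k b) y.
      move=> [->|Ay]; first by rewrite thb update_same.
      by rewrite thA // kE ?update_other //; [exact: Ab|exact: AC].
    have pth y : (b0 |` A) y -> p (th y) = t1 (h1 y).
      move=> [->|Ay]; first by rewrite thb.
      by rewrite thA // pC; [rewrite -A1 //; exists y|exact: AC].
    have eth : @embedding_on L2 (reduct2 M) M2 (b0 |` A) th.
      apply: (@eq_embedding_on L2 (reduct2 M) M2 (b0 |` A)
        (fun y => update id (h2 x) b (h2 (update id b0 x y)))).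
      - exact/fun_closed_reduct2.
      - move=> y [->|Ay]; first by rewrite thb !update_same.
        rewrite thA // [update id b0 x y]update_other; last exact: Ab.
        rewrite update_other // => /i2 yx; apply: nx; rewrite -yx //; exact: AC.
      - apply: (@embedding_on_comp L2 (reduct2 M) M2 M2 (b0 |` A) (h2 x |` h2 @` A)
          (fun y => h2 (update id b0 x y))) => //.
          move=> y [->|Ay]; first by rewrite update_same; left.
          by rewrite update_other; [right; exists y|exact: Ab].
        apply: (@embedding_on_comp L2 (reduct2 M) (reduct2 M) M2 (b0 |` A) (x |` A)
          (update id b0 x)) => //; last exact: e2'.
        move=> y [->|Ay]; first by rewrite update_same; left.
        by rewrite update_other; [right|exact: Ab].
    apply: (@eq_embedding_on _ M M (b0 |` A) (fun y => k (th y))) => //.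
    apply: embedding_on_reducts; last first.
      by apply: (@embedding_on_comp L2 (reduct2 M) M2 (reduct2 M) _ (b |` h2 @` C)) => //.
    split; last by move=> f; case: (rL1 f).
      move=> y z By Bz e'; have [ith _ _] := eth; apply: ith => //.
      by apply: ki => //; exact: thC'.
    move=> R' t Bt; rewrite (k2 R' (fun i => th (t i))); last by move=> i; exact: thC'.
    rewrite -r1; last by move=> i; case: (Bt i) => [->|/AE].
    rewrite -[X in _ <-> X](aut_rel t1).
    rewrite (_ : (fun i => p _) = (fun i => t1 (h1 (t i)))) //.
    by apply/funext => i; exact: pth.
  have gkb : g (k b) = k b.
    rewrite -sb; apply: fixed => //; rewrite sb => Fb; apply: nCb; apply: sC.
    by left; right.
  (* [g] fixes [k b] and sends [x] to [g x], so no relation with [k b] can tell these two apart. *)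
  apply: He.
  have C'b : (b |` h2 @` C) b by left.
  have C'h c : C c -> (b |` h2 @` C) (h2 c) by move=> Cc; right; exists c.
  rewrite -(kr R (fun i => if ee i then b else h2 x)); last by move=> i; case: ifP => // _; exact: C'h.
  rewrite -(kr R (fun i => if ee i then b else h2 (g x))); last by move=> i; case: ifP => // _; exact: C'h.
  rewrite -g2rel (_ : (fun i => g _) = (fun i => k (if ee i then b else h2 (g x)))) //.
  by apply/funext => i; case: (ee i); rewrite ?gkb ?kE.
have Ab c : A c -> c <> b0 by move=> Ac e; apply: nb0; rewrite -e.
apply: g1; apply: aut_ext => a; apply: contrapT => ga.
have [C [fC sC cC]] : exists Y : set M,
    [/\ finite_set Y, A `|` F `|` [set a; g a] `<=` Y & fun_closed Y].
  by apply: (closure_ex HM); rewrite !finite_setU; do !split=> //; exact: finite_set1.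
have Ca : C a by apply: sC; right; left.
have Cga : C (g a) by apply: sC; right; right.
have [h1 e1] := embed_reduct1 fC cC; have [i1 r1 _] := e1.
have h1a : h1 a <> h1 (g a) by move=> e; apply: ga; rewrite -(i1 _ _ Ca Cga e).
(* [M1] tells [a] from [g a] by a tuple; what remains is to realize its other entries by points that
   [g] fixes. *)
have [R [t0 [t0a nt0]]] := dist1 h1a.
have ft0 : finite_set (range t0) by exact: finite_range.
have [|||||||t1 [A1 D1]] := strong_disjoint HM1 strong1 (A := [set h1 a; h1 (g a)])
  (B := [set h1 a; h1 (g a)] `|` range t0) (C := h1 @` C).
- by move=> y; left.
- by move=> y [->|->]; [exists a|exists (g a)].
- by rewrite finite_setU; split=> //; exact: finite_set2.
- exact: finite_image.
- exact: cl1.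
- exact: cl1.
- exact: cl1.
have t1a : t1 (h1 a) = h1 a by rewrite -A1 //; left.
have t1ga : t1 (h1 (g a)) = h1 (g a) by rewrite -A1 //; right.
pose t i := t1 (t0 i).
pose V := range t `\ h1 a.
have fV : finite_set V by apply: finite_setD; exact: finite_range.
have nVC v : V v -> ~ (h1 @` C) v.
  move=> [[i _ <-] ta] H; have := D1 (t0 i) (or_intror (imageP _ I)) H.
  by case=> [t0E|t0E]; [apply: ta; rewrite /t t0E|case: (t0a i)].
have nt : ~ (rel_in (fun i => update id (h1 a) (h1 (g a)) (t i)) <-> rel_in t).
  apply: contra_not nt0; rewrite [X in _ <-> X](aut_rel t1) => <-.
  rewrite -(aut_rel t1) (_ : (fun i => t1 _) = (fun i => update id (h1 a) (h1 (g a)) (t i))) //.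
  apply/funext => i; rewrite /t; case: (pselect (t0 i = h1 a)) => [->|ti].
    by rewrite t1a !update_same.
  rewrite !update_other //.
  by rewrite -[X in _ <> X]t1a => /aut_inj.
(* These points have the type of [b0] over [A]. Only their [K2]-type will be kept; their labels are
   replaced by the entries of [t]. *)
pose O := [set x | exists2 s : aut M, agree A 1%g s & x = s b0] `\` C.
have iO : infinite_set O.
  apply: infinite_setD => // fO.
  have [s [As ns]] := superposition_infinite_orbits fA cA nb0 fO.
  by apply: ns; exists s.
have [psi [psi_inj _ psiO]] := @extend_injection M1 M set0 V (fun _ => a) O
  (finite_set0 _) fV iO (fun x _ h _ => match h with end).
have {}psi_inj : inj_on V psi by move=> x y Vx Vy; apply: psi_inj; right.
have {}psiO v : V v -> O (psi v) by move=> Vv; apply: psiO.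
have [E [fE sE cE]] : exists Y : set M,
    [/\ finite_set Y, C `|` psi @` V `<=` Y & fun_closed Y].
  by apply: (closure_ex HM); rewrite finite_setU; split=> //; exact: finite_image.
have CE : C `<=` E by move=> x Cx; apply: sE; left.
have VE v : V v -> E (psi v) by move=> Vv; apply: sE; right; exists v.
have [psi' psiK] := left_inverse_on iM1 psi_inj.
pose f0 x := if pselect (C x) then h1 x else psi' x.
have f0C x : C x -> f0 x = h1 x by rewrite /f0; case: pselect.
have f0V v : V v -> f0 (psi v) = v.
  move=> Vv; rewrite /f0; case: pselect => [Cv|?] /=; last exact: psiK.
  by have [_ []] := psiO _ Vv.
have fX : finite_set (C `|` psi @` V) by rewrite finite_setU; split=> //; exact: finite_image.
have if0 : inj_on (C `|` psi @` V) f0.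
  move=> x y [Cx|[v Vv <-]] [Cy|[w Vw <-]]; rewrite ?f0V // ?f0C //.
  - exact: i1.
  - by move=> e; case: (nVC _ Vw); rewrite -e; exists x.
  - by move=> e; case: (nVC _ Vv); rewrite e; exists y.
  - by move=> ->.
have [f [if_ fE0 _]] := extend_injection fX fE infinite_M1 if0.
have {}if_ : inj_on E f by move=> x y Ex Ey; apply: if_; right.
have [h2 e2] := embed_reduct2 fE cE; have [i2 r2 _] := e2.
have [h2' h2K] := left_inverse_on superposition_inhabited i2.
pose p y := f (h2' y).
have pE x : E x -> p (h2 x) = f x by move=> Ex; rewrite /p h2K.
have [||||||k [k1 kE k2]] := @superposition_extension C (h2 @` E) h2 p fC cC.
- exact: finite_image.
- by apply: (@fun_closed_image L2 (reduct2 M)) => //; exact/fun_closed_reduct2.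
- by move=> c Cc; exists c => //; exact: CE.
- by move=> _ _ [x Ex <-] [y Ey <-]; rewrite !pE // => /if_ ->.
- exact: sub_embedding_on e2.
- apply: (@eq_embedding_on L1 (reduct1 M) M1 C h1) => //.
  by move=> c Cc; rewrite pE ?fE0 ?f0C //; [left|exact: CE].
have [ki kr _] := k1.
(* [q v] has the [K2]-type of [psi v], hence of [b0], over [A], so [g] fixes it; its label in [M1]
   is [v]. *)
pose q v := k (h2 (psi v)).
have gq v : V v -> g (q v) = q v.
  move=> Vv; have [[s As sv] nCv] := psiO _ Vv.
  have nCq : ~ C (q v).
    move=> Cq; apply: nCv; suff <- : q v = psi v by [].
    apply: i2; [exact: CE|exact: VE|apply: ki].
    - by exists (q v) => //; exact: CE.
    - by exists (psi v) => //; exact: VE.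
    - exact: kE.
  apply: fixed_by_K2_type.
  - by move=> Aq; apply: nCq; apply: sC; left; left.
  - by move=> Fq; apply: nCq; apply: sC; left; right.
  have sE' y : (b0 |` A) y -> E (s y).
    move=> [->|Ay]; first by rewrite -sv; exact: VE.
    by rewrite -As //; apply: CE; apply: sC; left; left.
  apply: (@eq_embedding_on L2 (reduct2 M) (reduct2 M) (b0 |` A) (fun y => k (h2 (s y)))).
  - exact/fun_closed_reduct2.
  - move=> y [->|Ay]; first by rewrite update_same -sv.
    rewrite update_other; last exact: Ab.
    by rewrite -As // kE //; apply: sC; left; left.
  apply: (@embedding_on_comp L2 (reduct2 M) M2 (reduct2 M) (b0 |` A) (h2 @` E) (fun y => h2 (s y)) k) => //.
    by move=> y By; exists (s y) => //; exact: sE'.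
  apply: (@embedding_on_comp L2 (reduct2 M) (reduct2 M) M2 (b0 |` A) E s h2) => //.
  apply: embedding_onW; case: (aut_embedding s) => s1 s2 s3; split=> //.
    by move=> R'; exact: (s2 (inr R')).
  by move=> f'; exact: (s3 (inr f')).
have Vt i : t i <> h1 a -> V (t i) by move=> ti; split=> //; exists i.
(* Through [k], the tuples [y] and [y'] become tuples of [M] differing only in [a] and [g a], and
   [g] maps the first to the second. Their labels are [t] and its modification. *)
pose y i := if pselect (t i = h1 a) then h2 a else h2 (psi (t i)).
pose y' i := if pselect (t i = h1 a) then h2 (g a) else h2 (psi (t i)).
have yE i : (h2 @` E) (y i).
  by rewrite /y; case: pselect => [?|/Vt Vi] /=; [exists a|exists (psi (t i))] => //; [exact: CE|exact: VE].
have y'E i : (h2 @` E) (y' i).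
  by rewrite /y'; case: pselect => [?|/Vt Vi] /=; [exists (g a)|exists (psi (t i))] => //; [exact: CE|exact: VE].
have pq v : V v -> p (h2 (psi v)) = v.
  by move=> Vv; rewrite pE ?fE0 ?f0V //; [right; exists v|exact: VE].
have pC c : C c -> p (h2 c) = h1 c.
  by move=> Cc; rewrite pE ?fE0 ?f0C //; [left|exact: CE].
apply: nt.
have tE i : t i = p (y i).
  by rewrite /y; case: pselect => [e|/Vt Vi] /=; [rewrite pC|rewrite pq].
have t'E i : update id (h1 a) (h1 (g a)) (t i) = p (y' i).
  rewrite /y'; case: pselect => [e|ti] /=; first by rewrite pC // e update_same.
  by rewrite pq ?update_other //; exact: Vt.
rewrite (funext tE : t = fun i => p (y i)) (funext (fun i => etrans (congr1 _ (esym (tE i))) (t'E i))).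
rewrite -(k2 _ _ yE) -(k2 _ _ y'E) -[X in _ <-> X]g1rel.
rewrite (_ : (fun i => g _) = (fun i => k (y' i))) //.
apply/funext => i; rewrite /y /y'; case: pselect => [e|/Vt Vi] /=.
  by rewrite !kE.
exact: gq.
Qed.

Lemma superposition_not_group_topology : ~ zariski_is_group_topology (aut M).
Proof.
apply: aut_zariski_not_group_topology.
- exact: superposition_inhabited.
- move=> [f|f] t Ht; first by case: (rL1 f).
  by have := @closed0 f (fun i => match Ht i with end) Ht.
- exact: superposition_splits.
- exact: superposition_infinite_orbits.
- exact: superposition_moves_orbits.
Qed.
End Superposition.

(** * Distinguishing points *)


Section Nontrivial.
Variables (L : language) (K : str_class L) (M : structure L).
Hypothesis HM : fraisse_limit K M.
Hypothesis rL : relational L.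
Hypothesis nontriv : ~ trivial_structure M.

Lemma nontrivial_inhabited : inhabited M.
Proof.
apply: contrapT => nM; apply: nontriv; apply: (trivial_structure_criterion HM rL).
move=> n a b _ R u; rewrite (_ : (fun i => a (u i)) = (fun i => b (u i))) //.
by apply/funext => i; case: nM; constructor; exact: (a (u i)).
Qed.

(** If one pair is not told apart, transitivity on pairs shows that none is: in any tuple a value
    may be exchanged for one that does not occur. Such exchanges link two tuples of the same
    equality type with disjoint ranges. *)
Lemma pair_transitive_distinguishes : strong_amalgamation K ->
  pair_transitive M -> distinguishes_points M.
Proof.
move=> sK pt a0 a0' aa'; apply: contrapT => H; apply: nontriv.
have sw c c' R (t : 'I_(rel_ar R) -> M) : c <> c' -> (forall i, t i <> c') ->
    (rel_in (fun i => update id c c' (t i)) <-> rel_in t).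
  move=> cc' tc'; have [g [ga ga']] := pt _ _ _ _ aa' cc'.
  apply: contrapT => nt; apply: H; exists R, (fun i => g^-1%g (t i)); split.
    by move=> i e; apply: (tc' i); rewrite -ga' -e aut_mulKV.
  apply: contra_not nt; rewrite -(aut_rel g (fun i => g^-1%g (t i))).
  rewrite -(aut_rel g (fun i => update _ _ _ _)).
  rewrite (_ : (fun i => g (g^-1%g (t i))) = t); last by apply/funext => i; rewrite aut_mulKV.
  rewrite (_ : (fun i => g _) = (fun i => update id c c' (t i))) //.
  apply/funext => i; case: (pselect (t i = c)) => [->|tc].
    by rewrite -{1}ga aut_mulVK !update_same.
  rewrite !update_other ?aut_mulKV // => e; apply: tc; rewrite -ga -e.
  by rewrite aut_mulKV.
have disjoint n (a b : 'I_n -> M) : same_equality_type a b ->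
    (forall i j, a i <> b j) -> forall R (u : 'I_(rel_ar R) -> 'I_n),
    rel_in (fun i => a (u i)) <-> @rel_in _ M R (fun i => b (u i)).
  move=> ab dab R u.
  (* [x k] has the first [k] values of [a] replaced, at all their occurrences. The next step
     exchanges one value, or does nothing if that value has come up before. *)
  pose x k i := if pselect (exists j : 'I_n, (j < k)%N /\ a j = a i) then b i else a i.
  have xk k : (k <= n)%N -> rel_in (fun i => a (u i)) <-> rel_in (fun i => x k (u i)).
    elim: k => [_|k IH kn].
      rewrite (_ : (fun i => x 0 (u i)) = (fun i => a (u i))) //.
      by apply/funext => i; rewrite /x; case: pselect => //= -[j []].
    rewrite IH; last exact: ltnW.
    pose o := Ordinal kn.
    case: (pselect (exists j : 'I_n, (j < k)%N /\ a j = a o)) => [[j [jk ja]]|nj].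
      rewrite (_ : (fun i => x k.+1 (u i)) = (fun i => x k (u i))) //.
      apply/funext => i; rewrite /x; case: pselect => [[l [lk la]]|n1] /=; case: pselect => [n2|n2] //=.
        case: n2; move: lk; rewrite ltnS leq_eqVlt => /orP[/eqP lk|lk]; last by exists l.
        by exists j; split=> //; rewrite ja -la; congr a; apply: val_inj.
      by case: n1; case: n2 => l [lk la]; exists l; split=> //; exact: ltnW.
    rewrite -(sw (a o) (b o) _ (fun i => x k (u i))).
    - rewrite (_ : (fun i => update _ _ _ _) = (fun i => x k.+1 (u i))) //.
      apply/funext => i; rewrite /x; case: pselect => [[l [lk la]]|n1] /=; case: pselect => [n2|n2] //=.
      + by rewrite update_other // => /esym; exact: dab.
      + by case: n2; exists l; split=> //; exact: ltnW.
      + case: n2 => l [lk la]; move: lk; rewrite ltnS leq_eqVlt => /orP[/eqP lk|lk].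
          have lo : l = o by apply: val_inj.
          by rewrite -la lo update_same; apply/ab; rewrite -lo.
        by case: n1; exists l.
      + rewrite update_other // => e; apply: n2; exists o; split=> //=.
    - exact: dab.
    - move=> i; rewrite /x; case: pselect => [[l [lk la]]|n1] /=; last exact: dab.
      by move=> /ab e; apply: nj; exists l; rewrite la e.
  rewrite (xk n) // (_ : (fun i => x n (u i)) = (fun i => b (u i))) //.
  by apply/funext => i; rewrite /x; case: pselect => //= -[]; exists (u i); split.
apply: (trivial_structure_criterion HM rL) => n a b ab R u.
have iM : infinite_set [set: M].
  apply: infinite_carrier.
  - exact: nontrivial_inhabited.
  - exact: fun_closed_relational.
  - exact: (strong_infinite_orbits HM sK).
have fab : finite_set (range a `|` range b) by rewrite finite_setU; split; exact: finite_range.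
have [f [fi _ fS]] := @extend_injection M M set0 (range a) id (setT `\` (range a `|` range b))
  (finite_set0 _) (finite_range a) (infinite_setD iM fab) (fun x _ h _ => match h with end).
have fS' i : ~ (range a `|` range b) (f (a i)).
  by case: (fS (a i) (imageP _ I) (fun h => h)).
have fE i j : f (a i) = f (a j) <-> a i = a j.
  by split=> [|->//]; apply: fi; right; [exists i|exists j].
have d1 : rel_in (fun i => a (u i)) <-> rel_in (fun i => f (a (u i))).
  apply: (disjoint n a (fun i => f (a i))); first by move=> i j; rewrite fE.
  by move=> i j e; apply: (fS' j); left; exists i.
have d2 : rel_in (fun i => b (u i)) <-> rel_in (fun i => f (a (u i))).
  apply: (disjoint n b (fun i => f (a i))).
    by move=> i j; rewrite fE; split=> /ab.
  by move=> i j e; apply: (fS' j); right; exists i.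
by rewrite d1 d2.
Qed.
End Nontrivial.

(** Some point [b] has different distances to [a] and [a']; the threshold relation at the smaller of
    the two separates them. *)
Lemma urysohn_distinguishes (L : language) (M : structure L) :
  rational_urysohn_space M -> distinguishes_points M.
Proof.
case=> {L}{}M HM; have [d dM dE] := urysohn_metric HM.
have [d0 _ dsym _] := dM.
move=> a a' aa'; have [D D0 HD] := finite_pos_upper_bound (d a) (finite_set2 a a').
have [b [nb ba bD]] := urysohn_separate HM dM dE (finite_set2 a a') (or_introl erefl) D0 HD.
have {}bD : d b a' = D by apply: bD; [right|move=> e; apply: aa'].
have dba : d b a <> d b a' by rewrite bD.
have bn : b <> a' by move=> e; apply: nb; right.
have ban : b <> a by move=> e; apply: nb; left.
have tE : (fun i => update id a a' (tuple2 b a i)) = tuple2 b a'.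
  by rewrite tuple2_comp update_same update_other.
suff [q [q0 Hq]] : exists q, (0 <= q)%R /\ ~ ((d b a' <= q)%R <-> (d b a <= q)%R).
  exists (dist_le q0), (tuple2 b a); split.
    by move=> i; rewrite /tuple2; case: ifP.
  by rewrite tE !dE.
case: (ltP (d b a) (d b a')) => [lt|le].
  exists (d b a); split=> // -[_ /(_ (lexx _))]; by rewrite leNgt lt.
exists (d b a'); split=> // -[/(_ (lexx _)) le' _].
by apply: dba; apply/eqP; rewrite eq_le le le'.
Qed.

(** * The rational order and S(2) *)


Lemma relational_splits_within (L : language) (M : structure L) :
  relational L -> splits_within M.
Proof.
by move=> rL A C a _ _ _ AC _ nA; exists A; split=> //; exact: fun_closed_relational.
Qed.

Section Twins.
Variable M : structure binary_language.

(** Two points so close to [a], one on each side, that the other points of [C] do not notice the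
    difference. *)
Definition local_twins := forall (C : set M) a, finite_set C ->
  (exists b, [/\ forall c, C c -> c <> a ->
      (edge b c <-> edge a c) /\ (edge c b <-> edge c a),
    edge a b & ~ edge b a]) /\
  (exists b, [/\ forall c, C c -> c <> a ->
      (edge b c <-> edge a c) /\ (edge c b <-> edge c a),
    edge b a & ~ edge a b]).

(** A twin [b] of [a] has the same edge with [a'] as [a] has. Taking it after [a] if [a] points to
    [a'], and before [a] otherwise, makes its edges with [a] and with [a'] differ. *)
Lemma local_twins_separate : tournament M -> local_twins -> separates_twins M.
Proof.
move=> [irr tot] tw A C a a' fC _ _ AC Ca na _ Ca' aa'.
have Aa c : A c -> c <> a by move=> Ac e; apply: na; rewrite -e.
have main b : (forall c, C c -> c <> a ->
      (edge b c <-> edge a c) /\ (edge c b <-> edge c a)) ->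
    (edge a b /\ ~ edge b a \/ edge b a /\ ~ edge a b) ->
    [/\ ~ C b, fun_closed (b |` C) & embedding_on (a |` A) (update id a b)].
  move=> Hb ab.
  have ba : b <> a by move=> e; move: ab; rewrite e; tauto.
  have nCb : ~ C b.
    by move=> Cb; have := Hb b Cb ba; have := irr b; tauto.
  split=> //; first exact: fun_closed_relational.
  have Ab c : A c -> c <> b by move=> /AC Cc e; apply: nCb; rewrite -e.
  apply: binary_embedding_on => x y.
    move=> [->|Ax] [->|Ay] //; rewrite ?update_same ?update_other //; try exact: Aa.
      by move=> /esym/(Ab _ Ay).
    by move=> /(Ab _ Ax).
  move=> [->|Ax] [->|Ay]; rewrite ?update_same ?update_other //; try exact: Aa.
  - by split=> /irr.
  - by case: (Hb y (AC _ Ay) (Aa _ Ay)).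
  - by case: (Hb x (AC _ Ax) (Aa _ Ax)).
have a'a : a' <> a by move=> e; apply: aa'.
have tE (b x : M) : (fun i : 'I_2 => if i != ord0 then b else x) = tuple2 x b.
  by apply/funext => i; rewrite /tuple2; case: eqP.
have [[b1 [H1 ab1 nb1]] [b2 [H2 ab2 nb2]]] := tw C a fC.
case: (tot _ _ aa') => -[e1 e2].
- have [|nC cC eb] := main b1 H1; first by left.
  exists b1; split=> //; exists tt, (fun i => i != ord0).
  rewrite !tE => H.
  by have := H1 a' Ca' a'a; tauto.
- have [|nC cC eb] := main b2 H2; first by right.
  exists b2; split=> //; exists tt, (fun i => i != ord0).
  rewrite !tE => H.
  by have := H2 a' Ca' a'a; tauto.
Qed.
End Twins.

Section LinearAndCircular.
Local Open Scope ring_scope.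

Lemma rat_order_twins (M : structure binary_language) :
  isomorphic M rat_order -> [/\ inhabited M, tournament M & local_twins M].
Proof.
move=> [f [fi fr _] [f' fK f'K]].
have eE x y : edge x y <-> f x < f y.
  by rewrite /edge -fr /= /tuple2.
split; first by constructor; exact: f' 0.
  split=> [x|x y xy]; rewrite !eE ?ltxx //.
  have : f x <> f y by move=> /fi.
  by move=> /eqP; rewrite neq_lt => /orP[] lt; [left|right]; split=> //; apply/negP; rewrite -leNgt ltW.
move=> C a fC.
have [|e e0 He] := @finite_pos_lower_bound _ (C `\ a) (fun c => `|f c - f a|) (finite_setD _ fC).
  by move=> c [_ ca] /=; rewrite normr_gt0 subr_eq0; apply/eqP => /fi.
have key c v : C c -> c <> a -> `|v| < e -> (f a + v < f c <-> f a < f c) /\ (f c < f a + v <-> f c < f a).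
  move=> Cc ca; have := He c (conj Cc ca); rewrite /= ltr_norml.
  have : f c <> f a by move=> /fi.
  move=> /eqP; rewrite neq_lt => /orP[] lt.
    by rewrite ltr0_norm; [move=> ? /andP[? ?]; split; split=> ?; lra|lra].
  by rewrite gtr0_norm; [move=> ? /andP[? ?]; split; split=> ?; lra|lra].
split.
  exists (f' (f a + e / 2)); split; rewrite ?eE ?f'K; [|lra|by apply/negP; rewrite -leNgt; lra].
  by move=> c Cc ca; rewrite !eE !f'K; apply: key => //; rewrite gtr0_norm; lra.
exists (f' (f a - e / 2)); split; rewrite ?eE ?f'K; [|lra|by apply/negP; rewrite -leNgt; lra].
by move=> c Cc ca; rewrite !eE !f'K; apply: key => //; rewrite normrN gtr0_norm; lra.
Qed.

(** The edge relation of [S(2)] in terms of the difference of angles: modulo 1 it lies strictly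
    between 0 and 1/2. *)
Definition half_turn (d : rat) := exists k : int, 0 < d + k%:~R < 1 / 2.

Lemma int_rat_ge1 (k : int) : 0 < k -> 1 <= k%:~R :> rat.
Proof. by move=> k0; rewrite (ler_int _ 1 k); lia. Qed.

Lemma int_rat_le0 (k : int) : k <= 0 -> k%:~R <= 0 :> rat.
Proof. by move=> k0; rewrite (ler_int _ k 0). Qed.

Lemma half_turn_pos d : 0 < d < 1 / 2 -> half_turn d.
Proof. by move=> H; exists 0; rewrite addr0. Qed.

Lemma half_turn_neg d : - 1 / 2 <= d <= 0 -> ~ half_turn d.
Proof.
move=> /andP[d1 d2] [k /andP[k1 k2]].
case: (lerP k 0) => [/int_rat_le0|/int_rat_ge1] k0; lra.
Qed.

Lemma half_turn_shift d (j : int) : half_turn (d + j%:~R) <-> half_turn d.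
Proof.
split=> -[k H]; first by exists (j + k); rewrite intrD addrA.
exists (k - j); rewrite intrB.
by have -> : d + j%:~R + (k%:~R - j%:~R) = d + k%:~R by lra.
Qed.

(** For [d] between -1 and 1, this is its distance to the nearest of -1, -1/2, 0, 1/2 and 1, the
    places where [half_turn] can change. *)
Definition margin (d : rat) : rat :=
  Num.min (Num.min `|d| `|d - 1 / 2|) (Num.min `|d + 1 / 2| (1 - `|d|)).

Lemma marginP d e : e <= margin d -> - 1 < d < 1 ->
  [\/ - 1 + e <= d <= - 1 / 2 - e, - 1 / 2 + e <= d <= - e,
      e <= d <= 1 / 2 - e | 1 / 2 + e <= d <= 1 - e].
Proof.
rewrite /margin !le_min => /andP[/andP[h1 h2] /andP[h3 h4]] /andP[d1 d2].
case: (ltP d (- 1 / 2)) => c1.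
  by apply: Or41; rewrite ltr0_norm in h3; last lra; rewrite ltr0_norm in h4; lra.
case: (ltP d 0) => c2.
  apply: Or42; rewrite ger0_norm in h3; last lra; rewrite ltr0_norm in h1; lra.
case: (ltP d (1 / 2)) => c3.
  apply: Or43; rewrite ger0_norm in h1; last lra; rewrite ltr0_norm in h2; lra.
apply: Or44; rewrite ger0_norm in h2; last lra; rewrite ger0_norm in h4; lra.
Qed.

Lemma half_turn_stable d v e : e <= margin d -> - 1 < d < 1 -> - e < v < e ->
  half_turn (d + v) <-> half_turn d.
Proof.
move=> ed d1 /andP[v1 v2].
case: (marginP ed d1) => /andP[r1 r2].
- by split=> _; rewrite -(half_turn_shift _ 1); apply: half_turn_pos; lra.
- by split=> H; exfalso; move: H; apply: half_turn_neg; lra.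
- by split=> _; apply: half_turn_pos; lra.
- by split=> H; exfalso; move: H; rewrite -(half_turn_shift _ (-1)); apply: half_turn_neg; lra.
Qed.

Lemma circular_twins (M : structure binary_language) :
  circular_tournament M -> [/\ inhabited M, tournament M & local_twins M].
Proof.
case=> th [thi th01 th12 thd thE].
have eE x y : edge x y <-> half_turn (th y - th x) by exact: thE.
have d1 x y : - 1 < th y - th x < 1.
  by have := th01 x; have := th01 y; lra.
have mpos x y : x <> y -> 0 < margin (th y - th x).
  move=> xy; rewrite /margin !lt_min !normr_gt0 !subr_gt0 ltr_norml (d1 x y) andbT.
  rewrite -andbA; apply/and3P; split.
  - by apply/eqP => /subr0_eq /thi yx; apply: xy.
  - by apply/eqP => H; apply: (th12 y x); lra.
  - by apply/eqP => H; apply: (th12 x y); lra.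
split.
- by have [//|//|//|x _] := thd 0 1; constructor.
- split=> [x|x y xy]; rewrite !eE.
    by rewrite subrr; apply: half_turn_neg; lra.
  have opp : th x - th y = - (th y - th x) by lra.
  rewrite opp; case: (marginP (lexx _) (d1 x y)) => /andP[r1 r2]; have := mpos x y xy => m0.
  + left; split; first by rewrite -(half_turn_shift _ 1); apply: half_turn_pos; lra.
    by rewrite -(half_turn_shift _ (-1)); apply: half_turn_neg; lra.
  + right; split; first by apply: half_turn_pos; lra.
    by apply: half_turn_neg; lra.
  + left; split; first by apply: half_turn_pos; lra.
    by apply: half_turn_neg; lra.
  + right; split; first by rewrite -(half_turn_shift _ 1); apply: half_turn_pos; lra.
    by rewrite -(half_turn_shift _ (-1)); apply: half_turn_neg; lra.
move=> C a fC.
have [|e0 e0p He] := @finite_pos_lower_bound _ (C `\ a) (fun c => margin (th c - th a)) (finite_setD _ fC).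
  by move=> c [_ ca]; apply: mpos => ac; apply: ca.
(* The bound 1/2 keeps the angle between [a] and its twin below half a turn. *)
pose e := Num.min e0 (1 / 2).
have ep : 0 < e by rewrite lt_min e0p.
have [ee0 e12] : e <= e0 /\ e <= 1 / 2 by rewrite /e !ge_min !lexx orbT.
have marginN d : margin (- d) = margin d.
  rewrite /margin normrN -opprD normrN (_ : - d + 1 / 2 = - (d - 1 / 2)); last lra.
  by rewrite normrN minACA.
have key x (j : int) v : th x + j%:~R = th a + v -> - e < v < e ->
    (forall c, C c -> c <> a -> (edge x c <-> edge a c) /\ (edge c x <-> edge c a)) /\
    ((edge a x <-> half_turn v) /\ (edge x a <-> half_turn (- v))).
  move=> xv ve; split=> [c Cc ca|]; last first.
    rewrite !eE -(half_turn_shift (th x - th a) j) -(half_turn_shift (th a - th x) (- j)) intrN.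
    have -> : th x - th a + j%:~R = v by lra.
    by have -> : th a - th x - j%:~R = - v by lra.
  have Hm := He c (conj Cc ca).
  split.
    rewrite !eE -(half_turn_shift (th c - th x) (- j)) intrN.
    have -> : th c - th x - j%:~R = (th c - th a) + (- v) by lra.
    by apply: (@half_turn_stable _ _ e); [exact: le_trans Hm|exact: d1|lra].
  rewrite !eE -(half_turn_shift (th x - th c) j).
  have -> : th x - th c + j%:~R = (th a - th c) + v by lra.
  apply: (@half_turn_stable _ _ e); [|exact: d1|lra].
  by rewrite -marginN opprB; exact: le_trans Hm.
have /andP[a0 a1] := th01 a.
split.
  pose r := Num.min (th a + e) 1.
  have [x /andP[x1 x2]] : exists x, th a < th x < r.
    by apply: thd => //; rewrite /r ?ge_min ?lexx ?orbT // lt_min a1 andbT; lra.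
  have x3 : th x < th a + e by apply: (lt_le_trans x2); rewrite ge_min lexx.
  have [||H1 [H2 H3]] := key x 0 (th x - th a); [lra|lra|].
  exists x; split=> //; first by apply/H2/half_turn_pos; lra.
  by move=> /H3; apply: half_turn_neg; lra.
(* If [th a] is 0, the points just before [a] have angles near 1; [j = -1] takes them back by one
   turn. *)
have [x [j [x1 x2]]] : exists x (j : int), th a - e < th x + j%:~R /\ th x + j%:~R < th a.
  case: (eqVneq (th a) 0) => [->|an].
    have [|||x /andP[x1 x2]] := thd (1 - e) 1; [lra|lra|lra|].
    by exists x, (-1); split; lra.
  have a0' : 0 < th a by rewrite lt_neqAle eq_sym an.
  have [x /andP[x1 x2]] : exists x, Num.max (th a - e) 0 < th x < th a.
    by apply: thd; [rewrite le_max lexx orbT|rewrite gt_max a0' andbT; lra|exact: ltW].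
  exists x, 0; rewrite addr0; split=> //.
  by apply: le_lt_trans x1; rewrite le_max lexx.
have [||H1 [H2 H3]] := key x j (th x + j%:~R - th a); [lra|lra|].
exists x; split=> //; first by apply/H3/half_turn_pos; lra.
by move=> /H2; apply: half_turn_neg; lra.
Qed.
End LinearAndCircular.

(** * Meet trees *)


Section MeetTrees.
Variable T : structure meet_language.
Hypothesis dT : dense_meet_tree T.
Implicit Types (A C S : set T) (a b c x y z : T).

Let le_refl x : tle x x. Proof. by case: dT => [[]]. Qed.
Let le_anti x y : tle x y -> tle y x -> x = y.
Proof. by case: dT => [[_ H _ _ _]] _ _ _; exact: H. Qed.
Let le_trans x y z : tle x y -> tle y z -> tle x z.
Proof. by case: dT => [[_ _ H _ _]] _ _ _; exact: H. Qed.
Let le_lin t x y : tle x t -> tle y t -> tle x y \/ tle y x.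
Proof. by case: dT => [[_ _ _ H _]] _ _ _; exact: H. Qed.
Let meet_l x y : tle (tmeet x y) x.
Proof. by case: dT => [[_ _ _ _ H]] _ _ _; case: (H x y). Qed.
Let meet_r x y : tle (tmeet x y) y.
Proof. by case: dT => [[_ _ _ _ H]] _ _ _; case: (H x y). Qed.
Let meet_glb x y z : tle z x -> tle z y -> tle z (tmeet x y).
Proof. by case: dT => [[_ _ _ _ H]] _ _ _; case: (H x y) => _ _; exact. Qed.
Let dense x y : tlt x y -> exists z, tlt x z /\ tlt z y.
Proof. by case: dT => _ H _ _; exact: H. Qed.

Let meet_eq x y z : tle z x -> tle z y -> (forall w, tle w x -> tle w y -> tle w z) ->
  tmeet x y = z.
Proof. by move=> zx zy H; apply: le_anti; [apply: H|apply: meet_glb]. Qed.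

Let meetC x y : tmeet x y = tmeet y x.
Proof. by apply: meet_eq => // w wx wy; exact: meet_glb. Qed.

Let meet_le x y : tle x y -> tmeet x y = x.
Proof. by move=> xy; apply: meet_eq. Qed.

Let meet_ge x y : tle y x -> tmeet x y = y.
Proof. by move=> xy; apply: meet_eq. Qed.

Lemma meet_closedP C :
  fun_closed C <-> forall x y, C x -> C y -> C (tmeet x y).
Proof.
split=> [cC x y Cx Cy|H [] t Ct].
  by apply: (cC tt) => i; rewrite /tuple2; case: ifP.
by rewrite (tuple2E t); exact: H.
Qed.

Lemma meet_embedding_on C (h : T -> T) : inj_on C h ->
  (forall x y, C x -> C y -> tle (h x) (h y) <-> tle x y) ->
  (forall x y, C x -> C y -> h (tmeet x y) = tmeet (h x) (h y)) ->
  embedding_on C h.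
Proof.
move=> ih lh mh; split=> // -[] t Ct; rewrite (tuple2E t) tuple2_comp.
  exact: lh.
exact: mh.
Qed.

Lemma chain_max S t : finite_set S -> S !=set0 -> (forall x, S x -> tle x t) ->
  exists2 m, S m & forall x, S x -> tle x m.
Proof.
move=> fS; elim/finite_set_ind: S / fS => [[x []]|S x _ _ IH _ St].
case: (pselect (S !=set0)) => [S0|nS]; last first.
  by exists x; [left|move=> y [->|Sy] //; case: nS; exists y].
have [|m Sm Hm] := IH S0; first by move=> y Sy; apply: St; right.
case: (@le_lin t x m) => [||xm|mx].
- by apply: St; left.
- by apply: St; right.
- by exists m; [right|move=> y [->|/Hm]].
- by exists x; [left|move=> y [->//|/Hm ym]; exact: le_trans mx].
Qed.

Lemma chain_min S t : finite_set S -> S !=set0 -> (forall x, S x -> tle x t) ->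
  exists2 m, S m & forall x, S x -> tle m x.
Proof.
move=> fS; elim/finite_set_ind: S / fS => [[x []]|S x _ _ IH _ St].
case: (pselect (S !=set0)) => [S0|nS]; last first.
  by exists x; [left|move=> y [->|Sy] //; case: nS; exists y].
have [|m Sm Hm] := IH S0; first by move=> y Sy; apply: St; right.
case: (@le_lin t x m) => [||xm|mx].
- by apply: St; left.
- by apply: St; right.
- by exists x; [left|move=> y [->//|/Hm ym]; exact: le_trans ym].
- by exists m; [right|move=> y [->|/Hm]].
Qed.

Lemma closed_min S C : finite_set S -> S !=set0 -> S `<=` C ->
  (forall x y, C x -> C y -> C (tmeet x y)) ->
  exists2 m, C m & forall x, S x -> tle m x.
Proof.
move=> fS S0 SC cC; elim/finite_set_ind: S / fS S0 SC => [[x []]|S x _ _ IH _ SC].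
have Cx : C x by apply: SC; left.
case: (pselect (S !=set0)) => [S0|nS]; last first.
  by exists x => // y [->|Sy] //; case: nS; exists y.
have [|m Sm Hm] := IH S0; first by move=> y Sy; apply: SC; right.
exists (tmeet x m); first exact: cC.
by move=> y [->//|/Hm]; exact: le_trans.
Qed.

(** The meets of [a] with the points of [A] form a chain below [a]. The largest one, [e], is where
    [a] branches off from [A], and the only point that closure requires. [A'] contains it unless it
    is [a] itself. *)
Lemma tree_splits_within : splits_within T.
Proof.
move=> A C a fC /meet_closedP cA /meet_closedP cC AC Ca na.
have fA : finite_set A by exact: sub_finite_set fC.
case: (pselect (A !=set0)) => [[c1 Ac1]|A0]; last first.
  have nA x : ~ A x by move=> Ax; apply: A0; exists x.
  exists A; split=> //; first exact/meet_closedP.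
  apply/meet_closedP => x y [->|/nA//] [->|/nA//]; left; exact: meet_le.
have [|||_ [c0 Ac0 <-]] := @chain_max ((fun c => tmeet a c) @` A) a.
- exact: finite_image.
- by exists (tmeet a c1); exists c1.
- by move=> _ [c _ <-].
set e := tmeet a c0 => emax.
have Ce : C e by apply: cC => //; exact: AC.
have ea : tle e a by exact: meet_l.
have ec0 : tle e c0 by exact: meet_r.
have ae x : A x -> tmeet a x = tmeet e x.
  move=> Ax; apply: meet_eq => [||w wa wx].
  - by apply: le_trans ea; exact: meet_l.
  - exact: meet_r.
  - apply: meet_glb => //; apply: le_trans (emax (tmeet a x) _); last by exists x.
    exact: meet_glb.
(* [e] and the meet of [c0] and [x] both lie below [c0], so they are comparable. *)
have eA x : A x -> A (tmeet e x) \/ tmeet e x = e.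
  move=> Ax; case: (@le_lin c0 e (tmeet c0 x)) => // [H|H].
    by right; apply: meet_le; apply: le_trans H _.
  left; rewrite (_ : tmeet e x = tmeet c0 x); first exact: cA.
  apply: meet_eq => // w we wx; apply: meet_glb => //; exact: le_trans ec0.
pose A' x := (A x \/ x = e) /\ x <> a.
have A'm x : A x -> e <> a -> A' (tmeet e x).
  move=> Ax ne; case: (eA x Ax) => [Ame|->]; last by split; [right|].
  by split; [left|move=> xa; apply: na; rewrite -xa].
exists A'; split.
- by move=> x Ax; split; [left|move=> xa; apply: na; rewrite -xa].
- by move=> x [[/AC|->]].
- by case.
- apply/meet_closedP => x y [[Ax|->] xa] [[Ay|->] ya].
  + by split; [left; exact: cA|move=> E; apply: na; rewrite -E; exact: cA].
  + by rewrite meetC; exact: A'm.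
  + exact: A'm.
  + by rewrite meet_le //; split; [right|].
have mae x : A x -> (a |` A') (tmeet a x).
  move=> Ax; rewrite ae //; case: (pselect (e = a)) => [E|ne]; last by right; exact: A'm.
  case: (eA x Ax) => [Am|->]; last by left.
  by right; split; [left|move=> xa; apply: na; rewrite -xa].
apply/meet_closedP => x y [->|[[Ax|->] xa]] [->|[[Ay|->] ya]].
- by left; exact: meet_le.
- exact: mae.
- by rewrite meet_ge //; right; split; [right|].
- by rewrite meetC; exact: mae.
- by right; split; [left; exact: cA|move=> E; apply: na; rewrite -E; exact: cA].
- by right; rewrite meetC; exact: A'm.
- by rewrite meet_le //; right; split; [right|].
- by right; exact: A'm.
- by rewrite meet_le //; right; split; [right|].
Qed.

(** The conditions place [b] relative to [A] exactly as [a] is placed, and ensure that meets of [b]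
    with [C] bring no point besides [b]. Where [a] is below [c], so is [b], and the meets with [c]
    are [a] and [b] themselves. *)
Lemma tree_twin A C a b : A `<=` C -> ~ A a -> fun_closed A -> fun_closed C ->
  ~ C b ->
  (forall c, A c -> (tle c b <-> tle c a) /\ (tle b c <-> tle a c)) ->
  (forall c, A c -> tle a c \/ tmeet b c = tmeet a c) ->
  (forall c, C c -> C (tmeet b c) \/ tmeet b c = b) ->
  fun_closed (b |` C) /\ embedding_on (a |` A) (update id a b).
Proof.
move=> AC na /meet_closedP cA /meet_closedP cC nCb Hle Hm Hc.
have Aa c : A c -> c <> a by move=> Ac e; apply: na; rewrite -e.
have Ab c : A c -> c <> b by move=> /AC Cc e; apply: nCb; rewrite -e.
split.
  apply/meet_closedP => x y [->|Cx] [->|Cy].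
  - by left; exact: meet_le.
  - by case: (Hc y Cy); [right|left].
  - by rewrite meetC; case: (Hc x Cx); [right|left].
  - by right; exact: cC.
have uA c : A c -> update id a b c = c by move=> Ac; apply: update_other; exact: Aa.
have um c : A c -> update id a b (tmeet a c) = tmeet b c.
  move=> Ac; case: (pselect (tle a c)) => ac.
    rewrite (meet_le ac) update_same meet_le //.
    by have [_ ->] := Hle c Ac.
  case: (Hm c Ac) => // ->; rewrite update_other // => E; apply: ac; rewrite -E.
  exact: meet_r.
apply: meet_embedding_on.
- move=> x y [->|Ax] [->|Ay] //; rewrite ?update_same ?uA //.
  + by move=> /esym/(Ab _ Ay).
  + by move=> /(Ab _ Ax).
- move=> x y [->|Ax] [->|Ay]; rewrite ?update_same ?uA //.
  + by have [_ ->] := Hle y Ay.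
  + by have [-> _] := Hle x Ax.
- move=> x y [->|Ax] [->|Ay]; rewrite ?update_same ?(uA _ Ax) ?(uA _ Ay).
  + by rewrite !meet_le // update_same.
  + exact: um.
  + by rewrite meetC um // meetC.
  + by rewrite uA //; exact: cA.
Qed.

(** [b] is taken just below [a], above the largest point [s] of [C] strictly below [a]. The points
    of [C] above [b] are then those above [a], and [a'] is not one of them. *)
Lemma tree_twin_below A C a a' : finite_set C -> fun_closed A -> fun_closed C ->
  A `<=` C -> C a -> ~ A a -> C a' -> ~ tle a a' ->
  exists b, [/\ ~ C b, fun_closed (b |` C), embedding_on (a |` A) (update id a b),
    tle b a & ~ tle b a'].
Proof.
move=> fC cA cC AC Ca na Ca' naa'; have /meet_closedP mC := cC.
pose S := [set c | C c /\ (tle c a /\ c <> a)].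
have ne_meet c : ~ tle a c -> tmeet a c <> a.
  by move=> nac E; apply: nac; rewrite -E; exact: meet_r.
have Sm c : C c -> ~ tle a c -> S (tmeet a c).
  by move=> Cc nac; split; [exact: mC|split; [exact: meet_l|exact: ne_meet]].
have [|||s [Cs [sa sna]] smax] := @chain_max S a.
- by apply: sub_finite_set fC => x [].
- by exists (tmeet a a'); exact: Sm.
- by move=> x [_ []].
have [b [[sb snb] [ba bna]]] := dense (conj sa sna).
have nab : ~ tle a b by move=> ab; apply: bna; exact: le_anti.
have nCb : ~ C b.
  by move=> Cb; apply: snb; apply: le_anti => //; apply: smax.
have cb c : C c -> c <> a -> tle c b <-> tle c a.
  move=> Cc ca; split=> [cb|cla]; first exact: le_trans ba.
  by apply: le_trans sb; apply: smax.
have bc c : C c -> tle b c <-> tle a c.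
  move=> Cc; split=> [blc|]; last exact: le_trans.
  apply: contrapT => nac; apply: snb; apply: le_anti => //.
  by apply: le_trans (smax _ (Sm c Cc nac)); exact: meet_glb.
have mE c : C c -> tle a c \/ tmeet b c = tmeet a c.
  move=> Cc; case: (pselect (tle a c)) => nac; [by left|right].
  apply: meet_eq => // [|w wb wc].
    by apply: le_trans sb; apply: smax; exact: Sm.
  by apply: meet_glb => //; exact: le_trans ba.
have Aa c : A c -> c <> a by move=> Ac e; apply: na; rewrite -e.
have [|||cb' eb] := @tree_twin A C a b AC na cA cC nCb.
- by move=> c Ac; split; [apply: cb; [exact: AC|exact: Aa]|apply: bc; exact: AC].
- by move=> c /AC; exact: mE.
- move=> c Cc; case: (mE c Cc) => [ac|->]; last by left; exact: mC.
  by right; apply: meet_le; apply/bc.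
by exists b; split=> //; rewrite bc.
Qed.

(** [b] is taken just above [a], so that no point of [C] comes in between. The direction matters:
    [b] has to stay below the points of [A] that are above [a], without reaching [a']. *)
Lemma tree_twin_above A C a a' : finite_set C -> fun_closed A -> fun_closed C ->
  A `<=` C -> C a -> ~ A a -> C a' -> tle a a' -> a <> a' ->
  exists b, [/\ ~ C b, fun_closed (b |` C), embedding_on (a |` A) (update id a b),
    tle a b & ~ tle a' b].
Proof.
move=> fC cA cC AC Ca na Ca' aa' naa'; have /meet_closedP mC := cC.
have /meet_closedP mA := cA.
have Aa c : A c -> c <> a by move=> Ac e; apply: na; rewrite -e.
have fA : finite_set A by exact: sub_finite_set fC.
(* [w] will bound [b] from above. With [c0] the least point of [A] above [a], it is the meet of [a']
   and [c0]; or [c0] if these two part at [a]; or [a'] if there is no [c0]. *)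
have [w [Cw aw naw Hw Aw]] : exists w, [/\ C w, tle a w, a <> w,
    forall b, tle b w -> b <> w -> ~ tle a' b & forall c, A c -> tle a c -> tle w c].
  case: (pselect (exists2 c, A c & tle a c)) => [[c1 Ac1 ac1]|nc]; last first.
    exists a'; split=> // [b ba' bna' a'b|c Ac ac]; last by case: nc; exists c.
    by apply: bna'; exact: le_anti.
  have [||||c0 [Ac0 ac0] c0min] :=
      @closed_min [set c | A c /\ tle a c] [set c | A c /\ tle a c].
  - by apply: sub_finite_set fA => x [].
  - by exists c1.
  - by [].
  - by move=> x y [Ax ax] [Ay ay]; split; [exact: mA|exact: meet_glb].
  case: (pselect (tmeet a' c0 = a)) => [E|nE].
    exists c0; split=> //.
    + exact: AC.
    + by move=> e; apply: (Aa _ Ac0).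
    + move=> b bc0 bnc0 a'b; apply: naa'; rewrite -E; apply: meet_le.
      exact: le_trans bc0.
    + by move=> c Ac ac; apply: c0min.
  exists (tmeet a' c0); split.
  + by apply: mC => //; exact: AC.
  + exact: meet_glb.
  + by move=> e; apply: nE.
  + move=> b bw bnw a'b; apply: bnw; apply: le_anti => //.
    by apply: le_trans a'b; exact: meet_l.
  + by move=> c Ac ac; apply: le_trans (c0min c (conj Ac ac)); exact: meet_r.
(* [m] is the first point of [C] on the way from [a] up to [w]; density puts [b] strictly between
   [a] and [m]. *)
have [|||m [Cm [am nam mw]] mmin] :=
    @chain_min [set c | C c /\ [/\ tle a c, a <> c & tle c w]] w.
- by apply: sub_finite_set fC => x [].
- by exists w.
- by move=> x [_ []].
have [b [[ab nab] [bm nbm]]] := dense (conj am nam).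
have nmb : ~ tle m b by move=> mb; apply: nbm; exact: le_anti.
have bw : tle b w by exact: le_trans mw.
have na'b : ~ tle a' b.
  by apply: Hw => // e; apply: nmb; rewrite e.
have cb c : C c -> tle c b <-> tle c a.
  move=> Cc; split=> [clb|ca]; last exact: le_trans ab.
  case: (le_lin clb ab) => // ac.
  apply: contrapT => nca; apply: nmb; apply: (le_trans _ clb); apply: mmin.
  split=> //; split=> //; last exact: (le_trans clb bw).
  by move=> e; apply: nca; rewrite -e.
have bc c : A c -> tle b c <-> tle a c.
  move=> Ac; split; first exact: le_trans.
  by move=> /(Aw _ Ac); exact: le_trans.
have mE c : C c -> ~ tle b c -> tmeet b c = tmeet a c.
  move=> Cc nbc.
  (* Otherwise the meet of [m] and [c] would be a point of [C] strictly above [a], hence above [m]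
     by minimality, and [b] would lie below [c]. *)
  have mca : tle (tmeet m c) a.
    case: (@le_lin m (tmeet m c) a) => // amc.
    apply: contrapT => nmca; apply: nbc; apply: le_trans bm _.
    apply: le_trans (meet_r m c); apply: mmin; split; first exact: mC.
    split=> //; first by move=> e; apply: nmca; rewrite -e.
    by apply: le_trans mw; exact: meet_l.
  apply: meet_eq => // [|z zb zc]; first exact: le_trans ab.
  apply: meet_glb => //; apply: le_trans mca; apply: meet_glb => //.
  exact: le_trans bm.
have nCb : ~ C b by move=> Cb; apply: nab; apply: le_anti => //; apply/cb.
have [|||cb' eb] := @tree_twin A C a b AC na cA cC nCb.
- by move=> c Ac; split; [apply: cb; exact: AC|exact: bc].
- move=> c Ac; case: (pselect (tle b c)) => blc; first by left; apply/bc.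
  by right; apply: mE => //; exact: AC.
- move=> c Cc; case: (pselect (tle b c)) => blc; first by right; exact: meet_le.
  by left; rewrite mE //; exact: mC.
by exists b.
Qed.

Lemma tree_separates_twins : separates_twins T.
Proof.
move=> A C a a' fC cA cC AC Ca na _ Ca' aa'.
case: (pselect (tle a a')) => laa'.
  have [b [nCb cb eb ab na'b]] := tree_twin_above fC cA cC AC Ca na Ca' laa' aa'.
  exists b; split=> //; exists tt, (fun i => i != ord0).
  have tE (x : T) : (fun i : 'I_2 => if i != ord0 then b else x) = tuple2 x b.
    by apply/funext => i; rewrite /tuple2; case: eqP.
  by rewrite !tE => -[/(_ ab)].
have [b [nCb cb eb ba nba']] := tree_twin_below fC cA cC AC Ca na Ca' laa'.
exists b; split=> //; exists tt, (fun i => i == ord0).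
have tE (x : T) : (fun i : 'I_2 => if i == ord0 then b else x) = tuple2 b x by [].
by rewrite !tE => -[/(_ ba)].
Qed.

Lemma tree_closed0 : fun_closed (set0 : set T).
Proof. by apply/meet_closedP => x y []. Qed.
End MeetTrees.

(** * Assembling the cases *)

Lemma rational_urysohn_space_not_group_topology (L : language) (M : structure L) :
  rational_urysohn_space M -> ~ zariski_is_group_topology (aut M).
Proof.
case=> {L}{}M HM; have [d dM dE] := urysohn_metric HM.
exact: (urysohn_not_group_topology HM dM dE).
Qed.

Lemma random_tournament_not_group_topology (L : language) (M : structure L) :
  random_tournament M -> ~ zariski_is_group_topology (aut M).
Proof. by case=> {L}{}M HM; exact: (tournament_not_group_topology HM). Qed.

Lemma second_factor_properties (L : language) (M : structure L) :
  countable_dense_meet_tree M \/ is_S2 M \/ is_rat_order M ->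
  [/\ inhabited M, fun_closed (set0 : set M), splits_within M & separates_twins M].
Proof.
case=> [|[|]]; case=> {L}{}M.
- move=> _ iM dM; split=> //.
  + exact: tree_closed0.
  + exact: tree_splits_within.
  + exact: tree_separates_twins.
- move=> _ _ /circular_twins[iM tM twM]; split=> //.
  + exact: fun_closed_relational.
  + exact: relational_splits_within.
  + exact: local_twins_separate.
- move=> /rat_order_twins[iM tM twM]; split=> //.
  + exact: fun_closed_relational.
  + exact: relational_splits_within.
  + exact: local_twins_separate.
Qed.

Lemma is_superposition_not_group_topology (L1 L2 : language)
    (K1 : str_class L1) (K2 : str_class L2) (M1 : structure L1) (M2 : structure L2)
    (L : language) (K : str_class L) (M : structure L) :
  is_superposition K1 K2 K -> fraisse_limit K M -> relational L1 ->
  fraisse_limit K1 M1 -> fraisse_limit K2 M2 ->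
  strong_amalgamation K1 -> strong_amalgamation K2 ->
  inhabited M1 -> distinguishes_points M1 ->
  [/\ inhabited M2, fun_closed (set0 : set M2), splits_within M2 & separates_twins M2] ->
  ~ zariski_is_group_topology (aut M).
Proof.
(* Case analysis on the indexed [is_superposition] identifies the language and class of [M] with
   those of the superposition. *)
move=> sup; case: sup M => {L K} M HM rL1 HM1 HM2 s1 s2 iM1 d1 [iM2 c0 sp2 tw2].
exact: (superposition_not_group_topology rL1 HM1 HM2 HM s1 s2 iM1 iM2 c0 d1 sp2 tw2).
Qed.

Theorem theoremE (L : language) (K : str_class L) (M : structure L)
  (HK : fraisse_class K) (HM : fraisse_limit K M)
  (Hcase :
    (* (1) *)
    [/\ free_amalgamation_class K, ~ trivial_structure M
      & point_transitive M] \/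
    (* (2) *)
    rational_urysohn_space M \/
    (* (3) *)
    random_tournament M \/
    (* (4) *)
    exists (L1 L2 : language) (K1 : str_class L1) (K2 : str_class L2)
           (M1 : structure L1) (M2 : structure L2),
      is_superposition K1 K2 K /\
      [/\ relational L1, fraisse_class K1, strong_amalgamation K1
        & fraisse_limit K1 M1] /\
      [/\ fraisse_class K2, strong_amalgamation K2 & fraisse_limit K2 M2] /\
      ~ trivial_structure M1 /\
      (rational_urysohn_space M1 \/
       finite_language L1 /\ pair_transitive M1) /\
      (countable_dense_meet_tree M2 \/ is_S2 M2 \/ is_rat_order M2)) :
  ~ zariski_is_group_topology (aut M).
Proof.
case: Hcase => [[fa nt pt]|[ru|[rt|]]].
- have rL : relational L by case: fa.
  exact: (free_amalgamation_not_group_topology HM fa pt (nontrivial_inhabited HM rL nt) nt).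
- exact: rational_urysohn_space_not_group_topology.
- exact: random_tournament_not_group_topology.
case=> L1 [L2 [K1 [K2 [M1 [M2 [sup [[rL1 _ s1 HM1] [[_ s2 HM2] [nt1 [c1 c2]]]]]]]]]].
apply: (is_superposition_not_group_topology sup HM rL1 HM1 HM2 s1 s2).
- exact: nontrivial_inhabited HM1 rL1 nt1.
- case: c1 => [|[_ pt]]; first exact: urysohn_distinguishes.
  exact: pair_transitive_distinguishes HM1 rL1 nt1 s1 pt.
- exact: second_factor_properties.
Qed.
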